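(* Suppose a group $\Gamma$ has a central subgroup $\Delta$ such that both $\Delta$ and $\Gamma/\Delta$ are finitely generated abelian groups. Then $C^*(\Gamma)$ is strongly quasidiagonal.
   Context: Groups are discrete; $C^*(\Gamma)$ is the full group C*-algebra. A separable set $\Omega\subset B(H)$, $H$ a separable Hilbert space, is quasidiagonal if there is an increasing sequence of compact self-adjoint projections $P_n$ with $P_n\to1_H$ strongly and $\|P_nT-TP_n\|\to0$ for every $T\in\Omega$. A separable C*-algebra $A$ is strongly quasidiagonal if $\sigma(A)$ is a quasidiagonal set of operators for every representation $\sigma$ of $A$ (on a separable Hilbert space). *)

(* Defs.v *)
(* The complex numbers are R[i], for an arbitrary realType R. *)
From HB Require Import structures.
From mathcomp Require Import all_boot all_order all_algebra finmap.
From mathcomp Require Import complex.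
From mathcomp Require Import all_classical all_reals all_analysis.

Set Implicit Arguments.
Unset Strict Implicit.
Unset Printing Implicit Defensive.

Import Order.TTheory GRing.Theory Num.Theory.
Import numFieldNormedType.Exports.

Local Open Scope classical_set_scope.
Local Open Scope ring_scope.

Section GroupNotions.
Local Open Scope group_scope.
Local Open Scope quotient_scope.

Definition generated (G : groupType) (s : seq G) : set G :=
  [set x | forall K : groupClosed G, {subset s <= K} -> x \in K].

Definition finitely_generated (G : groupType) (S : set G) : Prop :=
  exists s : seq G, S = generated s.

Definition abelian (G : groupType) (S : set G) : Prop :=
  forall x y, S x -> S y -> commute x y.

Definition central (G : groupType) (D : {pred G}) : Prop :=
  forall x y, x \in D -> commute x y.

Record normalSubgroup (G : groupType) := NormalSubgroup {
  nsubgroup :> groupClosed G;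
  nsubgroupJ : forall x y, x \in nsubgroup -> x ^ y \in nsubgroup }.

Lemma centralJ (G : groupType) (D : groupClosed G) (Dc : central D) x y :
  x \in D -> x ^ y \in D.
Proof. by move=> Dx; rewrite conjgE (Dc x y Dx) mulKg. Qed.

Definition central_normal (G : groupType) (D : groupClosed G)
  (Dc : central D) : normalSubgroup G := NormalSubgroup (centralJ Dc).

Section Quotient.
Variables (G : groupType) (D : normalSubgroup G).

Definition same_coset (x y : G) : bool := x^-1 * y \in D.

Lemma same_coset_refl : reflexive same_coset.
Proof. by move=> x; rewrite /same_coset mulVg gpred1. Qed.

Lemma same_coset_sym : symmetric same_coset.
Proof. by move=> x y; rewrite /same_coset -gpredV invgM invgK. Qed.

Lemma same_coset_trans : transitive same_coset.
Proof.
move=> y x z xy yz; rewrite /same_coset -[z](mulVKg y) mulgA.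
exact: gpredM.
Qed.

Canonical same_coset_equiv :=
  EquivRel same_coset same_coset_refl same_coset_sym same_coset_trans.

Definition quotient := {eq_quot same_coset}.

HB.instance Definition _ := Choice.on quotient.
HB.instance Definition _ := EqQuotient.on quotient.

Lemma same_cosetP x y : reflect (\pi_quotient x = \pi_quotient y)
  (same_coset x y).
Proof. by apply: (iffP idP) => [xy|/eqmodP//]; apply/eqmodP. Qed.

Definition quotient_one : quotient := \pi_quotient 1.
Definition quotient_mul (a b : quotient) : quotient :=
  \pi_quotient (repr a * repr b).
Definition quotient_inv (a : quotient) : quotient := \pi_quotient (repr a)^-1.

Lemma same_coset_repr x : same_coset (repr (\pi_quotient x)) x.
Proof. by apply/same_cosetP; rewrite reprK. Qed.

Lemma same_cosetM x x' y y' :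
  same_coset x x' -> same_coset y y' -> same_coset (x * y) (x' * y').
Proof.
move=> xx' yy'; rewrite /same_coset invgM.
have -> : y^-1 * x^-1 * (x' * y') = (x^-1 * x') ^ y * (y^-1 * y').
  by rewrite conjgE !mulgA mulgK.
by rewrite gpredM // nsubgroupJ.
Qed.

Lemma same_cosetV x x' : same_coset x x' -> same_coset x^-1 x'^-1.
Proof.
rewrite same_coset_sym /same_coset invgK => xx'.
have -> : x * x'^-1 = (x'^-1 * x) ^ x'^-1.
  by rewrite conjgE invgK !mulgA mulgV mul1g.
exact: nsubgroupJ.
Qed.

Lemma quotient_piM x y :
  quotient_mul (\pi_quotient x) (\pi_quotient y) = \pi_quotient (x * y).
Proof. by apply/same_cosetP/same_cosetM; exact: same_coset_repr. Qed.

Lemma quotient_piV x : quotient_inv (\pi_quotient x) = \pi_quotient x^-1.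
Proof. by apply/same_cosetP/same_cosetV; exact: same_coset_repr. Qed.

Lemma quotient_mulA : associative quotient_mul.
Proof.
elim/quotW=> x; elim/quotW=> y; elim/quotW=> z.
by rewrite (quotient_piM y z) (quotient_piM x (y * z)) (quotient_piM x y)
  (quotient_piM (x * y) z) mulgA.
Qed.

Lemma quotient_mul1q : left_id quotient_one quotient_mul.
Proof. by elim/quotW=> x; rewrite quotient_piM mul1g. Qed.

Lemma quotient_mulq1 : right_id quotient_one quotient_mul.
Proof. by elim/quotW=> x; rewrite quotient_piM mulg1. Qed.

Lemma quotient_mulVq : left_inverse quotient_one quotient_inv quotient_mul.
Proof. by elim/quotW=> x; rewrite quotient_piV quotient_piM mulVg. Qed.

Lemma quotient_mulqV : right_inverse quotient_one quotient_inv quotient_mul.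
Proof. by elim/quotW=> x; rewrite quotient_piV quotient_piM mulgV. Qed.

HB.instance Definition _ := isGroup.Build quotient
  quotient_mulA quotient_mul1q quotient_mulq1 quotient_mulVq quotient_mulqV.

End Quotient.
End GroupNotions.

(* The inner product is linear in its first argument. *)
HB.mixin Record NormedModule_isInner (R : realType) H of
    NormedModule R[i] H := {
  inner : H -> H -> R[i];
  innerDZl : forall (a : R[i]) (x y z : H),
    inner (a *: x + y) z = a * inner x z + inner y z;
  innerC : forall x y : H, inner y x = (inner x y)^*;
  inner_norm : forall x : H, inner x x = `|x| ^+ 2 }.

#[short(type="hilbertType")]
HB.structure Definition Hilbert (R : realType) :=
  {H of CompleteNormedModule R[i] H & NormedModule_isInner R H}.

(* C*-algebras are not assumed to be unital. *)
HB.mixin Record NormedModule_isCstar (R : realType) A of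
    NormedModule R[i] A := {
  amul : A -> A -> A;
  adj : A -> A;
  amulA : associative amul;
  amulDZl : forall (a : R[i]) (x y z : A),
    amul (a *: x + y) z = a *: amul x z + amul y z;
  amulDZr : forall (a : R[i]) (x y z : A),
    amul z (a *: x + y) = a *: amul z x + amul z y;
  adjDZ : forall (a : R[i]) (x y : A), adj (a *: x + y) = a^* *: adj x + adj y;
  adjM : forall x y : A, adj (amul x y) = amul (adj y) (adj x);
  adjK : involutive adj;
  norm_amul : forall x y : A, `|amul x y| <= `|x| * `|y|;
  norm_adjM : forall x : A, `|amul (adj x) x| = `|x| ^+ 2 }.

#[short(type="cstarType")]
HB.structure Definition Cstar (R : realType) :=
  {A of CompleteNormedModule R[i] A & NormedModule_isCstar R A}.

Definition separable (T : topologicalType) : Prop :=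
  exists D : set T, countable D /\ dense D.

Section Operators.
Variables (R : realType) (H : hilbertType R).

(* B(H) *)
Record boundedOp := BoundedOp {
  bop :> {linear H -> H};
  bop_continuous : continuous bop }.

(* Norms in H are elements of R[i]; Re recovers the underlying real number. *)
Definition opnorm (T : H -> H) : R :=
  sup [set complex.Re `|T x| | x in [set x : H | `|x| <= 1]].

Definition compact_op (T : boundedOp) : Prop :=
  precompact (T @` [set x : H | `|x| <= 1]).

Definition projection (P : boundedOp) : Prop := forall x, P (P x) = P x.

Definition self_adjoint (T : boundedOp) : Prop :=
  forall x y, inner (T x) y = inner x (T y).

Definition op_le (S T : boundedOp) : Prop :=
  forall x, inner (S x) x <= inner (T x) x.

Definition separable_ops (Omega : set boundedOp) : Prop :=
  exists D : set boundedOp, [/\ countable D, D `<=` Omega &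
    forall T, Omega T -> forall e : R, 0 < e ->
      exists2 S, D S & opnorm (fun x => T x - S x) < e].

Definition quasidiagonal (Omega : set boundedOp) : Prop :=
  [/\ separable H, separable_ops Omega &
  exists P : nat -> boundedOp,
  [/\ forall n, [/\ compact_op (P n), self_adjoint (P n) & projection (P n)],
      forall m n, (m <= n)%N -> op_le (P m) (P n),
      forall x, P n x @[n --> \oo] --> x &
      forall T, Omega T ->
        opnorm (fun x => P n (T x) - T (P n x)) @[n --> \oo] --> (0 : R)]].

End Operators.

Record representation (R : realType) (A : cstarType R) (H : hilbertType R) :=
  Representation {
  rep :> A -> boundedOp H;
  rep_linear : forall (a : R[i]) (x y : A) (v : H),
    rep (a *: x + y) v = a *: rep x v + rep y v;
  rep_mul : forall (x y : A) (v : H), rep (amul x y) v = rep x (rep y v);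
  rep_adj : forall (x : A) (v w : H),
    inner (rep x v) w = inner v (rep (adj x) w) }.

Definition strongly_quasidiagonal (R : realType) (A : cstarType R) : Prop :=
  separable A /\
  forall (H : hilbertType R) (sigma : representation A H),
    separable H -> quasidiagonal (range sigma).

Section GroupCstar.
Variables (R : realType) (G : groupType).

Record unitaryRep (H : hilbertType R) := UnitaryRep {
  urep :> G -> boundedOp H;
  urep1 : forall v, urep 1%g v = v;
  urepM : forall g h v, urep (g * h)%g v = urep g (urep h v);
  urep_unitary : forall g v w, inner (urep g v) (urep g w) = inner v w }.

(* The group algebra C[G]. *)
Definition groupAlgebra := {fsfun G -> R[i] with 0}.

(* The linear extension to C[G] of a map u defined on G. *)
Definition lin_ext (V : lmodType R[i]) (u : G -> V) (f : groupAlgebra) : V :=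
  \sum_(g <- finsupp f) f g *: u g.

(* The norm of f in C*(G): the supremum of the operator norms of pi(f) over all
   unitary representations pi of G; it is at most the l^1 norm of f. *)
Definition universal_norm (f : groupAlgebra) : R :=
  sup [set r | exists (H : hilbertType R) (pi : unitaryRep H),
    r = opnorm (fun v => lin_ext (fun g => pi g v) f)].

(* (A, u) is the full group C*-algebra of G: the completion of the *-algebra
   C[G] for its universal norm, u being the inclusion of G. The first two
   conditions say that the extension of u to C[G] is a *-homomorphism. *)
Definition is_full_group_cstar (A : cstarType R) (u : G -> A) : Prop :=
  [/\ forall g h, u (g * h)%g = amul (u g) (u h),
      forall g, u (g^-1)%g = adj (u g),
      forall f, complex.Re `|lin_ext u f| = universal_norm f &
      dense (range (lin_ext u))].

End GroupCstar.

(* Main.v *)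
Require Import Defs.
From HB Require Import structures.
From mathcomp Require Import all_boot all_order all_algebra finmap.
From mathcomp Require Import complex.
From mathcomp Require Import all_classical all_reals all_analysis.
From mathcomp Require Import ring lra zify.

Set Implicit Arguments.
Unset Strict Implicit.
Unset Printing Implicit Defensive.

Import Order.TTheory GRing.Theory Num.Theory.

Local Open Scope classical_set_scope.
Local Open Scope ring_scope.
Local Notation Re := complex.Re.
Local Notation "a %:C" := (real_complex _ a) (format "a %:C") : ring_scope.

(** * Complex modulus and inner product spaces *)

(** Since Gamma / Delta is abelian, all commutators of Gamma lie in the central subgroup Delta, so
    Gamma is a finitely generated group of class two and hence a quotient of [heis d]
    ([heis_cover]). A representation of the algebra gives an action of [heis d] by operators on H.
    It suffices to build an increasing sequence of finite-dimensional subspaces with dense union,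
    ever more invariant under the d generators: their projections then asymptotically commute with
    the generators, and the elements with which they asymptotically commute form a closed
    star-subalgebra ([rep_quasidiagonal], using that representations are contractive, [rep_contr]).
    A small perturbation makes approximate containment of finitely many vectors exact ([perturb]),
    so everything rests on a local statement, [piece_qd]: finitely many vectors are approximated by
    a finite-dimensional almost invariant subspace.

    The local statement survives orthogonal sums with the same constant ([qd_add]) and strong
    approximation ([qd_approx]), so the space may be cut by spectral projections of central
    elements. One family of cuts arranges that each of finitely many central commutators either acts
    trivially or stays away from 1 ([dich_cut]); another makes finitely many central elements nearly
    scalar ([cut_centrals]). The vectors k whose commutators act trivially form a lattice, and the
    Smith normal form gives a basis adapted to its relevant part ([smith_lattice]). The near
    scalars, once the commutator phases are rounded to rational numbers, come from a character that
    induces a finite-dimensional monomial representation K ([character_data]).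

    On an infinite-dimensional piece K is absorbed ([absorb]). A Folner function on the orbit of K
    ([folner_function]) averages maps into almost equivariant ones ([transfer_intertwines]), which
    embeds the piece into a multiple of K. Conversely, commutators staying away from 1 yield unit
    vectors whose translates by different coset representatives are nearly orthogonal
    ([diffuse_supply]), which embeds finite-dimensional multiples of K back into the piece,
    orthogonally to any finite set. Glued by a quasicentral finite-rank contraction
    ([quasicentral]), the two maps give a finite-dimensional almost invariant subspace containing
    the given vectors. *)

Section ComplexModulus.
Variable R : realType.
Implicit Types (a b : R) (z w : R[i]).

Definition cabs z : R := Re `|z|.

Lemma cabsE z : `|z| = (cabs z)%:C.
Proof. by rewrite /cabs normc_def. Qed.

Lemma cabs_ge0 z : 0 <= cabs z.
Proof. by rewrite -ler0c -cabsE normr_ge0. Qed.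

Lemma cabsM z w : cabs (z * w) = cabs z * cabs w.
Proof. by apply: complexI; rewrite rmorphM /= -!cabsE normrM. Qed.

Lemma cabsD z w : cabs (z + w) <= cabs z + cabs w.
Proof. by rewrite -lecR rmorphD /= -!cabsE ler_normD. Qed.

Lemma cabsN z : cabs (- z) = cabs z.
Proof. by rewrite /cabs normrN. Qed.

Lemma cabsB z w : cabs (z - w) = cabs (w - z).
Proof. by rewrite -cabsN opprB. Qed.

Lemma cabsJ z : cabs z^* = cabs z.
Proof. by rewrite /cabs norm_conjC. Qed.

Lemma cabs0 : cabs 0 = 0.
Proof. by rewrite /cabs normr0. Qed.

Lemma cabs1 : cabs 1 = 1.
Proof. by rewrite /cabs normr1. Qed.

Lemma cabs_eq0 z : (cabs z == 0) = (z == 0).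
Proof. by rewrite -(inj_eq (@complexI R)) -cabsE normr_eq0. Qed.

Lemma cabs_real a : cabs a%:C = `|a|.
Proof. by rewrite /cabs normc_def /= expr0n /= addr0 sqrtr_sqr. Qed.

Lemma cabsV z : cabs z^-1 = (cabs z)^-1.
Proof. by apply: complexI; rewrite fmorphV /= -!cabsE normfV. Qed.

Lemma cabsX z n : cabs (z ^+ n) = cabs z ^+ n.
Proof. by apply: complexI; rewrite rmorphXn /= -!cabsE normrX. Qed.

Lemma mulJ_cabs z : z * z^* = (cabs z ^+ 2)%:C.
Proof. by rewrite rmorphXn /= -cabsE normCK. Qed.

Lemma cabs_sum (I : Type) (r : seq I) (P : pred I) (F : I -> R[i]) :
  cabs (\sum_(i <- r | P i) F i) <= \sum_(i <- r | P i) cabs (F i).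
Proof.
elim/big_ind2 : _ => [|x1 x2 y1 y2 h1 h2|//]; first by rewrite cabs0.
by rewrite (le_trans (cabsD _ _)) ?lerD.
Qed.

Lemma ReD z w : Re (z + w) = Re z + Re w.
Proof. by case: z w => ? ? []. Qed.

Lemma ReN z : Re (- z) = - Re z.
Proof. by case: z. Qed.

Lemma ReB z w : Re (z - w) = Re z - Re w.
Proof. by rewrite ReD ReN. Qed.

Lemma ReJ z : Re z^* = Re z.
Proof. by case: z. Qed.

Lemma Re_realM a z : Re (a%:C * z) = a * Re z.
Proof. by case: z => x y /=; rewrite mul0r subr0. Qed.

Lemma conj_real a : (a%:C)^* = a%:C :> R[i].
Proof. exact: conjc_real. Qed.

Lemma ler_Re_cabs z : `|Re z| <= cabs z.
Proof. by rewrite -lecR -cabsE; exact: normc_ge_Re. Qed.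

Lemma Re_le_cabs z : Re z <= cabs z.
Proof. exact: le_trans (ler_norm _) (ler_Re_cabs z). Qed.

Lemma ge0_real z : 0 <= z -> z = (Re z)%:C.
Proof. by case: z => a b; rewrite lecE /= => /andP[/eqP->]. Qed.

Lemma ge0_Re z : 0 <= z -> 0 <= Re z.
Proof. by case: z => a b; rewrite lecE /= => /andP[]. Qed.

Lemma Re_sum (I : Type) (r : seq I) (P : pred I) (F : I -> R[i]) :
  Re (\sum_(i <- r | P i) F i) = \sum_(i <- r | P i) Re (F i).
Proof. by elim/big_ind2 : _ => // x1 x2 y1 y2 <- <-; rewrite ReD. Qed.

End ComplexModulus.

(* The form is only semidefinite, so that the Cauchy-Schwarz inequality also
   applies to the forms <T x, y> of positive operators T. *)
Record ipspace (R : realType) := IPSpace {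
  ipcar :> lmodType R[i];
  ip : ipcar -> ipcar -> R[i];
  ipDZl : forall (a : R[i]) (x y z : ipcar),
    ip (a *: x + y) z = a * ip x z + ip y z;
  ipC : forall x y, ip y x = (ip x y)^*;
  ip_ge0 : forall x, 0 <= ip x x }.

Arguments ip {R i} _ _.

Section InnerProduct.
Variables (R : realType) (X : ipspace R).
Implicit Types (x y z : X) (a : R[i]).

Lemma ipDl x y z : ip (x + y) z = ip x z + ip y z.
Proof. by have := ipDZl 1 x y z; rewrite scale1r mul1r. Qed.

Lemma ip0l z : ip 0 z = 0.
Proof. by apply: (addrI (ip 0 z)); rewrite -ipDl !addr0. Qed.

Lemma ipZl a x z : ip (a *: x) z = a * ip x z.
Proof. by rewrite -[_ *: _]addr0 ipDZl ip0l addr0. Qed.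

Lemma ipDr x y z : ip z (x + y) = ip z x + ip z y.
Proof. by rewrite ipC ipDl rmorphD /= -!ipC. Qed.

Lemma ipZr a x z : ip z (a *: x) = a^* * ip z x.
Proof. by rewrite ipC ipZl rmorphM /= -!ipC. Qed.

Lemma ip0r z : ip z 0 = 0.
Proof. by rewrite ipC ip0l rmorph0. Qed.

Lemma ipNl x z : ip (- x) z = - ip x z.
Proof. by rewrite -scaleN1r ipZl mulN1r. Qed.

Lemma ipNr x z : ip z (- x) = - ip z x.
Proof. by rewrite ipC ipNl rmorphN /= -!ipC. Qed.

Lemma ipBl x y z : ip (x - y) z = ip x z - ip y z.
Proof. by rewrite ipDl ipNl. Qed.

Lemma ipBr x y z : ip z (x - y) = ip z x - ip z y.
Proof. by rewrite ipDr ipNr. Qed.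

Lemma ip_suml (I : Type) (r : seq I) (P : pred I) (F : I -> X) z :
  ip (\sum_(i <- r | P i) F i) z = \sum_(i <- r | P i) ip (F i) z.
Proof.
by elim/big_ind2 : _ => [|x1 x2 y1 y2 <- <-|//]; rewrite ?ip0l ?ipDl.
Qed.

Lemma ip_sumr (I : Type) (r : seq I) (P : pred I) (F : I -> X) z :
  ip z (\sum_(i <- r | P i) F i) = \sum_(i <- r | P i) ip z (F i).
Proof.
by elim/big_ind2 : _ => [|x1 x2 y1 y2 <- <-|//]; rewrite ?ip0r ?ipDr.
Qed.

Lemma ip_eq0C x y : ip x y = 0 -> ip y x = 0.
Proof. by move=> h; rewrite ipC h rmorph0. Qed.

Definition nsq x : R := Re (ip x x).
Definition nrm x : R := Num.sqrt (nsq x).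

Lemma nsq_ge0 x : 0 <= nsq x. Proof. exact/ge0_Re/ip_ge0. Qed.
Lemma nrm_ge0 x : 0 <= nrm x. Proof. exact: sqrtr_ge0. Qed.

Lemma ipxx x : ip x x = (nsq x)%:C.
Proof. exact/ge0_real/ip_ge0. Qed.

Lemma nrm2 x : nrm x ^+ 2 = nsq x.
Proof. exact/sqr_sqrtr/nsq_ge0. Qed.

Lemma nsq0 : nsq 0 = 0. Proof. by rewrite /nsq ip0l. Qed.
Lemma nrm0 : nrm 0 = 0. Proof. by rewrite /nrm nsq0 sqrtr0. Qed.

Lemma nsqZ a x : nsq (a *: x) = cabs a ^+ 2 * nsq x.
Proof.
by rewrite /nsq ipZl ipZr mulrA mulJ_cabs Re_realM.
Qed.

Lemma nrmZ a x : nrm (a *: x) = cabs a * nrm x.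
Proof.
by rewrite /nrm nsqZ sqrtrM ?sqr_ge0// sqrtr_sqr ger0_norm ?cabs_ge0.
Qed.

Lemma nrmN x : nrm (- x) = nrm x.
Proof. by rewrite -scaleN1r nrmZ cabsN cabs1 mul1r. Qed.

Lemma nsqN x : nsq (- x) = nsq x.
Proof. by rewrite -!nrm2 nrmN. Qed.

Lemma nrmBC x y : nrm (x - y) = nrm (y - x).
Proof. by rewrite -nrmN opprB. Qed.

Lemma nsqD x y : nsq (x + y) = nsq x + nsq y + 2 * Re (ip x y).
Proof.
rewrite /nsq ipDl !ipDr !ReD (ipC x y) ReJ; ring.
Qed.

Lemma nsqB x y : nsq (x - y) = nsq x + nsq y - 2 * Re (ip x y).
Proof. by rewrite nsqD ipNr ReN nsqN mulrN. Qed.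

Lemma pythagoras x y : ip x y = 0 -> nsq (x + y) = nsq x + nsq y.
Proof. by move=> h; rewrite nsqD h mulr0 addr0. Qed.

(** Expand [nsq (x - s <x,y> y) >= 0] for real [s]. If [nsq y = 0] the expression is affine in [s],
    and a large [s] forces [<x,y> = 0]; otherwise take [s = 1 / nsq y]. *)
Lemma cauchy_schwarz_sq x y : cabs (ip x y) ^+ 2 <= nsq x * nsq y.
Proof.
set a := cabs _ ^+ 2.
have key (s : R) : 0 <= nsq x - 2 * s * a + s ^+ 2 * a * nsq y.
  have := nsq_ge0 (x - (s%:C * ip x y) *: y).
  rewrite nsqB nsqZ ipZr rmorphM /= conj_real -mulrA Re_realM mulrC.
  rewrite [_^* * _]mulrC mulJ_cabs /= cabsM cabs_real exprMn real_normK ?num_real//.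
  by rewrite -/a; congr (0 <= _); ring.
have a0 : 0 <= a by rewrite sqr_ge0.
have [y0|] := eqVneq (nsq y) 0.
  rewrite y0 mulr0.
  have [//|a1] := leP a 0.
  have := key ((nsq x + 1) / (2 * a)); rewrite y0 mulr0 addr0.
  have -> : 2 * ((nsq x + 1) / (2 * a)) * a = nsq x + 1.
    by field; rewrite gt_eqF.
  by lra.
move=> y0; have y1 : 0 < nsq y by rewrite lt_neqAle eq_sym y0 nsq_ge0.
have := key (nsq y)^-1.
have -> : nsq x - 2 * (nsq y)^-1 * a + (nsq y)^-1 ^+ 2 * a * nsq y =
  nsq x - a / nsq y by field.
by rewrite subr_ge0 ler_pdivrMr.
Qed.

Lemma cauchy_schwarz x y : cabs (ip x y) <= nrm x * nrm y.
Proof.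
rewrite -(@ler_pXn2r _ 2)// ?nnegrE ?cabs_ge0 ?mulr_ge0 ?nrm_ge0//.
by rewrite exprMn !nrm2 cauchy_schwarz_sq.
Qed.

Lemma Re_ip_le x y : Re (ip x y) <= nrm x * nrm y.
Proof. exact: le_trans (Re_le_cabs _) (cauchy_schwarz x y). Qed.

Lemma nrm_triangle x y : nrm (x + y) <= nrm x + nrm y.
Proof.
rewrite -(@ler_pXn2r _ 2)// ?nnegrE ?addr_ge0 ?nrm_ge0//.
rewrite nrm2 nsqD -!nrm2.
have := Re_ip_le x y; nra.
Qed.

Lemma nrm_triangleB x y : nrm (x - y) <= nrm x + nrm y.
Proof. by rewrite -[nrm y]nrmN nrm_triangle. Qed.

Lemma nrm_dist x y z : nrm (x - z) <= nrm (x - y) + nrm (y - z).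
Proof. by rewrite -{1}(subrK y x) -addrA nrm_triangle. Qed.

Lemma nrm_rev x y : nrm x - nrm y <= nrm (x - y).
Proof. by rewrite lerBlDr -{1}(subrK y x) nrm_triangle. Qed.

Lemma nrm_sum (I : Type) (r : seq I) (P : pred I) (F : I -> X) :
  nrm (\sum_(i <- r | P i) F i) <= \sum_(i <- r | P i) nrm (F i).
Proof.
elim/big_ind2 : _ => [|x1 x2 y1 y2 h1 h2|//]; first by rewrite nrm0.
by rewrite (le_trans (nrm_triangle _ _)) ?lerD.
Qed.

Lemma parallelogram x y : nsq (x + y) + nsq (x - y) = 2 * nsq x + 2 * nsq y.
Proof. rewrite nsqD nsqB; ring. Qed.

Lemma nsq_sum_orth (I : eqType) (r : seq I) (F : I -> X) : uniq r ->
  {in r &, forall i j, i != j -> ip (F i) (F j) = 0} ->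
  nsq (\sum_(i <- r) F i) = \sum_(i <- r) nsq (F i).
Proof.
elim: r => [|i r IH] /=; first by rewrite !big_nil nsq0.
move=> /andP[ir ur] h; rewrite !big_cons pythagoras ?IH//.
  by move=> j k jr kr; apply: h; rewrite inE ?jr ?kr orbT.
rewrite ip_sumr big_seq big1// => j jr; apply: h; rewrite ?inE ?eqxx ?jr ?orbT//.
by apply: contraNneq ir => ->.
Qed.

Lemma nsq_sumT_orth (I : finType) (F : I -> X) :
  (forall i j, i != j -> ip (F i) (F j) = 0) ->
  nsq (\sum_i F i) = \sum_i nsq (F i).
Proof. by move=> h; apply: nsq_sum_orth; [exact: index_enum_uniq | move=> i j _ _; exact: h]. Qed.

Lemma nrm_leP x (c : R) : 0 <= c -> (nrm x <= c) = (nsq x <= c ^+ 2).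
Proof.
by move=> c0; rewrite -nrm2 ler_pXn2r// nnegrE nrm_ge0.
Qed.

Lemma nrm_le_of_ip x (c : R) : 0 <= c ->
  (forall y, Re (ip x y) <= c * nrm y) -> nrm x <= c.
Proof.
move=> c0 /(_ x); rewrite -/(nsq x) -nrm2.
have := nrm_ge0 x; nra.
Qed.

End InnerProduct.

Section Definite.
Variables (R : realType) (X : ipspace R).
Hypothesis definite : forall x : X, nsq x = 0 -> x = 0.
Implicit Types x y : X.

Lemma nrm_eq0 x : nrm x = 0 -> x = 0.
Proof. by move=> h; apply: definite; rewrite -nrm2 h expr0n. Qed.

Lemma ip_inj x y : (forall z, ip x z = ip y z) -> x = y.
Proof.
move=> h; apply/eqP; rewrite -subr_eq0; apply/eqP/definite.
by rewrite /nsq ipBl h subrr.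
Qed.

(** Operators below are mostly bare functions given with an adjoint; this recovers their
    linearity. *)
Lemma adjointable_linear (f g : X -> X) :
  (forall x y, ip (f x) y = ip x (g y)) -> linear f.
Proof. by move=> h a x y; apply: ip_inj => z; rewrite h !ipDZl !h. Qed.

End Definite.

(** * Spans and orthonormal lists *)

Section LinearMaps.
Variables (K : pzRingType) (U V : lmodType K) (f : U -> V).

Lemma linB x y : linear f -> f (x - y) = f x - f y.
Proof. by move=> h; rewrite addrC -scaleN1r h scaleN1r addrC. Qed.

Lemma lin0 : linear f -> f 0 = 0.
Proof. by move=> h; have := linB 0 0 h; rewrite !subrr. Qed.

Lemma linZ c x : linear f -> f (c *: x) = c *: f x.
Proof. by move=> h; rewrite -[c *: x]addr0 h lin0// addr0. Qed.

Lemma linD x y : linear f -> f (x + y) = f x + f y.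
Proof. by move=> h; have := h 1 x y; rewrite !scale1r. Qed.

Lemma linN x : linear f -> f (- x) = - f x.
Proof. by move=> h; rewrite -sub0r linB// lin0// sub0r. Qed.

Lemma lin_sum (I : Type) (r : seq I) (P : pred I) (F : I -> U) : linear f ->
  f (\sum_(i <- r | P i) F i) = \sum_(i <- r | P i) f (F i).
Proof.
by move=> h; elim/big_rec2 : _ => [|i x y _ <-]; [exact: lin0 | exact: linD].
Qed.

End LinearMaps.

Section Subspaces.
Variables (R : realType) (X : lmodType R[i]).
Implicit Types (D : X -> Prop) (l : seq X).

Definition subsp D := D 0 /\ forall a x y, D x -> D y -> D (a *: x + y).

(** Impredicative, so that applying a membership to a predicate is an induction over the span. *)
Definition span l x := forall D, subsp D -> (forall y, y \in l -> D y) -> D x.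

Lemma subspD D x y : subsp D -> D x -> D y -> D (x + y).
Proof. by move=> [_ h] Dx Dy; have := h 1 _ _ Dx Dy; rewrite scale1r. Qed.

Lemma subspZ D a x : subsp D -> D x -> D (a *: x).
Proof. by move=> [h0 h] Dx; have := h a _ _ Dx h0; rewrite addr0. Qed.

Lemma subspB D x y : subsp D -> D x -> D y -> D (x - y).
Proof.
by move=> h Dx Dy; apply: subspD => //; rewrite -scaleN1r; apply: subspZ.
Qed.

Lemma subsp_sum D (I : eqType) (r : seq I) (P : pred I) (F : I -> X) :
  subsp D -> (forall i, i \in r -> P i -> D (F i)) -> D (\sum_(i <- r | P i) F i).
Proof.
move=> hD h; rewrite big_seq_cond; apply: big_ind; first exact: hD.1.
- by move=> x y; apply: subspD.
- by move=> i /andP[]; exact: h.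
Qed.

Lemma span_subsp l : subsp (span l).
Proof.
split=> [D h _|a x y lx ly D h hl]; first exact: h.1.
by apply: h.2; [apply: lx | apply: ly].
Qed.

Lemma spanZ l a x : span l x -> span l (a *: x).
Proof. exact: (subspZ _ (span_subsp l)). Qed.

Lemma spanD l x y : span l x -> span l y -> span l (x + y).
Proof. exact: (subspD (span_subsp l)). Qed.

Lemma spanB l x y : span l x -> span l y -> span l (x - y).
Proof. exact: (subspB (span_subsp l)). Qed.

Lemma span_mem l x : x \in l -> span l x.
Proof. by move=> lx D _ h; exact: h. Qed.

Lemma span_sub l l' x : (forall y, y \in l -> span l' y) -> span l x -> span l' x.
Proof. by move=> h lx; apply: lx => //; exact: span_subsp. Qed.

End Subspaces.

Section Projections.
Variables (R : realType) (X : ipspace R).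
Implicit Types (l es : seq X) (x y : X).

Lemma subsp_orth y : subsp (fun x : X => ip x y = 0).
Proof.
split=> [|a x z hx hz]; first by rewrite ip0l.
by rewrite ipDZl hx hz mulr0 addr0.
Qed.

Lemma span_orth l x y : (forall z, z \in l -> ip z y = 0) -> span l x -> ip x y = 0.
Proof. by move=> h lx; apply: (lx _ (subsp_orth y)). Qed.

Fixpoint ons l : Prop :=
  if l is e :: l' then [/\ ip e e = 1, forall f, f \in l' -> ip e f = 0 & ons l']
  else True.

Definition proj es x : X := \sum_(e <- es) ip x e *: e.

Lemma proj_linear es : linear (proj es).
Proof.
move=> a x y; rewrite /proj scaler_sumr -big_split /=; apply: eq_bigr => e _.
by rewrite ipDZl scalerDl scalerA.
Qed.

Lemma proj_span es x : span es (proj es x).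
Proof.
apply: (subsp_sum (span_subsp es)) => e ee _. by apply: spanZ; apply: span_mem.
Qed.

Lemma proj_self es x y : ip (proj es x) y = ip x (proj es y).
Proof.
rewrite ip_suml ip_sumr; apply: eq_bigr => e _.
by rewrite ipZl ipZr -ipC mulrC.
Qed.

Lemma proj_orth_mem es x e : ons es -> e \in es -> ip (x - proj es x) e = 0.
Proof.
rewrite ipBl /proj; elim: es => [//|f es IH] /= [f1 fe oe].
rewrite inE big_cons ipDl ipZl => /orP[/eqP->|ees].
  rewrite f1 mulr1 ip_suml big_seq big1 ?addr0 ?subrr// => g ges.
  by rewrite ipZl (ip_eq0C (fe _ ges)) mulr0.
by rewrite fe// mulr0 add0r IH.
Qed.

Lemma proj_orth es x y : ons es -> span es y -> ip (x - proj es x) y = 0.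
Proof.
move=> oe; move/span_orth => h; apply: ip_eq0C; apply: h => e ee.
exact/ip_eq0C/proj_orth_mem.
Qed.

Lemma proj_mem es e : ons es -> e \in es -> proj es e = e.
Proof.
rewrite /proj; elim: es => [//|f es IH] /= [f1 fe oe].
rewrite inE big_cons => /orP[/eqP->|ees].
  rewrite f1 scale1r big_seq big1 ?addr0// => g ges; by rewrite fe// scale0r.
by rewrite (ip_eq0C (fe _ ees)) scale0r add0r IH.
Qed.

Lemma proj_id es x : ons es -> span es x -> proj es x = x.
Proof.
move=> oe /(_ (fun x => proj es x = x)); apply.
  split=> [|a y z hy hz]; first by rewrite /proj big1// => e _; rewrite ip0l scale0r.
  by rewrite proj_linear hy hz.
by move=> e; exact: proj_mem.
Qed.

Lemma proj_idem es x : ons es -> proj es (proj es x) = proj es x.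
Proof. by move=> oe; apply: proj_id => //; exact: proj_span. Qed.

Lemma nsq_projD es x : ons es -> nsq x = nsq (proj es x) + nsq (x - proj es x).
Proof.
move=> oe; rewrite -pythagoras; first by rewrite addrC subrK.
by apply: ip_eq0C; apply: proj_orth => //; exact: proj_span.
Qed.

Lemma nrm_proj es x : ons es -> nrm (proj es x) <= nrm x.
Proof.
move=> oe; rewrite nrm_leP ?nrm_ge0// nrm2 (nsq_projD x oe).
by rewrite lerDl nsq_ge0.
Qed.

Lemma nrm_projC es x : ons es -> nrm (x - proj es x) <= nrm x.
Proof.
move=> oe; rewrite nrm_leP ?nrm_ge0// nrm2 (nsq_projD x oe).
by rewrite lerDr nsq_ge0.
Qed.

Lemma parseval es x : ons es -> nsq (proj es x) = \sum_(e <- es) cabs (ip x e) ^+ 2.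
Proof.
move=> oe; rewrite /nsq proj_self proj_idem// /proj ip_sumr Re_sum.
apply: eq_bigr => e _; rewrite ipZr mulrC mulJ_cabs//.
Qed.

Lemma proj_nearest es x y : ons es -> span es y ->
  nrm (x - proj es x) <= nrm (x - y).
Proof.
move=> oe ey; rewrite nrm_leP ?nrm_ge0// nrm2.
have -> : x - y = (x - proj es x) + (proj es x - y) by rewrite addrA subrK.
rewrite [leRHS]pythagoras; first by rewrite lerDl nsq_ge0.
apply: proj_orth => //; apply: spanB => //; exact: proj_span.
Qed.

(** A vector already in the span leaves a null remainder [w], which definiteness turns into 0, and
    it is dropped. *)
Lemma gram_schmidt (definite : forall x : X, nsq x = 0 -> x = 0) l :
  exists es, [/\ ons es, forall x, span es x -> span l x &
    forall x, span l x -> span es x].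
Proof.
elim: l => [|v l [es [oe el le]]]; first by exists [::].
have lvl y : span l y -> span (v :: l) y.
  by apply: span_sub => z zl; apply: span_mem; rewrite inE zl orbT.
pose w := v - proj es v.
have [w0|w0] := eqVneq (nsq w) 0.
  exists es; split=> // x; first by move/el/lvl.
  apply: span_sub => y; rewrite inE => /orP[/eqP->|yl]; last by apply: le; apply: span_mem.
  by have /eqP := definite _ w0; rewrite subr_eq0 => /eqP ->; exact: proj_span.
have wp : 0 < nrm w by rewrite sqrtr_gt0 lt_neqAle eq_sym w0 nsq_ge0.
pose f : X := ((nrm w)^-1)%:C *: w.
exists (f :: es); split.
- split=> //; last by move=> e ee; rewrite ipZl proj_orth_mem// mulr0.
  rewrite ipxx nsqZ cabs_real -nrm2 -exprMn ger0_norm ?invr_ge0 ?nrm_ge0//.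
  by rewrite mulVf ?gt_eqF// expr1n.
- move=> x; apply: span_sub => y; rewrite inE => /orP[/eqP->|ye].
    apply: spanZ; apply: spanB; first by apply: span_mem; rewrite inE eqxx.
    apply: lvl; apply: el; exact: proj_span.
  apply: lvl; apply: el; exact: span_mem.
have ese y : span es y -> span (f :: es) y.
  by apply: span_sub => z zl; apply: span_mem; rewrite inE zl orbT.
move=> x; apply: span_sub => y; rewrite inE => /orP[/eqP->|yl].
  rewrite -(subrK (proj es v) v); apply: spanD.
    have -> : v - proj es v = (nrm w)%:C *: f.
      by rewrite scalerA -rmorphM /= divff ?gt_eqF// scale1r.
    by apply: spanZ; apply: span_mem; rewrite inE eqxx.
  apply: ese; exact: proj_span.
apply: ese; apply: le; exact: span_mem.
Qed.

End Projections.

(** * Hilbert spaces *)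

(** Completeness is phrased by sequences and [nrm], so that the operator theory uses the inner
    product only; [hilbert] makes every Hilbert space H an instance. *)
Record hspace (R : realType) := HSpace {
  hcar :> ipspace R;
  definite : forall x : hcar, nsq x = 0 -> x = 0;
  complete : forall v : nat -> hcar,
    (forall e : R, 0 < e -> exists N, forall m n, (N <= m)%N -> (N <= n)%N ->
       nrm (v m - v n) <= e) ->
    exists l, forall e : R, 0 < e -> exists N, forall n, (N <= n)%N ->
       nrm (v n - l) <= e }.

Section Limits.
Variable R : realType.

Lemma le0_eps (a : R) : (forall e, 0 < e -> a <= e) -> a <= 0.
Proof. by move=> h; apply/ler_addgt0Pr => e /h; rewrite add0r. Qed.

Lemma cabs_eps0 (z : R[i]) : (forall e, 0 < e -> cabs z <= e) -> z = 0.
Proof.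
by move/le0_eps => h; apply/eqP; rewrite -cabs_eq0 eq_le h cabs_ge0.
Qed.

Lemma archi_inv (e : R) : 0 < e -> exists N, forall n, (N <= n)%N -> n.+1%:R^-1 <= e.
Proof.
move=> e0; exists (Num.truncn e^-1) => n h.
rewrite -[e]invrK lef_pV2 ?posrE ?invr_gt0// ltW//.
by rewrite (lt_le_trans (truncnS_gt _))// ler_nat.
Qed.

End Limits.

Section Spectral.
Variables (R : realType) (X : hspace R).
Implicit Types (x y z : X) (D : X -> Prop) (S T Q : X -> X).

Definition adjoint S S' := forall x y, ip (S x) y = ip x (S' y).
Definition selfadj S := adjoint S S.
Definition commutes S T := forall x, S (T x) = T (S x).
Definition closed_sub D :=
  forall x, (forall e : R, 0 < e -> exists2 y, D y & nrm (x - y) <= e) -> D x.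

Lemma adj_sym S S' : adjoint S S' -> adjoint S' S.
Proof. by move=> h x y; rewrite ipC -h -ipC. Qed.

Lemma adj_linear S S' : adjoint S S' -> linear S.
Proof. exact/adjointable_linear/definite. Qed.

Lemma ip_inj' x y : (forall z, ip x z = ip y z) -> x = y.
Proof. exact/ip_inj/definite. Qed.

Lemma nrm_eps0 x : (forall e, 0 < e -> nrm x <= e) -> x = 0.
Proof.
move/le0_eps => h; apply: (nrm_eq0 (@definite _ X)); apply/eqP.
by rewrite eq_le h nrm_ge0.
Qed.

Lemma nearest_point D x : subsp D -> exists p,
  (forall e : R, 0 < e -> exists2 y, D y & nrm (p - y) <= e) /\
  forall y, D y -> ip (x - p) y = 0.
Proof.
move=> hD.
pose E := [set nsq (x - y) | y in D].
have hE : has_inf E.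
  split; first by exists (nsq (x - 0)), 0 => //; exact: hD.1.
  by exists 0 => _ [y _ <-]; exact: nsq_ge0.
have Ele y : D y -> inf E <= nsq (x - y).
  by move=> Dy; apply: ge_inf; [exact: hE.2 | exists y].
have /choice[v hv] : forall n : nat, exists y, D y /\ nsq (x - y) <= inf E + n.+1%:R^-1.
  move=> n; have [_ [y Dy <-] h] : exists2 r, E r & r < inf E + n.+1%:R^-1.
    by apply: inf_adherent => //; rewrite invr_gt0.
  by exists y; split => //; exact: ltW.
have cauchy m n : nsq (v m - v n) <= 2 * m.+1%:R^-1 + 2 * n.+1%:R^-1.
  have := parallelogram (x - v n) (x - v m).
  have -> : x - v n - (x - v m) = v m - v n by rewrite opprB addrC addrA subrK.
  have -> : x - v n + (x - v m) = (2%:C : R[i]) *: (x - (2^-1%:C : R[i]) *: (v m + v n)).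
    rewrite scalerBr scalerA -rmorphM /= divff// scale1r.
    have -> : (2%:C : R[i]) *: x = x + x.
      by rewrite rmorph_nat scaler_nat mulr2n.
    by rewrite opprD addrACA [- v n - v m]addrC.
  rewrite nsqZ cabs_real normr_nat.
  have := Ele ((2^-1%:C : R[i]) *: (v m + v n)).
  move/(_ (subspZ _ hD (subspD hD (hv m).1 (hv n).1))).
  have := (hv m).2; have := (hv n).2.
  move: (m.+1%:R^-1 : R) (n.+1%:R^-1 : R) => i j; lra.
have [p hp] : exists l, forall e : R, 0 < e -> exists N, forall n, (N <= n)%N ->
    nrm (v n - l) <= e.
  apply: complete => e e0.
  have [|N hN] := @archi_inv R (e ^+ 2 / 4); first by rewrite divr_gt0// exprn_gt0.
  exists N => m n mN nN; rewrite nrm_leP ?(ltW e0)//.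
  have := cauchy m n; have := hN _ mN; have := hN _ nN.
  move: (m.+1%:R^-1 : R) (n.+1%:R^-1 : R) => i j; lra.
exists p; split=> [e e0|y Dy].
  have [N hN] := hp _ e0; exists (v N); first exact: (hv N).1.
  by rewrite nrmBC hN.
(* Moving [v n] by [<x - v n, y> / k] times [y] gains at least [|<x - v n, y>|^2 / k], which cannot
   exceed the defect [1 / (n + 1)]; the added 1 keeps [k] positive. *)
pose k := nsq y + 1; have k0 : 0 < k by rewrite ltr_wpDl ?nsq_ge0.
have small n : cabs (ip (x - v n) y) ^+ 2 <= k * n.+1%:R^-1.
  have := Ele (v n + (k^-1%:C * ip (x - v n) y) *: y).
  move/(_ (subspD hD (hv n).1 (subspZ _ hD Dy))).
  rewrite opprD addrA nsqB nsqZ ipZr rmorphM /= conj_real -mulrA Re_realM.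
  rewrite [_^* * _]mulrC mulJ_cabs /= cabsM cabs_real exprMn real_normK ?num_real//.
  have := (hv n).2; set a := cabs _ ^+ 2; set i := _^-1 => h1 h2.
  have a0 : 0 <= a by rewrite sqr_ge0.
  have h3 : 2 * (k^-1 * a) - k^-1 ^+ 2 * a * nsq y <= i by lra.
  have h4 : k^-1 * a <= 2 * (k^-1 * a) - k^-1 ^+ 2 * a * nsq y.
    have -> : 2 * (k^-1 * a) - k^-1 ^+ 2 * a * nsq y = k^-1 * a + k^-1 ^+ 2 * a.
      have -> : nsq y = k - 1 by rewrite /k addrK.
      by field; rewrite gt_eqF.
    by rewrite lerDl mulr_ge0 ?sqr_ge0.
  by rewrite -ler_pdivrMl//; exact: le_trans h4 h3.
apply: cabs_eps0 => e e0.
have e20 : 0 < e / 2 by rewrite divr_gt0.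
have [N1 hN1] := hp (e / 2 / k) (divr_gt0 e20 k0).
have [|N2 hN2] := @archi_inv R ((e / 2) ^+ 2 / k); first by rewrite divr_gt0// exprn_gt0.
pose n := maxn N1 N2.
have -> : ip (x - p) y = ip (x - v n) y + ip (v n - p) y by rewrite -ipDl addrA subrK.
have -> : e = e / 2 + e / 2 by field.
apply: le_trans (cabsD _ _) _; apply: lerD.
  rewrite -(@ler_pXn2r _ 2)// ?nnegrE ?cabs_ge0 ?(ltW e20)//.
  apply: le_trans (small n) _; rewrite -ler_pdivlMl// mulrC.
  by apply: hN2; rewrite leq_maxr.
apply: le_trans (cauchy_schwarz _ _) _.
apply: (@le_trans _ _ (e / 2 / k * k)); last by rewrite divfK ?gt_eqF.
apply: ler_pM; rewrite ?nrm_ge0 ?hN1 ?leq_maxl//.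
have := nrm2 y; have := nrm_ge0 y; rewrite /k; nra.
Qed.

(** For the commutation clause: [S'] preserves [D], so [S] preserves the orthogonal complement of
    [D]; preserving [D] as well, it commutes with the projection. *)
Lemma closed_projection D : subsp D -> closed_sub D ->
  exists Q, [/\ forall x, D (Q x), forall x, D x -> Q x = x, selfadj Q &
    forall S S', adjoint S S' -> (forall x, D x -> D (S x)) ->
      (forall x, D x -> D (S' x)) -> commutes S Q].
Proof.
move=> hD cD.
have /choice[Q hQ] : forall x, exists p, D p /\ forall y, D y -> ip (x - p) y = 0.
  move=> x; have [p [h1 h2]] := nearest_point x hD.
  by exists p; split=> //; exact: cD.
have uniq x p : D p -> (forall y, D y -> ip (x - p) y = 0) -> Q x = p.
  move=> Dp hp; apply/eqP; rewrite -subr_eq0; apply/eqP/definite.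
  have Dd := subspB hD (hQ x).1 Dp.
  rewrite /nsq -[X in ip X _](_ : (x - p) - (x - Q x) = _); last first.
    by rewrite opprB addrC addrA subrK.
  by rewrite ipBl hp// (hQ x).2// subrr.
exists Q; split.
- by move=> x; exact: (hQ x).1.
- by move=> x Dx; apply: uniq => // y _; rewrite subrr ip0l.
- move=> x y.
  have h1 : ip (Q x) y = ip (Q x) (Q y).
    apply/eqP; rewrite -subr_eq0 -ipBr ipC (hQ y).2 ?rmorph0//.
    exact: (hQ x).1.
  by rewrite h1; apply/eqP; rewrite eq_sym -subr_eq0 -ipBl (hQ x).2 ?eqxx//; exact: (hQ y).1.
move=> S S' SS' h h' x; apply/esym/uniq; first exact/h/(hQ x).1.
move=> y Dy.
have /adj_linear lS := SS'.
have -> : S x - S (Q x) = S (x - Q x).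
  have -> : x - Q x = (-1) *: Q x + x by rewrite scaleN1r addrC.
  by rewrite lS scaleN1r addrC.
by rewrite SS' (hQ x).2//; exact: h'.
Qed.

(** The identity [<S x, z> = <x, S' z>] makes every coefficient of [S x] continuous in [x]. *)
Lemma ker_closed S S' : adjoint S S' ->
  subsp (fun x => S x = 0) /\ closed_sub (fun x => S x = 0).
Proof.
move=> h; have lS := adj_linear h.
have S0 : S 0 = 0 by apply: ip_inj' => z; rewrite h !ip0l.
split.
  by split=> // a x y hx hy; rewrite lS hx hy scaler0 addr0.
move=> x hx; apply: ip_inj' => z; rewrite h ip0l; apply: cabs_eps0 => e e0.
have k0 : 0 < nrm (S' z) + 1 by rewrite ltr_wpDl ?nrm_ge0.
have [y Sy hy] := hx _ (divr_gt0 e0 k0).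
have -> : ip x (S' z) = ip (x - y) (S' z).
  by rewrite ipBl -(h y) Sy ip0l subr0.
apply: le_trans (cauchy_schwarz _ _) _.
apply: (@le_trans _ _ (e / (nrm (S' z) + 1) * (nrm (S' z) + 1))).
  by rewrite ler_pM ?nrm_ge0// lerDl.
by rewrite divfK// gt_eqF.
Qed.

End Spectral.

(** * A square root and a spectral splitting *)

Section PositiveForm.
Variables (R : realType) (X : hspace R) (T : X -> X).
Hypothesis Tself : selfadj T.
Hypothesis Tpos : forall x, 0 <= Re (ip (T x) x).

Lemma selfadj_form_real x : ip (T x) x = (Re (ip (T x) x))%:C.
Proof.
have : ip (T x) x = (ip (T x) x)^* by rewrite -ipC -Tself.
case: (ip _ _) => a b /= [] h; congr Complex; lra.
Qed.

Fact form_DZl (a : R[i]) (x y z : X) :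
  ip (T (a *: x + y)) z = a * ip (T x) z + ip (T y) z.
Proof. by rewrite (adj_linear Tself) ipDZl. Qed.

Fact form_C (x y : X) : ip (T y) x = (ip (T x) y)^*.
Proof. by rewrite -ipC Tself. Qed.

Fact form_ge0 x : 0 <= ip (T x) x.
Proof. by rewrite selfadj_form_real ler0c. Qed.

Definition form_space : ipspace R :=
  @IPSpace R X (fun x y => ip (T x) y) form_DZl form_C form_ge0.

(** Cauchy-Schwarz for the form [<T x, y>] at [y = T x] gives [|T x|^4 <= <T x, x> <T (T x), T x>],
    and the hypothesis bounds both factors. *)
Lemma form_bound (r : R) : 0 <= r ->
  (forall x, Re (ip (T x) x) <= r * nsq x) -> forall x, nrm (T x) <= r * nrm x.
Proof.
move=> r0 h x.
have := @cauchy_schwarz_sq _ form_space x (T x).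
rewrite /nsq /= => cs.
have := h x; have := h (T x); rewrite -/(nsq _) => h1 h2.
have p1 := Tpos x; have p2 := Tpos (T x).
have : (nsq (T x)) ^+ 2 <= (r * nsq x) * (r * nsq (T x)).
  apply: le_trans (le_trans cs _).
    rewrite -(@ger0_norm _ (nsq (T x))) ?nsq_ge0// -cabs_real -ipxx//.
  exact: ler_pM.
move=> key; rewrite nrm_leP ?mulr_ge0 ?nrm_ge0// exprMn nrm2.
have q1 := nsq_ge0 x; have := nsq_ge0 (T x); rewrite le_eqVlt => /predU1P[<-|q2].
  by rewrite mulr_ge0 ?sqr_ge0.
rewrite -(ler_pM2r q2) -expr2; apply: le_trans key _.
by rewrite expr2 !mulrA [_ * nsq x * r]mulrAC.
Qed.

End PositiveForm.

Section SquareRoot.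
Variables (R : realType) (X : hspace R) (a : X -> X).
Hypothesis aself : selfadj a.
Hypothesis a1 : forall x, nrm (a x) <= nrm x.

Fixpoint sqs n : R := if n is n'.+1 then (1 + sqs n' ^+ 2) / 2 else 0.

(* The iterates converge in norm, dominated by the scalar ones [sqs], to a
   solution of [z = (a + z ^ 2) / 2], so that [(1 - z) ^ 2 = 1 - a]. *)
Fixpoint sqz n : X -> X :=
  if n is n'.+1 then fun x => (2^-1)%:C *: (a x + sqz n' (sqz n' x)) else fun=> 0.

Lemma sqs_ge0 n : 0 <= sqs n.
Proof. by case: n => [|n] //=; have := sqr_ge0 (sqs n); lra. Qed.

Lemma sqs_le1 n : sqs n <= 1.
Proof. by elim: n => [|n IH] /=; [exact: ler01|have := sqs_ge0 n; nra]. Qed.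

Lemma sqs_le n m : (n <= m)%N -> sqs n <= sqs m.
Proof.
move=> /subnK <-; elim: (m - n)%N => [|k IH] //.
by rewrite addSn (le_trans IH)//=; have := sqr_ge0 (1 - sqs (k + n)); lra.
Qed.

Lemma sqs_cauchy (e : R) : 0 < e ->
  exists N, forall m, (N <= m)%N -> sqs m - sqs N <= e.
Proof.
move=> e0; pose E := range sqs.
have hE : has_sup E.
  by split; [exists (sqs 0), 0%N | exists 1 => _ [n _ <-]; exact: sqs_le1].
have [_ [N _ <-] h] := sup_adherent e0 hE.
exists N => m _; have : sqs m <= sup E by apply: ub_le_sup; [exact: hE.2 | exists m].
by move: h; lra.
Qed.

Lemma sqz_self n : selfadj (sqz n).
Proof.
elim: n => [|n IH] x y /=; first by rewrite ip0l ip0r.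
by rewrite ipZl ipZr conj_real ipDl ipDr aself !IH.
Qed.

Lemma sqzB n x y : sqz n (x - y) = sqz n x - sqz n y.
Proof.
rewrite addrC -scaleN1r (adj_linear (sqz_self n)) scaleN1r addrC//.
Qed.

Lemma half_ge0 : cabs ((2^-1)%:C : R[i]) = 2^-1.
Proof. by rewrite cabs_real ger0_norm. Qed.

Lemma nrm_sqz n x : nrm (sqz n x) <= sqs n * nrm x.
Proof.
elim: n x => [|n IH] x /=; first by rewrite nrm0 mul0r.
rewrite nrmZ half_ge0.
have h := nrm_triangle (a x) (sqz n (sqz n x)).
have h1 := a1 x; have h2 := IH (sqz n x); have h3 := IH x.
have h4 : sqs n * nrm (sqz n x) <= sqs n * (sqs n * nrm x).
  by rewrite ler_wpM2l ?sqs_ge0.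
lra.
Qed.

(** With [z_n] the iterates, [z_{n+2} - z_{n+1}] is half of [z_{n+1} (z_{n+1} - z_n) + (z_{n+1} -
    z_n) z_n]; the scalars obey the same identity, so the bound propagates. *)
Lemma sqz_step n x : nrm (sqz n.+1 x - sqz n x) <= (sqs n.+1 - sqs n) * nrm x.
Proof.
elim: n x => [|n IH] x; first by rewrite !subr0; exact: nrm_sqz.
have -> : sqz n.+2 x - sqz n.+1 x = (2^-1)%:C *:
   (sqz n.+1 (sqz n.+1 x - sqz n x) + (sqz n.+1 (sqz n x) - sqz n (sqz n x))).
  rewrite [sqz n.+1 (_ - _)]sqzB addrA subrK.
  rewrite [sqz n.+2 x]/= [in LHS](_ : sqz n.+1 x =
    (2^-1)%:C *: (a x + sqz n (sqz n x)))// -scalerBr; congr (_ *: _).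
  by rewrite opprD addrACA subrr add0r.
rewrite nrmZ half_ge0.
have h := nrm_triangle (sqz n.+1 (sqz n.+1 x - sqz n x))
  (sqz n.+1 (sqz n x) - sqz n (sqz n x)).
have h1 := nrm_sqz n.+1 (sqz n.+1 x - sqz n x).
have h2 := IH (sqz n x); have h3 := IH x; have h4 := nrm_sqz n x.
have e : sqs n.+2 - sqs n.+1 = 2^-1 * ((sqs n.+1 + sqs n) * (sqs n.+1 - sqs n)).
  by rewrite /=; field.
have d0 : 0 <= sqs n.+1 - sqs n by rewrite subr_ge0 sqs_le.
have h5 : sqs n.+1 * nrm (sqz n.+1 x - sqz n x) <=
   sqs n.+1 * ((sqs n.+1 - sqs n) * nrm x).
  by rewrite ler_wpM2l ?sqs_ge0.
have h6 : (sqs n.+1 - sqs n) * nrm (sqz n x) <= (sqs n.+1 - sqs n) * (sqs n * nrm x).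
  by rewrite ler_wpM2l.
rewrite e -mulrA ler_wpM2l//.
move: h h1 h2 h5 h6.
move: (nrm _) (nrm (sqz n.+1 (sqz n.+1 x - sqz n x))) (nrm (sqz n.+1 x - sqz n x))
  (nrm (sqz n.+1 (sqz n x) - _)) (nrm (sqz n x)) (nrm x) => p q r s t u.
move: (sqs n.+1) (sqs n) => b c; nra.
Qed.

Lemma sqz_dist n m x : (n <= m)%N ->
  nrm (sqz m x - sqz n x) <= (sqs m - sqs n) * nrm x.
Proof.
move=> /subnK <-; elim: (m - n)%N => [|k IH].
  by rewrite add0n !subrr nrm0 mul0r.
rewrite addSn; apply: le_trans (nrm_dist _ (sqz (k + n) x) _) _.
apply: le_trans (lerD (sqz_step _ x) IH) _.
by rewrite -mulrDl addrA subrK.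
Qed.

Lemma sqz_limit : exists z : X -> X, forall x (e : R), 0 < e ->
  exists N, forall n, (N <= n)%N -> nrm (sqz n x - z x) <= e.
Proof.
suff /choice[z hz] : forall x, exists l, forall e : R, 0 < e ->
    exists N, forall n, (N <= n)%N -> nrm (sqz n x - l) <= e by exists z.
move=> x; apply: complete => e e0.
have k0 : 0 < nrm x + 1 by rewrite ltr_wpDl ?nrm_ge0.
have [N hN] := sqs_cauchy (divr_gt0 (divr_gt0 e0 (ltr0n _ 2)) k0).
have near m : (N <= m)%N -> nrm (sqz m x - sqz N x) <= e / 2.
  move=> Nm; apply: le_trans (sqz_dist x Nm) _.
  apply: (@le_trans _ _ (e / 2 / (nrm x + 1) * (nrm x + 1))).
    by apply: ler_pM; rewrite ?nrm_ge0 ?hN ?subr_ge0 ?sqs_le ?lerDl.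
  by rewrite divfK ?gt_eqF.
exists N => m n Nm Nn; apply: le_trans (nrm_dist _ (sqz N x) _) _.
by have := near _ Nm; have := near _ Nn; rewrite [nrm (sqz N x - _)]nrmBC; lra.
Qed.

(** [A = 1 - z] with [z] the pointwise limit of the iterates. It is positive because [z] is a
    contraction, and it inherits the commutation with [S] from the iterates, which are polynomials
    in [a]. *)
Lemma sqrt_one_minus : exists A : X -> X,
  [/\ selfadj A, forall x, 0 <= Re (ip (A x) x),
      forall x, A (A x) = x - a x &
      forall S S', adjoint S S' -> commutes S a -> commutes S A].
Proof.
have [z hz] := sqz_limit.
have weak x y e : 0 < e -> exists N, forall n, (N <= n)%N ->
    cabs (ip (z x) y - ip (sqz n x) y) <= e.
  move=> e0; have k0 : 0 < nrm y + 1 by rewrite ltr_wpDl ?nrm_ge0.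
  have [N hN] := hz x _ (divr_gt0 e0 k0); exists N => n Nn.
  rewrite -ipBl; apply: le_trans (cauchy_schwarz _ _) _.
  apply: (@le_trans _ _ (e / (nrm y + 1) * (nrm y + 1))).
    by rewrite ler_pM ?nrm_ge0 ?lerDl// nrmBC hN.
  by rewrite divfK ?gt_eqF.
have ip_lim x y x' y' : (forall n, ip (sqz n x) y = ip (sqz n x') y') ->
    ip (z x) y = ip (z x') y'.
  move=> h; apply/eqP; rewrite -subr_eq0; apply/eqP/cabs_eps0 => e e0.
  have e20 : 0 < e / 2 by rewrite divr_gt0.
  have [N1 h1] := weak x y _ e20; have [N2 h2] := weak x' y' _ e20.
  have := h1 _ (leq_maxl N1 N2); have := h2 _ (leq_maxr N1 N2).
  rewrite -h; set n := maxn _ _ => g2 g1.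
  rewrite -(subrK (ip (sqz n x) y) (ip (z x) y)) -addrA.
  apply: le_trans (cabsD _ _) _; move: g2; rewrite cabsB; move: g1; lra.
have zself : selfadj z.
  move=> x y; rewrite [RHS]ipC.
  apply/eqP; rewrite -subr_eq0; apply/eqP/cabs_eps0 => e e0.
  have e20 : 0 < e / 2 by rewrite divr_gt0.
  have [N1 h1] := weak x y _ e20; have [N2 h2] := weak y x _ e20.
  have := h1 _ (leq_maxl N1 N2); have := h2 _ (leq_maxr N1 N2).
  set n := maxn _ _ => g2 g1.
  rewrite -(subrK (ip (sqz n x) y) (ip (z x) y)) -addrA.
  have -> : ip (sqz n x) y - (ip (z y) x)^* = - (ip (z y) x - ip (sqz n y) x)^*.
    by rewrite rmorphB /= -!ipC opprB sqz_self.
  by apply: le_trans (cabsD _ _) _; rewrite cabsN cabsJ; lra.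
have lz := adj_linear zself.
have z1 x : nrm (z x) <= nrm x.
  apply/ler_addgt0Pr => e e0; have [N /(_ _ (leqnn N)) hN] := hz x e e0.
  have := nrm_triangleB (sqz N x) (sqz N x - z x); rewrite opprB addrC subrK.
  have := nrm_sqz N x; have := sqs_le1 N; have := nrm_ge0 x; nra.
have zz x : z x = (2^-1)%:C *: (a x + z (z x)).
  apply/eqP; rewrite -subr_eq0; apply/eqP/nrm_eps0 => e e0.
  have e30 : 0 < e / 3 by rewrite divr_gt0.
  have [N1 h1] := hz x _ e30; have [N2 h2] := hz (z x) _ e30.
  pose n := maxn N1 N2.
  have g1 := h1 n.+1 (leqW (leq_maxl _ _)); have g1' := h1 n (leq_maxl _ _).
  have g2 := h2 n (leq_maxr _ _).
  apply: le_trans (nrm_dist _ (sqz n.+1 x) _) _.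
  have -> : sqz n.+1 x - (2^-1)%:C *: (a x + z (z x)) =
     (2^-1)%:C *: (sqz n (sqz n x - z x) + (sqz n (z x) - z (z x))).
    by rewrite /= -scalerBr opprD addrACA subrr add0r sqzB addrA subrK.
  rewrite nrmZ half_ge0 [nrm (z x - _)]nrmBC.
  have h := nrm_triangle (sqz n (sqz n x - z x)) (sqz n (z x) - z (z x)).
  have h3 := nrm_sqz n (sqz n x - z x).
  have h4 : sqs n * nrm (sqz n x - z x) <= 1 * (e / 3).
    by apply: ler_pM; rewrite ?sqs_ge0 ?nrm_ge0 ?sqs_le1.
  lra.
exists (fun x => x - z x); split.
- by move=> x y; rewrite ipBl ipBr zself.
- move=> x; rewrite ipBl ReB -/(nsq x) -nrm2 subr_ge0.
  by apply: le_trans (Re_ip_le _ _) _; rewrite expr2 ler_wpM2r ?nrm_ge0.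
- move=> x.
  have -> : z (x - z x) = z x - z (z x).
    by rewrite addrC -scaleN1r lz scaleN1r addrC.
  have : (2%:C : R[i]) *: z x = a x + z (z x).
    by rewrite {1}zz scalerA -rmorphM /= mulfV// scale1r.
  rewrite rmorph_nat scaler_nat mulr2n => h.
  have -> : z (z x) = z x + z x - a x by rewrite h addrC addKr.
  rewrite opprB [_ - a x - _]addrAC addrK.
  by rewrite addrA subrK.
move=> S S' SS' Sa.
have lS := adj_linear SS'.
have Sn n : commutes S (sqz n).
  elim: n => [|n IH] x /=.
    by apply: ip_inj' => w; rewrite SS' !ip0l.
  have -> : S ((2^-1)%:C *: (a x + sqz n (sqz n x))) =
     (2^-1)%:C *: (S (a x) + S (sqz n (sqz n x))).
    apply: ip_inj' => w; by rewrite SS' !ipZl !ipDl !SS'.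
  by rewrite Sa !IH.
move=> x; have -> : S (x - z x) = S x - S (z x).
  by rewrite addrC -scaleN1r lS scaleN1r addrC.
congr (_ - _); apply: ip_inj' => w; rewrite SS'; apply: ip_lim => n.
by rewrite -SS' Sn.
Qed.

End SquareRoot.

Section Splitting.
Variables (R : realType) (X : hspace R).
Implicit Types (S T Q : X -> X).

(** Let [A] be the square root of [T^2]. [Q] projects onto the kernel of [A + T], where
    [T = - A <= 0]. Since [(A + T) (A - T) = 0], the operator [A - T] maps into that kernel, so it
    vanishes on the complement, where therefore [T = A >= 0]. [Q] is the spectral projection of [T]
    for the half-line of nonpositive numbers. *)
Lemma spectral_split T (M : R) : selfadj T -> (forall x, nrm (T x) <= M * nrm x) ->
  exists Q, [/\ selfadj Q, forall x, Q (Q x) = Q x,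
    forall S S', adjoint S S' -> commutes S T -> commutes S' T -> commutes S Q,
    forall x, Re (ip (T (Q x)) (Q x)) <= 0 &
    forall x, 0 <= Re (ip (T (x - Q x)) (x - Q x))].
Proof.
move=> Ts TM; have lT := adj_linear Ts.
(* Rescaling [T] to a contraction makes [1 - T^2] one too, as the square root requires. *)
wlog TM1 : T M Ts lT TM / forall x, nrm (T x) <= nrm x.
  move=> wl; pose K := Num.max M 1; have K0 : 0 < K by rewrite lt_max ltr01 orbT.
  pose T' x := (K^-1)%:C *: T x.
  have T's : selfadj T' by move=> x y; rewrite ipZl ipZr conj_real Ts.
  have TK x : T x = K%:C *: T' x by rewrite scalerA -rmorphM /= mulfV ?gt_eqF// scale1r.
  have T'1 x : nrm (T' x) <= nrm x.
    rewrite nrmZ cabs_real gtr0_norm ?invr_gt0// ler_pdivrMl//.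
    by apply: le_trans (TM x) _; rewrite ler_wpM2r ?nrm_ge0// le_max lexx.
  have T'1' x : nrm (T' x) <= 1 * nrm x by rewrite mul1r.
  have [Q [h1 h2 h3 h4 h5]] := wl T' 1 T's (adj_linear T's) T'1' T'1.
  exists Q; split=> //.
  - move=> S S' SS' ST S'T; apply: (h3 _ S') => // x.
      by rewrite /T' linZ ?ST//; exact: adj_linear SS'.
    by rewrite /T' linZ ?S'T//; exact: adj_linear (adj_sym SS').
  - by move=> x; rewrite TK ipZl Re_realM; have := h4 x; rewrite pmulr_rle0.
  - by move=> x; rewrite TK ipZl Re_realM; have := h5 x; rewrite pmulr_rge0.
pose a x := x - T (T x).
have as_ : selfadj a by move=> x y; rewrite /a ipBl ipBr !Ts.
have a1 x : nrm (a x) <= nrm x.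
  rewrite nrm_leP ?nrm_ge0// nrm2 nsqB -Ts -/(nsq (T x)).
  have := TM1 (T x); rewrite nrm_leP ?nrm_ge0// nrm2.
  have := nsq_ge0 (T x); lra.
have [A [As Apos A2 Acom]] := sqrt_one_minus as_ a1.
have comma S S' : adjoint S S' -> commutes S T -> commutes S a.
  by move=> SS' ST x; rewrite /a linB ?ST//; exact: adj_linear SS'.
have A2T x : A (A x) = T (T x) by rewrite A2 /a opprB addrC subrK.
have lA := adj_linear As.
have TA : commutes T A by apply: (Acom T T) => //; exact: (comma T T).
pose B x := A x + T x.
have Bs : selfadj B by move=> x y; rewrite /B ipDl ipDr As Ts.
have [kB cB] := ker_closed Bs.
have [Q [Q1 Q2 Q3 Q4]] := closed_projection kB cB.
have Qidem x : Q (Q x) = Q x by apply: Q2.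
have Bcom S S' : adjoint S S' -> commutes S T -> commutes S' T -> commutes S Q.
  have inv U U' : adjoint U U' -> commutes U T -> forall x, B x = 0 -> B (U x) = 0.
    move=> UU' UT x Bx; have lU := adj_linear UU'.
    rewrite /B -UT -(Acom _ _ UU' (comma _ _ UU' UT)).
    have -> : U (A x) + U (T x) = U (B x).
      by apply: ip_inj' => w; rewrite ipDl !UU' -ipDl.
    by rewrite Bx; apply: ip_inj' => w; rewrite UU' !ip0l.
  move=> SS' ST S'T; apply: (Q4 _ S') => //; first exact: inv SS' ST.
  exact: inv (adj_sym SS') S'T.
exists Q; split=> //.
- move=> x; have := Q1 x; rewrite /B => /eqP; rewrite addrC addr_eq0 => /eqP ->.
  by rewrite ipNl ReN oppr_le0.
move=> x; set y := x - Q x.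
have Qy : Q y = 0 by rewrite /y linB ?Qidem ?subrr//; exact: adj_linear Q3.
clearbody y.
suff -> : T y = A y by [].
have BC : commutes T Q by apply: (Bcom T T).
have AQ : commutes A Q.
  by apply: (Bcom A A) => // w; rewrite -TA.
apply/esym/eqP; rewrite -subr_eq0; apply/eqP.
have <- : Q (A y - T y) = A y - T y.
  apply: Q2; rewrite /B (linB _ _ lA) (linB _ _ lT) A2T TA.
  by rewrite addrA subrK subrr.
by rewrite (linB _ _ (adj_linear Q3)) -AQ -BC Qy (lin0 lA) (lin0 lT) subrr.
Qed.

End Splitting.

(** * The integral Heisenberg group and its representations *)

(* The free-type two-step nilpotent group Z^d x M_d(Z), whose cocycle is the
   full bilinear form k^T l, so that GL_d(Z) acts on it by automorphisms. *)
Definition heis d := ('rV[int]_d * 'M[int]_d)%type.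

Lemma trmx_add (A : nmodType) m n (M N : 'M[A]_(m, n)) : (M + N)^T = M^T + N^T.
Proof. by apply/matrixP => i j; rewrite !mxE. Qed.

Lemma trmx_opp (A : zmodType) m n (M : 'M[A]_(m, n)) : (- M)^T = - M^T.
Proof. by apply/matrixP => i j; rewrite !mxE. Qed.

Section HeisenbergGroup.
Variable d : nat.
Implicit Types g h : heis d.

Definition hmul g h : heis d := (g.1 + h.1, g.2 + h.2 + g.1^T *m h.1).
Definition hinv g : heis d := (- g.1, - g.2 + g.1^T *m g.1).
Definition hone : heis d := (0, 0).

Lemma hmulA g h k : hmul g (hmul h k) = hmul (hmul g h) k.
Proof.
rewrite /hmul /= addrA; congr (_, _).
rewrite trmx_add mulmxDl mulmxDr !addrA.
by rewrite [LHS](ACl (1 * 2 * 5 * 3 * 6 * 4)%AC).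
Qed.

Lemma hmul1 g : hmul g hone = g.
Proof. by case: g => k c; rewrite /hmul /= !addr0 mulmx0 addr0. Qed.

Lemma h1mul g : hmul hone g = g.
Proof. by case: g => k c; rewrite /hmul /= !add0r trmx0 mul0mx addr0. Qed.

Lemma hmulV g : hmul g (hinv g) = hone.
Proof.
case: g => k c; rewrite /hmul /hone /= subrr mulmxN; congr (_, _).
by rewrite addrA subrr add0r subrr.
Qed.

Lemma hVmul g : hmul (hinv g) g = hone.
Proof.
case: g => k c; rewrite /hmul /hone /= addNr trmx_opp mulNmx; congr (_, _).
by rewrite addrAC addrK addNr.
Qed.

Lemma hinvK g : hinv (hinv g) = g.
Proof.
case: g => k c; rewrite /hinv /= opprK trmx_opp mulNmx mulmxN opprK opprD opprK.
by rewrite -addrA addNr addr0.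
Qed.

End HeisenbergGroup.

Arguments hone {d}.

(* [hact hone] is a projection, not necessarily the identity. *)
Record hrep (R : realType) d (X : ipspace R) := HRep {
  hact :> heis d -> X -> X;
  hact_linear : forall g, linear (hact g);
  hactM : forall g h x, hact (hmul g h) x = hact g (hact h x);
  hact_adj : forall g x y, ip (hact g x) y = ip x (hact (hinv g) y) }.

Section Rep.
Variables (R : realType) (d : nat) (X : ipspace R) (p : hrep d X).
Implicit Types (g h : heis d) (x y : X).

Lemma hactV g x : p hone x = x -> p g (p (hinv g) x) = x.
Proof. by move=> h; rewrite -hactM hmulV. Qed.

Lemma hactVK g x : p hone x = x -> p (hinv g) (p g x) = x.
Proof. by move=> h; rewrite -hactM hVmul. Qed.

Lemma hact_one g x : p hone (p g x) = p g x.
Proof. by rewrite -hactM h1mul. Qed.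

Lemma hact_ip g x y : p hone x = x -> ip (p g x) (p g y) = ip x y.
Proof.
by move=> h; rewrite ipC hact_adj hactVK// -ipC.
Qed.

Lemma hact_nsq g x : p hone x = x -> nsq (p g x) = nsq x.
Proof. by move=> h; rewrite /nsq hact_ip. Qed.

Lemma hact_nrm g x : p hone x = x -> nrm (p g x) = nrm x.
Proof. by move=> h; rewrite /nrm hact_nsq. Qed.

End Rep.

(** * Subrepresentations and local quasidiagonality *)

Section Pieces.
Variables (R : realType) (d : nat) (X : hspace R) (p : hrep d X).
Implicit Types (e : X -> X) (g h : heis d) (x y : X).

Definition piece e := [/\ selfadj e, forall x, e (e x) = e x,
  forall g, commutes (p g) e & forall x, p hone (e x) = e x].

Definition subpiece e' e := piece e' /\ forall x, e (e' x) = e' x.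

Lemma subpiece_refl e : piece e -> subpiece e e.
Proof. by move=> he; split=> //; case: he. Qed.

Lemma subpiece_trans e1 e2 e3 : subpiece e1 e2 -> subpiece e2 e3 -> subpiece e1 e3.
Proof. by move=> [h1 h12] [h2 h23]; split=> // x; rewrite -h12 h23. Qed.

Lemma piece_linear e : piece e -> linear e.
Proof. by case=> /adj_linear. Qed.

Lemma piece_nsq e x : piece e -> nsq x = nsq (e x) + nsq (x - e x).
Proof.
move=> he; rewrite -pythagoras; first by rewrite addrC subrK.
have [es ei _ _] := he.
by rewrite es linB ?ei ?subrr ?ip0r//; exact: piece_linear.
Qed.

Lemma piece_nrm e x : piece e -> nrm (e x) <= nrm x.
Proof.
by move=> he; rewrite nrm_leP ?nrm_ge0// nrm2 (piece_nsq x he) lerDl nsq_ge0.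
Qed.

Lemma subpieceP e' e x : subpiece e' e -> e' x = x -> e x = x.
Proof. by move=> [_ h] ex; rewrite -ex h. Qed.

Lemma piece_act e g x : piece e -> e x = x -> e (p g x) = p g x.
Proof. by move=> [_ _ h _] ex; rewrite -h ex. Qed.

Lemma piece_one e x : piece e -> e x = x -> p hone x = x.
Proof. by move=> [_ _ _ h] <-. Qed.

Lemma piece_subsp e : piece e -> subsp (fun x => e x = x).
Proof.
move=> he; have l := piece_linear he; split=> [|a x y ex ey]; first exact: lin0.
by rewrite l ex ey.
Qed.

Lemma restrict_piece e Q : piece e -> selfadj Q -> (forall x, Q (Q x) = Q x) ->
  (forall g, commutes (p g) Q) -> commutes Q e ->
  subpiece (fun x => Q (e x)) e /\ subpiece (fun x => e x - Q (e x)) e.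
Proof.
move=> he Qs Qi Qc Qe; have [es ei ec eu] := he.
have lQ := adj_linear Qs; have le := piece_linear he.
split; split.
- split.
  + by move=> x y /=; rewrite Qs es Qe.
  + by move=> x /=; rewrite -Qe ei Qi.
  + by move=> g x /=; rewrite -ec -Qc.
  + by move=> x /=; rewrite Qc eu.
- by move=> x; rewrite -Qe ei.
- split.
  + by move=> x y /=; rewrite ipBl ipBr; congr (_ - _); rewrite ?Qs es ?Qe.
  + move=> x /=; rewrite (linB _ _ le) ei -Qe ei (linB _ _ lQ) Qi subrr subr0//.
  + by move=> g x /=; rewrite -ec -Qc linB//; exact: hact_linear.
  + by move=> x /=; rewrite linB ?Qc ?eu//; exact: hact_linear.
- by move=> x; rewrite linB// -Qe ei.
Qed.

Definition near e g (t : R[i]) (r : R) :=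
  forall x, e x = x -> nrm (p g x - t *: x) <= r * nrm x.

Definition central_on e g := forall h x, e x = x -> p g (p h x) = p h (p g x).

Lemma near_sub e e' g t r : subpiece e' e -> near e g t r -> near e' g t r.
Proof. by move=> h n x ex; apply: n; exact: subpieceP h ex. Qed.

Lemma central_sub e e' g : subpiece e' e -> central_on e g -> central_on e' g.
Proof. by move=> h n k x ex; apply: n; exact: subpieceP h ex. Qed.

Lemma central_onV e g : piece e -> central_on e g -> central_on e (hinv g).
Proof.
move=> he c h x ex; have u := piece_one he ex.
have -> : p h x = p h (p g (p (hinv g) x)) by rewrite hactV.
rewrite -c ?hactVK//; last by rewrite piece_act.
by rewrite hact_one.
Qed.

Section QD.
Variable us : seq (heis d).

Definition ainv (ep : R) (l : seq X) := forall g, g \in us ->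
  forall y, span l y -> exists2 y', span l y' & nrm (p g y - y') <= ep * nrm y.

(** Local quasidiagonality of the range of [e]. The tolerance [ep] for almost invariance is fixed
    while [eta] is arbitrary, so that cutting into pieces leaves [ep] unchanged. *)
Definition qd ep e := forall (xs : seq X) (eta : R), (forall x, x \in xs -> e x = x) ->
  0 < eta -> exists l, [/\ forall y, y \in l -> e y = y, ainv ep l &
    forall x, x \in xs -> exists2 y, span l y & nrm (x - y) <= eta].

Lemma span_piece e l x : piece e -> (forall y, y \in l -> e y = y) -> span l x -> e x = x.
Proof. by move=> he h /(_ (fun x => e x = x)); apply => //; exact: piece_subsp. Qed.

(** The two lists are concatenated. The defects lie in orthogonal ranges and add by Pythagoras, so
    [ep] does not grow, however many pieces are put together. *)
Lemma qd_add ep e e1 e2 : 0 <= ep -> subpiece e1 e -> subpiece e2 e ->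
  (forall x, e x = e1 x + e2 x) -> (forall x, e1 (e2 x) = 0) ->
  qd ep e1 -> qd ep e2 -> qd ep e.
Proof.
move=> ep0 s1 s2 e12 e12_0 q1 q2 xs eta hx eta0.
have [p1 h1] := s1; have [p2 h2] := s2.
have eta20 : 0 < eta / 2 by rewrite divr_gt0.
have [|//|l1 [a1 b1 c1]] := q1 [seq e1 x | x <- xs] (eta / 2).
  by move=> _ /mapP[x _ ->]; case: p1.
have [|//|l2 [a2 b2 c2]] := q2 [seq e2 x | x <- xs] (eta / 2).
  by move=> _ /mapP[x _ ->]; case: p2.
have orth x y : e1 x = x -> e2 y = y -> ip x y = 0.
  by move=> <- <-; case: p1 => es _ _ _; rewrite es e12_0 ip0r.
have sp1 y : span l1 y -> span (l1 ++ l2) y.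
  by apply: span_sub => z zl; apply: span_mem; rewrite mem_cat zl.
have sp2 y : span l2 y -> span (l1 ++ l2) y.
  by apply: span_sub => z zl; apply: span_mem; rewrite mem_cat zl orbT.
exists (l1 ++ l2); split.
- move=> y; rewrite mem_cat => /orP[/a1|/a2] h.
    exact: subpieceP s1 h.
  exact: subpieceP s2 h.
- move=> g gu y /(_ (fun y => exists y1 y2, [/\ span l1 y1, span l2 y2 & y = y1 + y2])).
  case.
  + split; first by exists 0, 0; rewrite addr0; split=> //; exact: (span_subsp _).1.
    move=> a _ _ [y1 [y2 [sy1 sy2 ->]]] [z1 [z2 [sz1 sz2 ->]]].
    exists (a *: y1 + z1), (a *: y2 + z2); split; [exact: (span_subsp _).2..|].
    by rewrite scalerDr addrACA.
  + move=> z; rewrite mem_cat => /orP[zl|zl].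
      by exists z, 0; rewrite addr0; split=> //; [exact: span_mem|exact: (span_subsp _).1].
    by exists 0, z; rewrite add0r; split=> //; [exact: (span_subsp _).1|exact: span_mem].
  move=> y1 [y2 [sy1 sy2 ->]].
  have [y1' s1' n1] := b1 g gu _ sy1; have [y2' s2' n2] := b2 g gu _ sy2.
  exists (y1' + y2'); first by apply: spanD; [exact: sp1|exact: sp2].
  have d1 := span_piece p1 a1 sy1; have d2 := span_piece p2 a2 sy2.
  have d1' := span_piece p1 a1 s1'; have d2' := span_piece p2 a2 s2'.
  have -> : p g (y1 + y2) - (y1' + y2') = (p g y1 - y1') + (p g y2 - y2').
    have := hact_linear p g 1 y1 y2; rewrite !scale1r => ->.
    by rewrite opprD addrACA.
  rewrite nrm_leP ?mulr_ge0 ?nrm_ge0// pythagoras; last first.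
    apply: orth.
      by apply: (subspB (piece_subsp p1)) => //; exact: piece_act.
    by apply: (subspB (piece_subsp p2)) => //; exact: piece_act.
  rewrite exprMn !nrm2.
  have -> : nsq (y1 + y2) = nsq y1 + nsq y2 by apply: pythagoras; exact: orth.
  move: n1 n2; rewrite !nrm_leP ?mulr_ge0 ?nrm_ge0// !exprMn !nrm2; lra.
move=> x xxs.
have [|y1 s1' n1] := c1 (e1 x); first exact: map_f.
have [|y2 s2' n2] := c2 (e2 x); first exact: map_f.
exists (y1 + y2); first by apply: spanD; [exact: sp1|exact: sp2].
have -> : x - (y1 + y2) = (e1 x - y1) + (e2 x - y2).
  by rewrite -{1}(hx _ xxs) e12 opprD addrACA.
by apply: le_trans (nrm_triangle _ _) _; lra.
Qed.

(** This allows a cut to discard a part of [e]: only the finitely many vectors [xs] have to be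
    nearly in the subpiece. *)
Lemma qd_approx ep e :
  (forall (xs : seq X) (eta : R), (forall x, x \in xs -> e x = x) -> 0 < eta ->
     exists e', [/\ subpiece e' e, qd ep e' & forall x, x \in xs -> nrm (x - e' x) <= eta]) ->
  qd ep e.
Proof.
move=> h xs eta hx eta0; have eta20 : 0 < eta / 2 by rewrite divr_gt0.
have [e' [s q n]] := h xs _ hx eta20.
have [|//|l [a b c]] := q [seq e' x | x <- xs] (eta / 2).
  by move=> _ /mapP[x _ ->]; case: s => [[]].
exists l; split=> //; first by move=> y /a; exact: subpieceP.
move=> x xxs; have [|y sy ny] := c (e' x); first exact: map_f.
exists y => //; apply: le_trans (nrm_dist _ (e' x) _) _.
by have := n _ xxs; lra.
Qed.

End QD.
End Pieces.

(** * Phases *)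

Section CircleExponential.
Variable R : realType.
Implicit Types s t : R.

(** [exp (2 pi i t)]: phases are measured in full turns. *)
Definition ex t : R[i] := Complex (cos (2 * pi * t)) (sin (2 * pi * t)).

Lemma exD s t : ex (s + t) = ex s * ex t.
Proof.
rewrite /ex mulrDr cosD sinD; congr Complex.
by rewrite addrC.
Qed.

Lemma ex0 : ex 0 = 1.
Proof. by rewrite /ex mulr0 cos0 sin0. Qed.

Lemma exN t : ex (- t) = (ex t)^*.
Proof. by rewrite /ex mulrN cosN sinN. Qed.

Lemma cabs_ex t : cabs (ex t) = 1.
Proof. by rewrite /cabs normc_def /= cos2Dsin2 sqrtr1. Qed.

Lemma ex1 : ex 1 = 1.
Proof.
have e : 2 * pi * 1 = pi *+ 2 :> R by rewrite mulr1 mulr_natl.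
by rewrite /ex e cos2pi sin2pi.
Qed.

Lemma exMn t n : ex (n%:R * t) = ex t ^+ n.
Proof.
elim: n => [|n IH]; first by rewrite mul0r ex0.
by rewrite -natr1 mulrDl mul1r exD IH exprSr.
Qed.

Lemma ex_int (j : int) : ex j%:~R = 1.
Proof.
have h n : ex n%:R = 1 by rewrite -[n%:R]mulr1 exMn ex1 expr1n.
case: j => n; first exact: h.
by rewrite NegzE mulrNz exN [X in X^*](h n.+1) rmorph1.
Qed.

Lemma ex_surj z : cabs z = 1 -> exists t, ex t = z.
Proof.
case: z => a b; rewrite /cabs normc_def /= => h.
have ab : a ^+ 2 + b ^+ 2 = 1.
  by rewrite -[LHS]sqr_sqrtr ?addr_ge0 ?sqr_ge0// h expr1n.
have a1 : -1 <= a <= 1 by apply/andP; split; have := sqr_ge0 b; nra.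
have sa : Num.sqrt (1 - a ^+ 2) = `|b| by rewrite -ab addrC addKr sqrtr_sqr.
have k u : 2 * pi * (u / (2 * pi)) = u :> R.
  by rewrite mulrC divfK// mulf_neq0 ?gt_eqF ?pi_gt0.
have [b0|b0] := leP 0 b.
  exists (acos a / (2 * pi)); rewrite /ex k acosK ?sin_acos ?sa ?ger0_norm//.
exists (- acos a / (2 * pi)); rewrite /ex k cosN sinN acosK ?sin_acos ?sa ?in_itv//.
by rewrite ltr0_norm// opprK.
Qed.

Lemma nsq_ex1 t : cabs (ex t - 1) ^+ 2 = 2 - 2 * cos (2 * pi * t).
Proof.
rewrite -[LHS]/(Re ((cabs (ex t - 1) ^+ 2)%:C)) -mulJ_cabs /= oppr0 addr0.
have := cos2Dsin2 (2 * pi * t); nra.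
Qed.

Lemma cos_mono x y : 0 <= x -> x <= y -> y <= pi -> cos y <= cos x :> R.
Proof.
move=> x0 xy yp; have px := le_trans xy yp; have y0 := le_trans x0 xy.
rewrite leNgt ltr_cos ?in_itv /= ?x0 ?px ?y0 ?yp//.
by rewrite -leNgt.
Qed.

Lemma ex_cont (r : R) : 0 < r ->
  exists2 del : R, 0 < del & forall t, `|t| <= del -> cabs (ex t - 1) <= r.
Proof.
move=> r0; pose r' := Num.min r 1.
have r'0 : 0 < r' by rewrite lt_min r0 ltr01.
have r'1 : r' <= 1 by rewrite ge_min lexx orbT.
have r'r : r' <= r by rewrite ge_min lexx.
pose c := 1 - r' ^+ 2 / 2.
have c1 : -1 <= c < 1.
  by rewrite /c; apply/andP; split; nra.
have c2 : -1 <= c <= 1 by case/andP: c1 => -> /ltW.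
have pp := @pi_gt0 R; have tp : 0 < 2 * pi :> R by rewrite mulr_gt0.
exists (acos c / (2 * pi)); first by rewrite divr_gt0// acos_gt0.
move=> t ht; apply: le_trans r'r.
rewrite -(@ler_pXn2r _ 2)// ?nnegrE ?cabs_ge0 ?(ltW r'0)// nsq_ex1.
rewrite -cos_norm normrM gtr0_norm//.
have : cos (acos c) <= cos (2 * pi * `|t|).
  apply: cos_mono; last exact: acos_lepi.
    by rewrite mulr_ge0 ?(ltW tp).
  by rewrite mulrC -ler_pdivlMr.
by rewrite acosK ?in_itv// /c; lra.
Qed.

(** [|ex t - 1|^2 = 2 - 2 cos (2 pi t)] grows with the distance from [t] to the nearest integer,
    which is the floor of [t + 1/2]. *)
Lemma ex_near_int (eta : R) : 0 < eta -> exists2 del : R, 0 < del &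
  forall t, cabs (ex t - 1) <= del -> exists j : int, `|t - j%:~R| <= eta.
Proof.
move=> eta0; pose h := Num.min eta 2^-1.
have h0 : 0 < h by rewrite lt_min eta0 invr_gt0 ltr0n.
have hh : h <= 2^-1 by rewrite ge_min lexx orbT.
have heta : h <= eta by rewrite ge_min lexx.
have pp := @pi_gt0 R; have tp : 0 < 2 * pi :> R by rewrite mulr_gt0.
have c1 : cos (2 * pi * h) < 1.
  have m : 0 <= 2 * pi * h <= pi by rewrite mulr_ge0 ?(ltW tp) ?(ltW h0)//=; nra.
  have : (cos (2 * pi * h) < cos 0) = (0 < 2 * pi * h).
    by apply: ltr_cos; rewrite in_itv /= ?m// lexx pi_ge0.
  by rewrite cos0 => ->; rewrite mulr_gt0.
pose D := Num.min 1 (1 - cos (2 * pi * h)).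
have D0 : 0 < D by rewrite lt_min ltr01 subr_gt0.
have D1 : D <= 1 by rewrite ge_min lexx.
have D2 : D <= 1 - cos (2 * pi * h) by rewrite ge_min lexx orbT.
exists D => // t ht; exists (Num.floor (t + 2^-1)); apply: le_trans heta.
set j := Num.floor _; set s := t - _.
have [j1 j2] : j%:~R <= t + 2^-1 /\ t + 2^-1 < j%:~R + 1.
  by split; [exact: ge_floor | rewrite -intrD1 floorD1_gt].
have s2 : `|s| <= 2^-1 by rewrite ler_norml /s; apply/andP; split; lra.
have es : ex s = ex t by rewrite /s -mulrNz exD ex_int mulr1.
rewrite leNgt; apply/negP => hs.
have : cos (2 * pi * `|s|) <= cos (2 * pi * h).
  apply: cos_mono; first by rewrite mulr_ge0 ?(ltW tp) ?(ltW h0).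
    by rewrite ler_pM2l// ltW.
  by nra.
have -> : cos (2 * pi * `|s|) = cos (2 * pi * s).
  by rewrite -(cos_norm (2 * pi * s)) normrM (gtr0_norm tp).
have := nsq_ex1 s; rewrite es; have := cabs_ge0 (ex t - 1); nra.
Qed.

End CircleExponential.

(** * Cutting along central elements *)

Section Cuts.
Variables (R : realType) (d : nat) (X : hspace R) (p : hrep d X).
Implicit Types (e : X -> X) (g h : heis d) (x y : X).

Section CutSelfadjoint.
Variable good : (X -> X) -> Prop.
Hypothesis good_add : forall e e1 e2, subpiece p e1 e -> subpiece p e2 e ->
  (forall x, e x = e1 x + e2 x) -> (forall x, e1 (e2 x) = 0) ->
  good e1 -> good e2 -> good e.

(** The spectrum of [T] is cut into intervals of length [r] by repeated [spectral_split]. On one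
    interval [T - a] is a positive form bounded by [r], so [form_bound] makes [T] nearly scalar.
    [good] is any property stable under orthogonal sums. *)
Lemma cut_selfadj e T (M r : R) : 0 < r -> piece p e -> selfadj T ->
  (forall x, nrm (T x) <= M * nrm x) -> (forall g, commutes (p g) T) -> commutes T e ->
  (forall e', subpiece p e' e ->
     (exists t : R, forall x, e' x = x -> nrm (T x - t%:C *: x) <= r * nrm x) -> good e') ->
  good e.
Proof.
move=> r0 he Ts TM Tc Te hgood; have lT := adj_linear Ts.
have shift_self a : selfadj (fun x => T x - a%:C *: x).
  by move=> x y; rewrite ipBl ipBr Ts ipZl ipZr conj_real.
have base e' a : subpiece p e' e -> commutes T e' ->
    (forall x, e' x = x -> a * nsq x <= Re (ip (T x) x) <= (a + r) * nsq x) -> good e'.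
  move=> s Te' h; have [he' _] := s; have [es' ei' _ _] := he'.
  apply: hgood => //; exists a => x ex.
  pose S y := T (e' y) - a%:C *: e' y.
  have formS y : Re (ip (S y) y) = Re (ip (T (e' y)) (e' y)) - a * nsq (e' y).
    rewrite /S ipBl ReB ipZl Re_realM; congr (_ - _ * _).
      by rewrite -{1}(ei' y) Te' es'.
    by rewrite /nsq -{1}(ei' y) es'.
  have Ss : selfadj S.
    by move=> y z; rewrite /S ipBl ipBr ipZl ipZr conj_real es' Te' es' Ts.
  have := @form_bound _ _ S Ss _ r (ltW r0) _ x.
  rewrite /S ex; apply => y; rewrite formS; have /andP[h1 h2] := h _ (ei' y).
    by lra.
  have h3 : r * nsq (e' y) <= r * nsq y by rewrite ler_pM2l// (piece_nsq y he') lerDl nsq_ge0.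
  by lra.
(* [n + 1] intervals starting at [a] remain; splitting at [a + r] detaches the first. *)
have step n e' a : subpiece p e' e -> commutes T e' ->
    (forall x, e' x = x -> a * nsq x <= Re (ip (T x) x) <= (a + n.+1%:R * r) * nsq x) ->
    good e'.
  elim: n e' a => [|n IH] e' a s Te' h.
    by apply: (base _ a s Te') => x /h; rewrite mulr1n mul1r.
  have [he' _] := s; have [es' ei' ec' _] := he'; have le' := piece_linear he'.
  have bdd x : nrm (T x - (a + r)%:C *: x) <= (M + `|a + r|) * nrm x.
    apply: le_trans (nrm_triangleB _ _) _; rewrite mulrDl nrmZ cabs_real.
    by rewrite lerD2r.
  have [Q [Qs Qi Qc Q1 Q2]] := spectral_split (shift_self (a + r)) bdd.
  have cshift S : linear S -> commutes S T -> commutes S (fun x => T x - (a + r)%:C *: x).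
    by move=> lS h' x; rewrite linB// linZ// h'.
  have Qe : commutes Q e'.
    move=> x; apply/esym/(Qc e' e') => //; apply: cshift; try exact: piece_linear he'.
      by move=> y; rewrite Te'.
    by move=> y; rewrite Te'.
  have Qg g : commutes (p g) Q.
    by apply: (Qc (p g) (p (hinv g))); [exact: hact_adj | apply: cshift => //; exact: hact_linear..].
  have TQ : commutes T Q by apply: (Qc T T) => //; exact: cshift.
  have [s1 s2] := restrict_piece he' Qs Qi Qg Qe.
  have lQ := adj_linear Qs.
  have shiftE x : Re (ip (T x - (a + r)%:C *: x) x) = Re (ip (T x) x) - (a + r) * nsq x.
    by rewrite ipBl ReB ipZl Re_realM.
  apply: (good_add s1 s2).
  - by move=> x; rewrite addrC subrK.
  - by move=> x; rewrite (linB _ _ le') ei' -Qe ei' (linB _ _ lQ) Qi subrr.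
  - apply: (base _ a (subpiece_trans s1 s)); first by move=> x; rewrite TQ Te'.
    move=> x qx; have ex : e' x = x by rewrite -qx -Qe ei'.
    have /andP[-> _] := h _ ex; rewrite /=.
    by have := Q1 x; rewrite -{1 2 3}ex qx shiftE; lra.
  - apply: (IH _ (a + r) (subpiece_trans s2 s)).
      by move=> x; rewrite (linB _ _ lT) Te' TQ Te'.
    move=> x qx; have ex : e' x = x by rewrite -qx (linB _ _ le') ei' -Qe ei'.
    have Qx : Q x = 0 by rewrite -qx (linB _ _ lQ) Qi subrr.
    have /andP[_ h2] := h _ ex.
    have := Q2 x; rewrite Qx subr0 shiftE => h3.
    by move: h2; rewrite -[n.+2%:R]natr1; have := nsq_ge0 x; lra.
(* The numerical range of [T] lies between [-|M|] and [|M|], which [n + 1] intervals of length [r]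
   cover. *)
pose n := Num.truncn (2 * `|M| / r).
apply: (step n e (- `|M|) (subpiece_refl he)) => // x ex.
have nb : 2 * `|M| <= n.+1%:R * r.
  by rewrite -ler_pdivrMr// ltW// truncnS_gt.
have := ler_Re_cabs (ip (T x) x).
have := cauchy_schwarz (T x) x; have := nrm_ge0 x; rewrite -!nrm2.
have := TM x; have := ler_norm M; have := nrm_ge0 (T x).
set c := cabs _; set m := `|M|; rewrite ler_norml => h1 h2 h3 h4 h5 /andP[h6 h7].
have h8 : nrm (T x) * nrm x <= m * nrm x * nrm x.
  by rewrite ler_wpM2r//; apply: le_trans h3 _; rewrite ler_wpM2r.
have h9 : 0 <= nrm x ^+ 2 by rewrite sqr_ge0.
have h10 : 2 * m * nrm x ^+ 2 <= n.+1%:R * r * nrm x ^+ 2 by rewrite ler_wpM2r.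
by apply/andP; split; lra.
Qed.

(** On the piece [p z] is a unitary commuting with the action. Cutting its real part and then its
    imaginary part puts it near a complex number [lam] of modulus nearly 1, which is replaced by
    [lam / |lam|]. *)
Lemma cut_central e z (r : R) : 0 < r -> piece p e -> central_on p e z ->
  (forall e', subpiece p e' e -> (exists t, near p e' z (ex t) r) -> good e') -> good e.
Proof.
move=> r0 he0 cz0 hgood.
(* The two cuts put [p z] within [2 q] of [lam], and normalizing [lam] costs [2 q] more. *)
pose q := r / 4; have q0 : 0 < q by rewrite divr_gt0.
have tools e' : subpiece p e' e -> [/\ 
    adjoint (fun x => p z (e' x)) (fun x => p (hinv z) (e' x)),
    forall g, commutes (p g) (fun x => p z (e' x)),
    forall g, commutes (p g) (fun x => p (hinv z) (e' x)) &
    commutes (fun x => p z (e' x)) e' /\ commutes (fun x => p (hinv z) (e' x)) e'].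
  move=> s; have [he _] := s; have cz := central_sub s cz0; have [es ei ec eu] := he.
  have czV := central_onV he cz.
  split; first by move=> x y; rewrite hact_adj es ec.
  - by move=> g x; rewrite -cz// ec.
  - by move=> g x; rewrite -czV// ec.
  - by split=> x /=; rewrite [LHS]ec.
have half : cabs ((2^-1)%:C : R[i]) = 2^-1 by rewrite cabs_real ger0_norm.
have cabsi : cabs ((2 *i)%C^-1 : R[i]) = 2^-1.
  by rewrite cabsV /cabs normc_def /= expr0n add0r sqrtr_sqr ger0_norm.
have bound a b e' x : piece p e' -> cabs a = 2^-1 -> cabs b = 2^-1 ->
    nrm (a *: p z (e' x) + b *: p (hinv z) (e' x)) <= 1 * nrm x.
  move=> he ha hb; apply: le_trans (nrm_triangle _ _) _; rewrite !nrmZ ha hb.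
  have [_ _ _ eu] := he.
  by rewrite !hact_nrm//; have := piece_nrm x he; lra.
have comb_c S T T' a b : linear S -> commutes S T -> commutes S T' ->
    commutes S (fun x : X => a *: T x + b *: T' x).
  by move=> lS h h' x; rewrite lS (linZ _ _ lS) h h'.
pose T1 e' x := (2^-1)%:C *: p z (e' x) + (2^-1)%:C *: p (hinv z) (e' x).
pose T2 e' x := (2 *i)%C^-1 *: p z (e' x) + (- (2 *i)%C^-1) *: p (hinv z) (e' x).
have conji : ((2 *i)%C^-1 : R[i])^* = - (2 *i)%C^-1.
  by rewrite fmorphV -invrN; congr (_^-1); apply/eqP; rewrite eq_complex /= oppr0 !eqxx.
have T1s e' : subpiece p e' e -> selfadj (T1 e').
  move=> s x y; have [a1 _ _ _] := tools _ s; have a2 := adj_sym a1.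
  by rewrite /T1 ipDl ipDr !ipZl !ipZr conj_real a1 a2 addrC.
have T2s e' : subpiece p e' e -> selfadj (T2 e').
  move=> s x y; have [a1 _ _ _] := tools _ s; have a2 := adj_sym a1.
  by rewrite /T2 ipDl ipDr !ipZl !ipZr rmorphN /= conji opprK a1 a2 addrC.
have s0 := subpiece_refl he0.
have [_ c1 c2 [k1 k2]] := tools _ s0.
apply: (cut_selfadj q0 he0 (T1s _ s0) (fun x => bound _ _ _ x he0 half half)).
- by move=> g; apply: comb_c => //; exact: hact_linear.
- move=> x; have /= e1 := k1 x; have /= e2 := k2 x; rewrite /T1 e1 e2.
  by rewrite (piece_linear he0) (linZ _ _ (piece_linear he0)).
move=> e1 s1 [t1 n1]; have [he1 _] := s1.
have [_ d1 d2 [m1 m2]] := tools _ s1.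
apply: (cut_selfadj q0 he1 (T2s _ s1)).
- by move=> x; apply: (bound _ _ _ x he1); rewrite ?cabsN cabsi.
- by move=> g; apply: comb_c => //; exact: hact_linear.
- move=> x; have /= g1 := m1 x; have /= g2 := m2 x; rewrite /T2 g1 g2.
  by rewrite (piece_linear he1) (linZ _ _ (piece_linear he1)).

move=> e2 s2 [t2 n2]; have s20 := subpiece_trans s2 s1; have [he2 _] := s2.
apply: hgood => //.
pose lam : R[i] := t1%:C + 'i%C * t2%:C.
have near_lam x : e2 x = x -> nrm (p z x - lam *: x) <= 2 * q * nrm x.
  move=> e2x; have e1x := subpieceP s2 e2x; have e0x := subpieceP s20 e2x.
  have := n1 _ e1x; have := n2 _ e2x; rewrite /T1 /T2 e0x e1x => h2 h1.
  have -> : p z x - lam *: x =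
     ((2^-1)%:C *: p z x + (2^-1)%:C *: p (hinv z) x - t1%:C *: x) +
     'i%C *: ((2 *i)%C^-1 *: p z x + (- (2 *i)%C^-1) *: p (hinv z) x - t2%:C *: x).
    have i2 : 'i%C * (2 *i)%C^-1 = (2^-1)%:C :> R[i].
      have -> : (2 *i)%C = 'i%C * (2%:C : R[i]).
        by apply/eqP; rewrite eq_complex /= !(mul0r, mulr0, mul1r, subr0, subrr, add0r, oppr0, eqxx).
      by rewrite invfM mulrA mulfV ?mul1r ?fmorphV// eq_complex /= eqxx oner_eq0.
    rewrite scalerBr scalerDr !scalerA mulrN i2 /lam scalerDl.
    have pzE : p z x = (2^-1)%:C *: p z x + (2^-1)%:C *: p z x.
      by rewrite -scalerDl -rmorphD /= (_ : 2^-1 + 2^-1 = 1 :> R) ?rmorph1 ?scale1r//; lra.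
    rewrite {1}pzE scaleNr; move: (_ *: p z x) (_ *: p (hinv z) x) (_ *: x) (_ *: x) => a b w u.
    by rewrite opprD addrACA [a + b - u]addrAC [a - b - w]addrAC [RHS]addrACA subrr addr0.
  apply: le_trans (nrm_triangle _ _) _; rewrite nrmZ.
  have -> : cabs ('i%C : R[i]) = 1.
    by rewrite /cabs normc_def /= expr0n expr1n add0r sqrtr1.
  by rewrite mul1r; lra.
(* On a zero range any phase will do; otherwise a nonzero vector [v] shows that [|lam|] is near
   1. *)
have [z0|/existsNP[v /not_implyP[e2v v0]]] := pselect (forall x, e2 x = x -> x = 0).
  exists 0 => x /z0 ->.
  by rewrite (lin0 (hact_linear p z)) scaler0 subrr nrm0 mulr0.
have nv : 0 < nrm v.
  rewrite lt_neqAle nrm_ge0 andbT; apply/eqP => h; apply: v0.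
  exact: (nrm_eq0 (@definite _ X)).
have lam1 : `|cabs lam - 1| <= 2 * q.
  have h := near_lam _ e2v.
  have uv := piece_one he2 e2v.
  have h1 := nrm_rev (p z v) (lam *: v); have h2 := nrm_rev (lam *: v) (p z v).
  move: h1 h2; rewrite [nrm (lam *: v - _)]nrmBC nrmZ hact_nrm// => h1 h2.
  rewrite -(ler_pM2r nv) -[X in _ * X]ger0_norm ?nrm_ge0// -normrM ler_norml.
  by apply/andP; split; lra.
(* [lam = 0] forces [1 <= 2 q], and then the phase 1 satisfies the estimate. *)
have [l0|l0] := eqVneq lam 0.
  exists 0 => x /near_lam; move: lam1; rewrite l0 cabs0 scale0r subr0 sub0r normrN normr1.
  move=> q1 h; rewrite ex0 scale1r; apply: le_trans (nrm_triangleB _ _) _.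
  rewrite /q in q1 h; have := nrm_ge0 x; nra.
have cl : 0 < cabs lam by rewrite lt_neqAle cabs_ge0 andbT eq_sym cabs_eq0.
have [t ht] : exists t, ex t = (cabs lam)^-1%:C * lam.
  by apply: ex_surj; rewrite cabsM cabs_real gtr0_norm ?invr_gt0// mulVf ?gt_eqF.
exists t => x e2x; rewrite ht.
apply: le_trans (nrm_dist _ (lam *: x) _) _.
have := near_lam _ e2x.
have -> : lam *: x - ((cabs lam)^-1%:C * lam) *: x = ((1 - (cabs lam)^-1)%:C * lam) *: x.
  by rewrite -scalerBl rmorphB /= mulrBl mul1r.
rewrite nrmZ cabsM cabs_real.
have -> : `|1 - (cabs lam)^-1| * cabs lam = `|cabs lam - 1|.
  rewrite -{2}(gtr0_norm cl) -normrM mulrBl mul1r mulVf ?gt_eqF//.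
have := nrm_ge0 x; move: lam1; rewrite /q; nra.
Qed.

End CutSelfadjoint.
End Cuts.

(** * Separating the fixed vectors of a central element *)

Section KernelCut.
Variables (R : realType) (d : nat) (X : hspace R) (p : hrep d X).
Implicit Types (e : X -> X) (g h : heis d) (x y : X).

Lemma piece_sum e e0 e1 : piece p e -> subpiece p e0 e -> subpiece p e1 e ->
  (forall x, e0 (e1 x) = 0) ->
  let f := fun x => e0 x + e1 x in
  [/\ subpiece p f e, subpiece p e0 f & subpiece p e1 f].
Proof.
move=> he [h0 s0] [h1 s1] h01; have [a0 i0 c0 u0] := h0; have [a1 i1 c1 u1] := h1.
have l0 := piece_linear h0; have l1 := piece_linear h1.
have h10 x : e1 (e0 x) = 0 by apply: ip_inj' => y; rewrite a1 a0 h01 ip0r ip0l.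
move=> f; have hf : piece p f.
  split.
  - by move=> x y; rewrite /f ipDl ipDr a0 a1.
  - by move=> x; rewrite /f (linD _ _ l0) (linD _ _ l1) i0 i1 h01 h10 addr0 add0r.
  - by move=> g x; rewrite /f (linD _ _ (hact_linear p g)) c0 c1.
  - by move=> x; rewrite /f (linD _ _ (hact_linear p hone)) u0 u1.
split; split=> //.
- by move=> x; rewrite /f (linD _ _ (piece_linear he)) s0 s1.
- by move=> x; rewrite /f i0 h10 addr0.
- by move=> x; rewrite /f i1 h01 add0r.
Qed.

(** With [T = |p z - 1|^2] on the piece, [e0] is the kernel of [T] and [e1] the spectral part where
    [T >= del^2]. The part in between tends strongly to 0 with [del], so a small [del] makes it
    negligible on the vectors [xs]. *)
Lemma kern_cut e z (xs : seq X) (eta : R) : piece p e -> central_on p e z ->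
  (forall x, x \in xs -> e x = x) -> 0 < eta ->
  exists e0 e1 (del : R), [/\ 0 < del, subpiece p e0 e, subpiece p e1 e &
      forall x, e0 (e1 x) = 0] /\
    [/\ forall x, e0 x = x -> p z x = x,
        forall x, e1 x = x -> del * nrm x <= nrm (p z x - x) &
        forall x, x \in xs -> nrm (x - (e0 x + e1 x)) <= eta].
Proof.
move=> he cz exs eta0; have [es ei ec eu] := he; have le := piece_linear he.
have czV := central_onV he cz.
have lp g := hact_linear p g.
pose D x := p z (e x) - e x; pose D' x := p (hinv z) (e x) - e x.
have DD' : adjoint D D'.
  by move=> x y; rewrite /D /D' ipBl ipBr hact_adj !es ec.
have Dc g : commutes (p g) D by move=> x; rewrite /D (linB _ _ (lp g)) -cz// ec.
have D'c g : commutes (p g) D' by move=> x; rewrite /D' (linB _ _ (lp g)) -czV// ec.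
have De : commutes D e by move=> x; rewrite /D (linB _ _ le) -ec ei.
have D'e : commutes D' e by move=> x; rewrite /D' (linB _ _ le) -ec ei.
have Dx2 x : nrm (D x) <= 2 * nrm x.
  apply: le_trans (nrm_triangleB _ _) _; rewrite hact_nrm//.
  have := piece_nrm x he; lra.
have D'x2 x : nrm (D' x) <= 2 * nrm x.
  apply: le_trans (nrm_triangleB _ _) _; rewrite hact_nrm//.
  have := piece_nrm x he; lra.
pose T x := D' (D x).
have Ts : selfadj T by move=> x y; rewrite /T (adj_sym DD') DD'.
have lT := adj_linear Ts.
have Tform x : Re (ip (T x) x) = nsq (D x) by rewrite /T (adj_sym DD').
have Tpos x : 0 <= Re (ip (T x) x) by rewrite Tform nsq_ge0.
have T4 x : nrm (T x) <= 4 * nrm x.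
  by apply: le_trans (D'x2 _) _; have := Dx2 x; lra.
have Tc g : commutes (p g) T by move=> x; rewrite /T D'c Dc.
have Te : commutes T e by move=> x; rewrite /T De D'e.
have [kT clT] := ker_closed Ts.
have [Q0 [Q01 Q02 Q0s Q0c]] := closed_projection kT clT.
have Q0i x : Q0 (Q0 x) = Q0 x by exact: Q02.
have presT S : linear S -> commutes S T -> forall x, T x = 0 -> T (S x) = 0.
  by move=> lS ST x Tx; rewrite -ST Tx (lin0 lS).
have Q0g g : commutes (p g) Q0.
  by apply: (Q0c _ (p (hinv g))); [exact: hact_adj|exact: presT..].
have Q0e : commutes Q0 e.
  by move=> x; apply/esym; apply: (Q0c e e) => //; apply: presT => // y; rewrite Te.
have TQ0 : commutes T Q0 by apply: (Q0c T T) => //; exact: presT.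
have lQ0 := adj_linear Q0s.
(* The complement of the kernel of the self-adjoint [T] is the closure of its range. *)
have approx x (c : R) : 0 < c -> exists y, nrm (x - Q0 x - T y) <= c.
  move=> c0; set xi := x - Q0 x.
  have hr : subsp (fun y => exists w, y = T w).
    split; first by exists 0; rewrite (lin0 lT).
    by move=> a _ _ [w ->] [w' ->]; exists (a *: w + w'); rewrite lT.
  have [q [q1 q2]] := nearest_point xi hr.
  have Txq : T (xi - q) = 0.
    by apply: ip_inj' => w; rewrite Ts q2 ?ip0l//; exists w.
  have c20 : 0 < c / 2 by rewrite divr_gt0.
  have [_ [w ->] hw] := q1 _ c20; exists w.
  have h : nsq (xi - q) <= c / 2 * nrm (xi - q).
    have -> : nsq (xi - q) = - Re (ip (q - T w) (xi - q)).
      rewrite /nsq -ReN -ipNl opprB; congr Re.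
      rewrite [in LHS]ipBl [in RHS]ipBl Ts Txq ip0r sub0r.
      have -> : ip xi (xi - q) = 0 by rewrite -(Q02 _ Txq) -Q0s /xi (linB _ _ lQ0) Q0i subrr ip0l.
      by rewrite sub0r.
    rewrite -ReN -ipNl; apply: le_trans (Re_ip_le _ _) _.
    by rewrite nrmN ler_wpM2r ?nrm_ge0.
  apply: le_trans (nrm_dist _ q _) _.
  have : nrm (xi - q) <= c / 2.
    move: h; rewrite -nrm2; have := nrm_ge0 (xi - q); nra.
  by lra.
have shift_self a : selfadj (fun x => T x - a%:C *: x).
  by move=> x y; rewrite ipBl ipBr Ts ipZl ipZr conj_real.
have bdd a x : nrm (T x - a%:C *: x) <= (4 + `|a|) * nrm x.
  apply: le_trans (nrm_triangleB _ _) _; rewrite mulrDl nrmZ cabs_real.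
  by rewrite lerD2r.
have shiftE a x : Re (ip (T x - a%:C *: x) x) = Re (ip (T x) x) - a * nsq x.
  by rewrite ipBl ReB ipZl Re_realM.
have cshift a S : linear S -> commutes S T -> commutes S (fun x => T x - a%:C *: x).
  by move=> lS h' x; rewrite (linB _ _ lS) (linZ _ _ lS) h'.
(* [Q] stands for the spectral projection of [T] below [del^2]: it sends [T y] to a vector of norm
   at most [del^2 |y|], and [x - Q0 x] is close to some [T y]. *)
have small x : exists2 dx : R, 0 < dx & forall del, 0 < del -> del <= dx -> forall Q,
    selfadj Q -> (forall x, Q (Q x) = Q x) -> commutes T Q ->
    (forall x, Re (ip (T (Q x) - (del ^+ 2)%:C *: Q x) (Q x)) <= 0) ->
    nrm (Q (x - Q0 x)) <= eta.
  have e40 : 0 < eta / 2 by rewrite divr_gt0.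
  have [y hy] := approx x _ e40.
  have k0 : 0 < nrm y + 1 by rewrite ltr_wpDl ?nrm_ge0.
  exists (Num.min 1 (eta / 2 / (nrm y + 1))).
    by rewrite lt_min ltr01 divr_gt0.
  move=> del d0; rewrite le_min => /andP[d1 d2] Q Qs Qi TQ Q1.
  have lQ := adj_linear Qs.
  have Q1nrm w : nsq (Q w) <= nsq w.
    have : nsq w = nsq (Q w) + nsq (w - Q w).
      rewrite -pythagoras; first by rewrite addrC subrK.
      by rewrite Qs (linB _ _ lQ) Qi subrr ip0r.
    by move=> ->; rewrite lerDl nsq_ge0.
  have TQs : selfadj (fun w => T (Q w)) by move=> w w'; rewrite Ts Qs -TQ.
  have TQf w : Re (ip (T (Q w)) w) = Re (ip (T (Q w)) (Q w)).
    by rewrite -[in LHS]Qi TQ Qs.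
  have TQy : nrm (T (Q y)) <= del ^+ 2 * nrm y.
    apply: (@form_bound _ _ (fun w => T (Q w)) TQs) => [w||w].
    - by rewrite TQf.
    - exact: sqr_ge0.
    rewrite TQf; have := Q1 w; rewrite shiftE.
    have : del ^+ 2 * nsq (Q w) <= del ^+ 2 * nsq w by rewrite ler_wpM2l ?sqr_ge0.
    by lra.
  have -> : Q (x - Q0 x) = Q (x - Q0 x - T y) + T (Q y).
    by rewrite [Q (_ - T y)](linB _ _ lQ) TQ subrK.
  apply: le_trans (nrm_triangle _ _) _.
  have h1 : nrm (Q (x - Q0 x - T y)) <= eta / 2.
    by apply: le_trans hy; rewrite nrm_leP ?nrm_ge0// nrm2.
  have h2 : del ^+ 2 * nrm y <= eta / 2.
    move: d2; rewrite ler_pdivlMr// => d2; have := nrm_ge0 y; nra.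
  by lra.
have {small} [del d0 small] : exists2 del : R, 0 < del & forall Q,
    selfadj Q -> (forall x, Q (Q x) = Q x) -> commutes T Q ->
    (forall x, Re (ip (T (Q x) - (del ^+ 2)%:C *: Q x) (Q x)) <= 0) ->
    forall x, x \in xs -> nrm (Q (x - Q0 x)) <= eta.
  suff [dx dx0 h] : exists2 dx : R, 0 < dx & forall del, 0 < del -> del <= dx -> forall Q,
    selfadj Q -> (forall x, Q (Q x) = Q x) -> commutes T Q ->
    (forall x, Re (ip (T (Q x) - (del ^+ 2)%:C *: Q x) (Q x)) <= 0) ->
    forall x, x \in xs -> nrm (Q (x - Q0 x)) <= eta by exists dx => //; exact: h.
  elim: (xs) => [|x s [d1 d10 h1]]; first by exists 1.
  have [d2 d20 h2] := small x.
  exists (Num.min d1 d2); first by rewrite lt_min d10.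
  move=> del d0; rewrite le_min => /andP[da db] Q a1 a2 a3 a4 w.
  rewrite inE => /orP[/eqP->|ws]; first exact: h2 db _ _ _ _ _.
  exact: h1 da _ _ _ _ _ _ _.
have [Q [Qs Qi Qc Q1 Q2]] := spectral_split (shift_self (del ^+ 2)) (bdd (del ^+ 2)).
have lQ := adj_linear Qs.
have TQ : commutes T Q by apply: (Qc T T) => //; exact: cshift.
have Qe : commutes Q e.
  by move=> x; apply/esym/(Qc e e) => //; apply: cshift => // y; rewrite Te.
have Qg g : commutes (p g) Q.
  by apply: (Qc (p g) (p (hinv g))); [exact: hact_adj|exact: cshift..].
have Q0Q : commutes Q0 Q.
  by apply: (Qc Q0 Q0) => //; apply: cshift => // y; rewrite TQ0.
have [s0 _] := restrict_piece he Q0s Q0i Q0g Q0e.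
have [_ s1] := restrict_piece he Qs Qi Qg Qe.
exists (fun x => Q0 (e x)), (fun x => e x - Q (e x)), del.
(* A vector [w] common to both parts satisfies [T w = 0] and [del^2 |w|^2 <= <T w, w>], so it
   vanishes. *)
have z01 x : Q0 (e (e x - Q (e x))) = 0.
  rewrite (linB _ _ le) ei -Qe ei; set y := e x - Q (e x).
  apply: definite; set w := Q0 y.
  have wE : w = e w - Q (e w).
    rewrite /w -Q0e -Q0Q -(linB _ _ lQ0); congr Q0.
    by rewrite /y (linB _ _ le) ei -!Qe ei (linB _ _ lQ) Qi subrr subr0.
  have := Q2 (e w); rewrite -wE shiftE.
  have -> : T w = 0 by exact: Q01.
  rewrite ip0l /= sub0r oppr_ge0 pmulr_rle0 ?exprn_gt0// => h.
  by apply/eqP; rewrite eq_le h nsq_ge0.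
have z10 x : e x = x -> Q (Q0 x) = Q0 x.
  move=> ex; have := z01 x; rewrite ex (linB _ _ le) ex -Qe ex (linB _ _ lQ0) Q0Q => /eqP.
  by rewrite subr_eq0 => /eqP.
split; split=> //.
- move=> x qx; have ex : e x = x by exact: subpieceP s0 qx.
  have : T x = 0 by rewrite -qx; exact: Q01.
  have := Tform x => /[swap] ->; rewrite ip0l /= => /esym/definite/eqP.
  by rewrite /D ex subr_eq0 => /eqP.
- move=> x qx; have ex : e x = x by exact: subpieceP s1 qx.
  have Qx : Q x = 0 by rewrite -qx (linB _ _ lQ) Qi subrr.
  have := Q2 x; rewrite Qx subr0 shiftE Tform /D ex => h.
  rewrite -(@ler_pXn2r _ 2)// ?nnegrE ?mulr_ge0 ?nrm_ge0 ?(ltW d0)//.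
  by rewrite exprMn !nrm2; lra.
- move=> x xxs; have ex := exs _ xxs; rewrite ex.
  have -> : x - (Q0 x + (x - Q x)) = Q (x - Q0 x).
    by rewrite [RHS](linB _ _ lQ) z10// opprD opprB addrA addrC addrA subrK.
  exact: small.
Qed.

End KernelCut.

(** * Monomial representations *)

(* Data of a finite-dimensional monomial representation of the group [heis d],
   induced from a character of the stabilizer of [ko]. *)
Record kdata (R : realType) d := KData {
  kA :> finType;
  ktr : kA -> 'rV[int]_d -> kA;
  ko : kA;
  kom : 'M[int]_d -> R[i];
  kap : kA -> 'rV[int]_d -> R[i];
  ktr0 : forall a, ktr a 0 = a;
  ktrD : forall a k l, ktr a (k + l) = ktr (ktr a k) l;
  komD : forall c c', kom (c + c') = kom c * kom c';
  cabs_kom : forall c, cabs (kom c) = 1;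
  cabs_kap : forall a l, cabs (kap a l) = 1;
  kapD : forall a k l,
    kap a k * kap (ktr a k) l = kap a (k + l) * kom (k^T *m l);
  kscal : forall l, ktr ko l = ko -> forall a, ktr a l = a /\ kap a l = kap ko l }.

Section FunctionSpace.
Variables (R : realType) (A : finType) (X : ipspace R).

Definition fip (F G : {ffun A -> X}) : R[i] := \sum_a ip (F a) (G a).

Fact fipDZl (c : R[i]) (F G H : {ffun A -> X}) :
  fip (c *: F + G) H = c * fip F H + fip G H.
Proof.
rewrite /fip mulr_sumr -big_split /=; apply: eq_bigr => a _.
by rewrite !ffunE ipDZl.
Qed.

Fact fipC F G : fip G F = (fip F G)^*.
Proof. by rewrite /fip rmorph_sum /=; apply: eq_bigr => a _; exact: ipC. Qed.

Fact fip_ge0 F : 0 <= fip F F.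
Proof. by apply: sumr_ge0 => a _; exact: ip_ge0. Qed.

Definition fspace : ipspace R := @IPSpace R {ffun A -> X} fip fipDZl fipC fip_ge0.

Lemma fspace_nsq (F : fspace) : nsq F = \sum_a nsq (F a).
Proof. exact: Re_sum. Qed.

End FunctionSpace.

Section MonomialRep.
Variables (R : realType) (d : nat) (K : kdata R d) (X : ipspace R).
Implicit Types (a : K) (l : 'rV[int]_d) (c : 'M[int]_d).

Lemma kom0 : kom K 0 = 1.
Proof.
have h : kom K 0 != 0 by rewrite -cabs_eq0 cabs_kom oner_eq0.
by apply: (mulfI h); rewrite -komD addr0 mulr1.
Qed.

Lemma kap0 a : kap a 0 = 1.
Proof.
have h : kap a 0 != 0 by rewrite -cabs_eq0 cabs_kap oner_eq0.
apply: (mulfI h); have := kapD a 0 0.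
by rewrite ktr0 addr0 mulmx0 kom0 => ->.
Qed.

Lemma unit_conj (z w : R[i]) : cabs z = 1 -> z * w = 1 -> w = z^*.
Proof.
move=> z1 zw; have z0 : z != 0 by rewrite -cabs_eq0 z1 oner_eq0.
by apply: (mulfI z0); rewrite zw mulJ_cabs z1 expr1n.
Qed.

Lemma ktrK a l : ktr (ktr a l) (- l) = a.
Proof. by rewrite -ktrD subrr ktr0. Qed.

Lemma ktrVK a l : ktr (ktr a (- l)) l = a.
Proof. by rewrite -ktrD addNr ktr0. Qed.

Lemma ktr_bij l : bijective (fun a => ktr a l).
Proof. by exists (fun a => ktr a (- l)) => a; rewrite ?ktrK ?ktrVK. Qed.

(** The monomial representation tensored with a multiplicity space [X] on which the group does not
    act. *)
Definition kact (g : heis d) (F : fspace K X) : fspace K X :=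
  [ffun a => (kom K g.2 * kap a g.1) *: F (ktr a g.1)].

Fact kact_linear g : linear (kact g).
Proof.
move=> z F G; apply/ffunP => a; rewrite !ffunE scalerDr !scalerA.
by congr (_ *: _ + _); rewrite mulrC.
Qed.

Fact kactM g h F : kact (hmul g h) F = kact g (kact h F).
Proof.
apply/ffunP => a; rewrite !ffunE scalerA /= -ktrD; congr (_ *: _).
rewrite !komD [RHS]mulrACA kapD; ring.
Qed.

Fact kact_adj g F G : ip (kact g F) G = ip F (kact (hinv g) G).
Proof.
rewrite /ip /= /fip [RHS](reindex (fun a => ktr a g.1)); last exact/onW_bij/ktr_bij.
apply: eq_bigr => a _; rewrite !ffunE ipZl ipZr /= ktrK; congr (_ * _).
apply/unit_conj; first by rewrite cabsM cabs_kom cabs_kap mulr1.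
rewrite mulrACA -komD [kap _ _ * _]mulrC kapD addrN kap0 mul1r -komD.
by rewrite mulmxN addrAC addrK addNr kom0.
Qed.

Definition krep : hrep d (fspace K X) := HRep kact_linear kactM kact_adj.

Lemma krep_one F : krep hone F = F.
Proof.
by apply/ffunP => a; rewrite ffunE /= kom0 kap0 mulr1 scale1r ktr0.
Qed.

Lemma krep_scal l c F : ktr (ko K) l = ko K ->
  krep (l, c) F = (kom K c * kap (ko K) l) *: F.
Proof.
by move=> h; apply/ffunP => a; rewrite !ffunE /=; have [-> ->] := kscal h a.
Qed.

End MonomialRep.

(** * Averaging a linear map into an almost intertwining one *)

Section Transfer.
Variables (R : realType) (d : nat) (K : kdata R d) (X1 X2 : ipspace R).
Variables (p1 : hrep d X1) (p2 : hrep d X2) (T : X1 -> X2).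
Hypothesis lT : linear T.
Variables (D1 : X1 -> Prop) (D2 : X2 -> Prop).
Hypothesis sD1 : subsp D1.
Hypothesis D1act : forall g x, D1 x -> D1 (p1 g x).
Hypothesis D1one : forall x, D1 x -> p1 hone x = x.
Hypothesis sD2 : subsp D2.
Hypothesis D2act : forall g x, D2 x -> D2 (p2 g x).
Hypothesis D2one : forall x, D2 x -> p2 hone x = x.
Hypothesis D12 : forall x, D1 x -> D2 (T x).
Variables (b : K -> 'rV[int]_d) (phi : K -> R) (Ap : pred K) (kappa : R).
Hypothesis kappa0 : 0 <= kappa <= 1.
Hypothesis phiA : forall a, phi a != 0 -> Ap a.
Hypothesis phi1 : \sum_a phi a ^+ 2 = 1.
Hypothesis Tbound : forall x, D1 x -> nrm (T x) <= 2 * nrm x.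

Let bg a : heis d := (b a, 0).

Hypothesis ortho : forall xs : K -> X1, (forall a, D1 (xs a)) ->
  (forall a, ~~ Ap a -> xs a = 0) ->
  `|nsq (\sum_a p2 (bg a) (T (xs a))) - \sum_a nsq (xs a)| <= kappa * \sum_a nsq (xs a).

(** In the uses below the [b a] represent the cosets of the stabilizer of [ko K], and [phi] is a
    Folner function of l^2 norm 1. *)
Definition transfer (x : X1) : X2 :=
  \sum_a (phi a)%:C *: p2 (bg a) (T (p1 (hinv (bg a)) x)).

Lemma transfer_linear : linear transfer.
Proof.
move=> c x y; rewrite /transfer scaler_sumr -big_split /=; apply: eq_bigr => a _.
by rewrite (hact_linear p1) lT (hact_linear p2) scalerDr !scalerA [_ * c]mulrC.
Qed.

Lemma transfer_D2 x : D1 x -> D2 (transfer x).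
Proof.
move=> Dx; apply: (subsp_sum sD2) => a _ _; apply: (subspZ _ sD2).
by apply: D2act; apply: D12; apply: D1act.
Qed.

(** As [phi] has l^2 norm 1, the squared norms of the weighted translates of [x] add up to that of
    [x]; [ortho] says that their images are nearly orthogonal and nearly as long. *)
Lemma transfer_nsq x : D1 x -> `|nsq (transfer x) - nsq x| <= kappa * nsq x.
Proof.
move=> Dx; pose xs a := (phi a)%:C *: p1 (hinv (bg a)) x.
have -> : transfer x = \sum_a p2 (bg a) (T (xs a)).
  apply: eq_bigr => a _; rewrite /xs.
  by rewrite (linZ _ _ lT) (linZ _ _ (hact_linear p2 _)).
have e : nsq x = \sum_a nsq (xs a).
  rewrite -[LHS]mul1r -phi1 mulr_suml; apply: eq_bigr => a _.
  by rewrite /xs nsqZ hact_nsq ?D1one// cabs_real real_normK// num_real.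
rewrite e; apply: ortho => a.
  by apply: (subspZ _ sD1); apply: D1act.
by move=> na; rewrite /xs (contraNeq (@phiA a) na) scale0r.
Qed.

Variables (i : 'I_d) (eps0 r : R).
Let u : heis d := (delta_mx 0 i, 0).
Let s (a : K) := ktr a (delta_mx 0 i).
Let z a := hmul (hinv (bg (s a))) (hmul u (bg a)).
Hypothesis r0 : 0 <= r.
Hypothesis eps00 : 0 <= eps0.
Hypothesis phi_slow : \sum_a (phi a - phi (s a)) ^+ 2 <= eps0 ^+ 2.
Hypothesis active : forall a, (phi a != 0) || (phi (s a) != 0) ->
  [/\ Ap a, Ap (s a) & exists chi : R[i], [/\ cabs chi = 1,
    forall x, D1 x -> nrm (p1 (z a) x - chi *: x) <= r * nrm x &
    forall x, D1 x -> nrm (p2 (z a) (T x) - chi *: T x) <= r * nrm (T x)]].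

Lemma phi_le1 a : `|phi a| <= 1.
Proof.
rewrite -(@ler_pXn2r _ 2)// ?nnegrE// expr1n real_normK ?num_real// -phi1.
by rewrite (bigD1 a)//= lerDl sumr_ge0// => ? _; exact: sqr_ge0.
Qed.

(** Write [u b_a = b_{s a} z_a]. As [z a] acts by almost the same scalar on both sides, the term [a]
    of [p2 u (transfer x)] cancels the term [s a] of [transfer (p1 u x)] up to the factor
    [phi a - phi (s a)]. The slow variation of [phi] bounds these remainders together ([main]);
    [err] collects the errors of the scalars, over the finite set [Ap]. *)
Lemma transfer_intertwines x : D1 x ->
  nrm (p2 u (transfer x) - transfer (p1 u x)) <= (2 * eps0 + 4 * #|Ap|%:R * r) * nrm x.
Proof.
move=> Dx; pose x_ a := p1 (hinv (bg a)) x.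
have Dx_ a : D1 (x_ a) by exact: D1act.
have nx_ a : nrm (x_ a) = nrm x by rewrite hact_nrm// D1one.
have /choice[chi hchi] : forall a, exists chi : R[i],
    (phi a != 0) || (phi (s a) != 0) -> [/\ cabs chi = 1,
    forall x, D1 x -> nrm (p1 (z a) x - chi *: x) <= r * nrm x &
    forall x, D1 x -> nrm (p2 (z a) (T x) - chi *: T x) <= r * nrm (T x)].
  move=> a; have [/active[_ _ [c hc]]|_] := boolP ((phi a != 0) || (phi (s a) != 0)).
    by exists c.
  by exists 0.
have lp1 g := hact_linear p1 g; have lp2 g := hact_linear p2 g.
have bz a : hmul (bg (s a)) (z a) = hmul u (bg a).
  by rewrite /z hmulA hmulV h1mul.
have zb a : hmul (hinv (bg (s a))) u = hmul (z a) (hinv (bg a)).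
  by rewrite /z -!hmulA hmulV hmul1.
have sbij : bijective s by exact: ktr_bij.
pose main a := p2 (bg (s a)) (T (((phi a - phi (s a))%:C * chi a) *: x_ a)).
pose err a := (phi a)%:C *: p2 (bg (s a)) (p2 (z a) (T (x_ a)) - chi a *: T (x_ a))
  - (phi (s a))%:C *: p2 (bg (s a)) (T (p1 (z a) (x_ a) - chi a *: x_ a)).
have -> : p2 u (transfer x) - transfer (p1 u x) = \sum_a (main a + err a).
  rewrite {2}/transfer (reindex s) ?sumrB; last exact/onW_bij.
  rewrite /transfer (lin_sum _ _ _ (lp2 u)) -sumrB; apply: eq_bigr => a _.
  rewrite (linZ _ _ (lp2 u)) -[p2 u (p2 _ _)]hactM -bz hactM.
  rewrite -[p1 _ (p1 u x)]hactM zb hactM -/(x_ a).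
  rewrite /main /err (linZ _ _ lT) (linZ _ _ (lp2 _)) (linB _ _ (lp2 _)) (linB _ _ lT).
  rewrite (linB _ _ (lp2 _)) !(linZ _ _ lT) !(linZ _ _ (lp2 _)) !scalerBr !scalerA.
  rewrite rmorphB /= mulrBl scalerBl.
  set A1 := _ *: p2 _ (p2 _ _); set A2 := _ *: p2 _ (T (p1 _ _)).
  set A3 := _ *: p2 _ _; set A4 := _ *: p2 _ _.
  by rewrite opprB [RHS](AC (2*(2*2)) ((3*6)*(1*4)*(5*2)))%AC /= !subrr !addr0.
rewrite big_split /= mulrDl; apply: le_trans (nrm_triangle _ _) (lerD _ _).
  (* Reindexed by the inverse shift, [main] has the form to which [ortho] applies; its norm is at
     most [sqrt (1 + kappa) eps0 |x| <= 2 eps0 |x|]. *)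
  have [s' sK s'K] := sbij.
  pose ys a := ((phi (s' a) - phi a)%:C * chi (s' a)) *: x_ (s' a).
  have -> : \sum_a main a = \sum_a p2 (bg a) (T (ys a)).
    rewrite [RHS](reindex s) /=; last exact/onW_bij.
    by apply: eq_bigr => a _; rewrite /main /ys sK.
  have ysA a : ~~ Ap a -> ys a = 0.
    move=> na; rewrite /ys; have [/active[_]|] := boolP ((phi (s' a) != 0) || (phi (s (s' a)) != 0)).
      by rewrite s'K (negPf na).
    by rewrite negb_or !negbK s'K => /andP[/eqP -> /eqP ->]; rewrite subrr mul0r scale0r.
  have := ortho (fun a => subspZ _ sD1 (Dx_ _)) ysA.
  rewrite -/(ys _) => h.
  have hs : \sum_a nsq (ys a) <= eps0 ^+ 2 * nsq x.
    rewrite (reindex s) /=; last exact/onW_bij.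
    apply: (@le_trans _ _ ((\sum_a (phi a - phi (s a)) ^+ 2) * nsq x)); last first.
      by rewrite ler_wpM2r ?nsq_ge0.
    rewrite mulr_suml; apply: ler_sum => a _; rewrite /ys sK nsqZ.
    rewrite cabsM cabs_real exprMn real_normK ?num_real// -nrm2 nx_ nrm2.
    have [/hchi[-> _ _]|] := boolP ((phi a != 0) || (phi (s a) != 0)); first by rewrite expr1n mulr1.
    by rewrite negb_or !negbK => /andP[/eqP -> /eqP ->]; rewrite subrr expr0n !mul0r.
  rewrite nrm_leP ?mulr_ge0 ?nrm_ge0// exprMn nrm2.
  move: h; rewrite ler_norml => /andP[_ h].
  have hs0 : 0 <= \sum_a nsq (ys a) by apply: sumr_ge0 => a _; exact: nsq_ge0.
  have k2 : kappa * \sum_a nsq (ys a) <= 1 * \sum_a nsq (ys a).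
    by case/andP: kappa0 => _ k1; rewrite ler_wpM2r.
  move: h hs k2 hs0; set S0 := \sum_a nsq (ys a); set S1 := nsq (\sum_a _).
  by have := nsq_ge0 x; have := sqr_ge0 eps0; nra.
apply: le_trans (nrm_sum _ _ _) _.
have errA a : nrm (err a) <= if Ap a then 4 * r * nrm x else 0.
  have [act|] := boolP ((phi a != 0) || (phi (s a) != 0)); last first.
    rewrite negb_or !negbK /err => /andP[/eqP -> /eqP ->].
    rewrite !scale0r subrr nrm0; case: ifP => // _.
    by rewrite !mulr_ge0 ?nrm_ge0.
  have [Aa _ _] := active act; have [c1 h1 h2] := hchi _ act; rewrite Aa.
  apply: le_trans (nrm_triangleB _ _) _; rewrite !nrmZ !cabs_real.
  have Dw : D1 (p1 (z a) (x_ a) - chi a *: x_ a).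
    by apply: (subspB sD1); [exact: D1act | exact: (subspZ _ sD1)].
  have Dv : D2 (p2 (z a) (T (x_ a)) - chi a *: T (x_ a)).
    by apply: (subspB sD2); [apply: D2act; exact: D12 | apply: (subspZ _ sD2); exact: D12].
  rewrite !hact_nrm; [|exact/D2one/D12|exact: D2one].
  have e1 : `|phi a| * nrm (p2 (z a) (T (x_ a)) - chi a *: T (x_ a)) <= 2 * r * nrm x.
    apply: (@le_trans _ _ (1 * (r * (2 * nrm x)))); last by rewrite mul1r mulrCA mulrA.
    apply: ler_pM; rewrite ?nrm_ge0 ?phi_le1//; apply: le_trans (h2 _ (Dx_ a)) _.
    by rewrite ler_wpM2l// -(nx_ a) Tbound.
  have e2 : `|phi (s a)| * nrm (T (p1 (z a) (x_ a) - chi a *: x_ a)) <= 2 * r * nrm x.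
    apply: (@le_trans _ _ (1 * (2 * (r * nrm x)))); last by rewrite mul1r mulrA.
    apply: ler_pM; rewrite ?nrm_ge0 ?phi_le1//; apply: le_trans (Tbound Dw) _.
    by rewrite ler_wpM2l// -(nx_ a) h1.
  by lra.
apply: le_trans (ler_sum _ (fun a _ => errA a)) _.
rewrite -big_mkcond /= sumr_const -mulr_natl le_eqVlt; apply/predU1P; left; ring.
Qed.

End Transfer.

(** * A quasicentral contraction of finite rank *)

Section Quasicentral.
Variables (R : realType) (d : nat) (X : ipspace R) (p : hrep d X).
Hypothesis definite : forall x : X, nsq x = 0 -> x = 0.
Variable D : X -> Prop.
Hypothesis sD : subsp D.
Hypothesis Dact : forall g x, D x -> D (p g x).
Hypothesis Done : forall x, D x -> p hone x = x.
Variable us : seq (heis d).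
Hypothesis usV : forall g, g \in us -> hinv g \in us.

(* The mean of the projections onto n successive enlargements by the
   generators: its commutators are sums of n operators with orthogonal ranges
   (or their adjoints), divided by n. *)
Lemma quasicentral (xs : seq X) (ep : R) : (forall x, x \in xs -> D x) -> 0 < ep ->
  exists (es : seq X) (e : X -> X), 
    [/\ linear e, forall x y, ip (e x) y = ip x (e y), forall x, nrm (e x) <= nrm x &
        forall x, span es (e x)] /\
    [/\ forall y, y \in es -> D y, forall x, x \in xs -> e x = x &
        forall g x, g \in us -> nrm (e (p g x) - p g (e x)) <= ep * nrm x].
Proof.
move=> xsD ep0.
have lp g := hact_linear p g.
pose L := fix L k := if k is k'.+1 then
  L k' ++ [seq p gy.1 gy.2 | gy <- [seq (g, y) | g <- us, y <- L k']] else xs.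
have LS k y : span (L k) y -> span (L k.+1) y.
  by apply: span_sub => w wl; apply: span_mem; rewrite mem_cat wl.
have Lle j k y : (j <= k)%N -> span (L j) y -> span (L k) y.
  by move=> /subnK <-; elim: (k - j)%N => [//|m IH] h; rewrite addSn; apply: LS; exact: IH.
have Lact k g y : g \in us -> span (L k) y -> span (L k.+1) (p g y).
  move=> gu /(_ (fun y => span (L k.+1) (p g y))); apply.
    split; first by rewrite (lin0 (lp g)); exact: (span_subsp _).1.
    by move=> a y1 y2 h1 h2; rewrite lp; exact: (span_subsp _).2.
  move=> w wl; apply: span_mem; rewrite mem_cat; apply/orP; right.
  by apply/mapP; exists (g, w) => //; apply/allpairsP; exists (g, w).
have LD k y : span (L k) y -> D y.
  elim: k y => [|k IH] y.
    by move=> /(_ D); apply.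
  move=> /(_ D); apply => // w; rewrite mem_cat => /orP[/span_mem/IH//|].
  by move=> /mapP[_ /allpairsP[[g v] [/= gu vl ->]] ->] /=; apply: Dact; apply: IH; exact: span_mem.
have /choice[es hes] := fun k => gram_schmidt definite (L k).
have oes k : ons (es k) by case: (hes k).
have e2L k y : span (es k) y -> span (L k) y by case: (hes k) => _ h _; exact: h.
have L2e k y : span (L k) y -> span (es k) y by case: (hes k) => _ _; apply.
pose P k := proj (es k).
have lP k : linear (P k) by exact: proj_linear.
have PL k x : span (L k) (P k x) by apply: e2L; exact: proj_span.
have PD k x : D (P k x) by exact: LD (PL k x).
(* The commutator is a difference of two sums of norm at most [sqrt n], divided by [n]; this [n]
   makes [2 / sqrt n <= ep]. *)
pose n := (Num.truncn (4 / ep ^+ 2)).+1.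
have n0 : 0 < n%:R :> R by rewrite ltr0n.
have nep : 4 <= n%:R * ep ^+ 2.
  by rewrite -ler_pdivrMr ?exprn_gt0// ltW// truncnS_gt.
pose e x := (n%:R^-1)%:C *: \sum_(k < n) P k x.
have le : linear e.
  move=> a x y; rewrite /e scalerA mulrC -scalerA -scalerDr; congr (_ *: _).
  by rewrite scaler_sumr -big_split /=; apply: eq_bigr => k _; rewrite lP.
exists (es n), e; split; split=> //.
- move=> x y; rewrite /e ipZl ipZr conj_real ip_suml ip_sumr; congr (_ * _).
  by apply: eq_bigr => k _; exact: proj_self.
- move=> x; rewrite /e nrmZ cabs_real ger0_norm ?invr_ge0// ler_pdivrMl//.
  apply: le_trans (nrm_sum _ _ _) _.
  apply: (@le_trans _ _ (\sum_(k < n) nrm x)).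
    by apply: ler_sum => k _; exact: nrm_proj.
  by rewrite sumr_const card_ord mulr_natl.
- move=> x; apply: L2e; apply: spanZ; apply: (subsp_sum (span_subsp _)) => k _ _.
  by apply: Lle (PL k x); exact: ltnW.
- by move=> y yes; apply: (LD n); apply: e2L; exact: span_mem.
- move=> x xxs; rewrite /e (eq_bigr (fun=> x)).
    rewrite sumr_const card_ord -[x *+ n]scaler_nat scalerA -(rmorph_nat (real_complex R)) -rmorphM /=.
    by rewrite mulVf ?gt_eqF// rmorph1 scale1r.
  by move=> k _; apply: proj_id => //; apply: L2e; apply: (@Lle 0%N) => //; exact: span_mem.
have sqrtn : 0 <= Num.sqrt (n%:R : R) by exact: sqrtr_ge0.
pose B g k x := p g (P k x) - P k (p g (P k x)).
have Bsum g x : g \in us -> nrm (\sum_(k < n) B g k x) <= Num.sqrt n%:R * nrm x.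
  move=> gu; rewrite nrm_leP ?mulr_ge0 ?nrm_ge0// exprMn nrm2 sqr_sqrtr ?(ltW n0)//.
  have BL k : span (L k.+1) (B g k x).
    apply: spanB; first exact: Lact.
    by apply: LS; exact: PL.
  have Borth j k : (j < k)%N -> ip (B g k x) (B g j x) = 0.
    by move=> jk; apply: proj_orth => //; apply: L2e; apply: Lle (BL j).
  rewrite nsq_sumT_orth; last first.
    move=> j k jk; have [h|h|/val_inj h] := ltngtP j k.
    - by apply: ip_eq0C; exact: Borth.
    - exact: Borth.
    - by rewrite h eqxx in jk.
  apply: (@le_trans _ _ (\sum_(k < n) nsq x)).
    apply: ler_sum => k _; rewrite -!nrm2 ler_pXn2r ?nnegrE ?nrm_ge0//.
    apply: le_trans (nrm_projC _ (oes k)) _.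
    by rewrite hact_nrm ?Done//; exact: nrm_proj.
  by rewrite sumr_const card_ord mulr_natl.
move=> g x gu.
have -> : e (p g x) - p g (e x) =
    (n%:R^-1)%:C *: (\sum_(k < n) P k (p g x - p g (P k x)) - \sum_(k < n) B g k x).
  rewrite /e (linZ _ _ (lp g)) (lin_sum _ _ _ (lp g)) -scalerBr -!sumrB; congr (_ *: _).
  apply: eq_bigr => k _; rewrite /B (linB _ _ (lP k)) opprB addrA subrK//.
rewrite nrmZ cabs_real ger0_norm ?invr_ge0 ?(ltW n0)// ler_pdivrMl//.
(* This sum is the adjoint of the sum of the [B (hinv g) k]. *)
have Csum : nrm (\sum_(k < n) P k (p g x - p g (P k x))) <= Num.sqrt n%:R * nrm x.
  apply: nrm_le_of_ip; first by rewrite mulr_ge0 ?nrm_ge0.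
  move=> y; rewrite ip_suml.
  rewrite (eq_bigr (fun k : 'I_n => ip x (B (hinv g) k y))); last first.
    move=> k _; rewrite proj_self -(linB _ _ (lp g)) hact_adj /B ipBl ipBr; congr (_ - _).
    by rewrite proj_self.
  rewrite -ip_sumr; apply: le_trans (Re_ip_le _ _) _.
  rewrite mulrC -[leRHS]mulrA [nrm x * _]mulrC mulrA ler_wpM2r ?nrm_ge0//.
  by apply: Bsum; exact: usV.
have h := nrm_triangleB (\sum_(k < n) P k (p g x - p g (P k x))) (\sum_(k < n) B g k x).
apply: le_trans h _; apply: le_trans (lerD Csum (Bsum _ x gu)) _.
rewrite -mulrDl mulrA ler_wpM2r ?nrm_ge0//.
rewrite -(@ler_pXn2r _ 2)// ?nnegrE ?addr_ge0 ?mulr_ge0 ?(ltW n0) ?(ltW ep0)//.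
rewrite -mulr2n -[_ *+ 2]mulr_natl exprMn sqr_sqrtr ?(ltW n0)//.
move: nep n0; rewrite exprMn; move: (n%:R : R) => m; nra.
Qed.

End Quasicentral.

Section GramMatrix.
Variables (R : realType) (X : ipspace R) (J : finType).

(** The difference is a quadratic form in the Gram matrix minus the identity, hence at most
    [tau (sum |c_j|)^2]; Cauchy-Schwarz brings in the factor [#|J|]. *)
Lemma gram_close (v : J -> X) (c : J -> R[i]) (P : pred J) (tau : R) : 0 <= tau ->
  (forall j, ~~ P j -> c j = 0) ->
  (forall j k, P j -> P k -> cabs (ip (v j) (v k) - (j == k)%:R) <= tau) ->
  `|nsq (\sum_j c j *: v j) - \sum_j cabs (c j) ^+ 2| <=
    tau * #|J|%:R * \sum_j cabs (c j) ^+ 2.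
Proof.
move=> tau0 cP hv.
have -> : nsq (\sum_j c j *: v j) - \sum_j cabs (c j) ^+ 2 =
    Re (\sum_j \sum_k (c j * (c k)^* * (ip (v j) (v k) - (j == k)%:R))).
  have -> : \sum_j cabs (c j) ^+ 2 = Re (\sum_j \sum_k (c j * (c k)^* * (j == k)%:R)).
    rewrite Re_sum; apply: eq_bigr => j _; rewrite (bigD1 j)//= eqxx mulr1 big1.
      by rewrite addr0 mulJ_cabs.
    by move=> k; rewrite eq_sym => /negPf ->; rewrite mulr0.
  rewrite /nsq -ReB ip_suml -sumrB; congr Re; apply: eq_bigr => j _.
  rewrite ip_sumr -sumrB; apply: eq_bigr => k _.
  by rewrite ipZl ipZr mulrBr; congr (_ - _); ring.
apply: le_trans (ler_Re_cabs _) _; apply: le_trans (cabs_sum _ _ _) _.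
have cs : (\sum_j cabs (c j)) ^+ 2 <= #|J|%:R * \sum_j cabs (c j) ^+ 2.
  have -> : (\sum_j cabs (c j)) ^+ 2 = \sum_j \sum_k cabs (c j) * cabs (c k).
    by rewrite expr2 mulr_suml; apply: eq_bigr => j _; rewrite mulr_sumr.
  have -> : #|J|%:R * \sum_j cabs (c j) ^+ 2 =
      \sum_(j : J) \sum_(k : J) (cabs (c j) ^+ 2 + cabs (c k) ^+ 2) / 2.
    have e j : \sum_(k : J) (cabs (c j) ^+ 2 + cabs (c k) ^+ 2) / 2 =
        (#|J|%:R * cabs (c j) ^+ 2 + \sum_k cabs (c k) ^+ 2) / 2.
      by rewrite -mulr_suml big_split /= sumr_const mulr_natl.
    rewrite (eq_bigr _ (fun j _ => e j)) -mulr_suml big_split /= sumr_const.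
    rewrite -mulr_sumr -[_ *+ _]mulr_natl.
    by field.
  apply: ler_sum => j _; apply: ler_sum => k _.
  by have := sqr_ge0 (cabs (c j) - cabs (c k)); lra.
apply: (@le_trans _ _ (tau * (\sum_j cabs (c j)) ^+ 2)); last first.
  by rewrite -mulrA ler_wpM2l.
rewrite expr2 mulr_suml mulr_sumr; apply: ler_sum => j _.
apply: le_trans (cabs_sum _ _ _) _; rewrite !mulr_sumr; apply: ler_sum => k _.
rewrite !cabsM cabsJ.
have [Pj|/cP ->] := boolP (P j); last by rewrite cabs0 !mul0r ?mulr0.
have [Pk|/cP ->] := boolP (P k); last by rewrite cabs0 !mulr0 ?mul0r.
by rewrite mulrC ler_wpM2r ?mulr_ge0 ?cabs_ge0// hv.
Qed.

End GramMatrix.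

(** * Absorbing a monomial representation *)

Section Absorption.
Variables (R : realType) (d : nat) (K : kdata R d) (X : ipspace R) (p : hrep d X).
Hypothesis definite : forall x : X, nsq x = 0 -> x = 0.
Variable D : X -> Prop.
Hypothesis sD : subsp D.
Hypothesis Dact : forall g x, D x -> D (p g x).
Hypothesis Done : forall x, D x -> p hone x = x.
Variables (b : K -> 'rV[int]_d) (phi : K -> R) (Ap : pred K).
Hypothesis bK : forall a, Ap a -> ktr (ko K) (b a) = a.
Hypothesis phiA : forall a, phi a != 0 -> Ap a.
Hypothesis phi1 : \sum_a phi a ^+ 2 = 1.
Variables (eps0 r : R).
Hypothesis eps00 : 0 <= eps0.
Hypothesis r0 : 0 <= r.

Let bg a : heis d := (b a, 0).
Let u (i : 'I_d) : heis d := (delta_mx 0 i, 0).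
Let s (i : 'I_d) (a : K) := ktr a (delta_mx 0 i).
Let z (i : 'I_d) a := hmul (hinv (bg (s i a))) (hmul (u i) (bg a)).

Hypothesis phi_slow : forall i, \sum_a (phi a - phi (s i a)) ^+ 2 <= eps0 ^+ 2.
Hypothesis activeA : forall i a, (phi a != 0) || (phi (s i a) != 0) -> Ap a /\ Ap (s i a).
Hypothesis near_scal : forall i a, Ap a -> Ap (s i a) -> forall x, D x ->
  nrm (p (z i a) x - (kom K (z i a).2 * kap (ko K) (z i a).1) *: x) <= r * nrm x.
Hypothesis supply : forall (tau : R) (F : seq X), 0 < tau ->
  exists x, [/\ D x, nsq x = 1, forall f, f \in F -> ip x f = 0 &
    forall a a', Ap a -> Ap a' -> a != a' ->
      cabs (ip (p (hmul (hinv (bg a)) (bg a')) x) x) <= tau].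

(** Both [b a] followed by the i-th unit vector and [b (s i a)] carry [ko K] to [s i a]. *)
Lemma z_stab i a : Ap a -> Ap (s i a) -> ktr (ko K) (z i a).1 = ko K.
Proof.
move=> Aa Asa; rewrite /z /= addrC ktrD [delta_mx _ _ + _]addrC ktrD (bK Aa).
have -> : ktr a (delta_mx 0 i) = ktr (ko K) (b (s i a)) by rewrite bK.
exact: ktrK.
Qed.

Lemma krep_z i a F : Ap a -> Ap (s i a) -> krep K X (z i a) F =
  (kom K (z i a).2 * kap (ko K) (z i a).1) *: F.
Proof.
by move=> Aa Asa; rewrite -krep_scal ?z_stab// -surjective_pairing.
Qed.

Lemma scal_unit i a : cabs (kom K (z i a).2 * kap (ko K) (z i a).1) = 1.
Proof. by rewrite cabsM cabs_kom cabs_kap mulr1. Qed.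

Lemma fspace_sumE (I : Type) (l : seq I) (P : pred I) (F : I -> fspace K X) (a : K) :
  (\sum_(j <- l | P j) F j : fspace K X) a = \sum_(j <- l | P j) F j a.
Proof.
by elim/big_rec2 : _ => [|j y x _ <-]; rewrite ?ffunE.
Qed.

Definition point_mass (x : X) : fspace K X := [ffun a => if a == ko K then x else 0].

Lemma point_mass_linear : linear point_mass.
Proof.
move=> c x y; apply/ffunP => a; rewrite !ffunE.
by case: ifP => //; rewrite scaler0 addr0.
Qed.

Lemma ip_point_mass x (F : fspace K X) : ip (point_mass x) F = ip x (F (ko K)).
Proof.
rewrite /ip /= /fip (bigD1 (ko K))//= ffunE eqxx big1 ?addr0// => a /negPf h.
by rewrite ffunE h ip0l.
Qed.

Lemma nsq_point_mass x : nsq (point_mass x) = nsq x.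
Proof. by rewrite /nsq ip_point_mass ffunE eqxx. Qed.

(** Embeds [D] into a multiple of the monomial representation, almost equivariantly because the
    stabilizer acts on both by nearly the same scalars. *)
Definition emb := transfer p (krep K X) point_mass b phi.

Definition DK (F : fspace K X) := forall a, D (F a).

Lemma DK_subsp : subsp DK.
Proof.
split=> [a|c F G DF DG a]; first by rewrite ffunE; exact: sD.1.
by rewrite !ffunE; apply: sD.2.
Qed.

Lemma DK_act g F : DK F -> DK (krep K X g F).
Proof. by move=> DF a; rewrite ffunE; apply: (subspZ _ sD). Qed.

Lemma point_mass_D x : D x -> DK (point_mass x).
Proof. by move=> Dx a; rewrite ffunE; case: ifP => // _; exact: sD.1. Qed.

(** For distinct points of [Ap] the translated point masses have disjoint supports. So [kappa] is 0,
    and [emb] is exactly isometric on [D]. *)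
Lemma point_mass_ortho (xs : K -> X) : (forall a, D (xs a)) ->
  (forall a, ~~ Ap a -> xs a = 0) ->
  `|nsq (\sum_a krep K X (bg a) (point_mass (xs a))) - \sum_a nsq (xs a)|
    <= 0 * \sum_a nsq (xs a).
Proof.
move=> Dxs xsA; rewrite mul0r nsq_sumT_orth; last first.
  move=> a a' aa'; rewrite /ip /= /fip big1// => a'' _; rewrite !ffunE /=.
  have [Aa|/xsA ->] := boolP (Ap a); last by rewrite if_same scaler0 ip0l.
  have [Aa'|/xsA ->] := boolP (Ap a'); last by rewrite if_same scaler0 ip0r.
  have [h|_] := eqVneq (ktr a'' (b a)) (ko K); last by rewrite scaler0 ip0l.
  have [h'|_] := eqVneq (ktr a'' (b a')) (ko K); last by rewrite scaler0 ip0r.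
  case/eqP: aa'; rewrite -(bK Aa) -(bK Aa') -{1}h' -{1}h -!ktrD.
  by rewrite addrC.
rewrite -sumrB big1 ?normr0// => a _; rewrite hact_nsq ?krep_one//.
by rewrite nsq_point_mass subrr.
Qed.

Let eps1 := 2 * eps0 + 4 * #|Ap|%:R * r.

Lemma eps1_ge0 : 0 <= eps1.
Proof. by rewrite addr_ge0 ?mulr_ge0. Qed.

Let kappa00 : 0 <= (0 : R) <= 1. Proof. by rewrite lexx ler01. Qed.

Lemma emb_linear : linear emb.
Proof. exact/transfer_linear/point_mass_linear. Qed.

Lemma emb_DK x : D x -> DK (emb x).
Proof.
exact: (transfer_D2 Dact DK_subsp DK_act point_mass_D).
Qed.

Lemma emb_nsq x : D x -> nsq (emb x) = nsq x.
Proof.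
move=> Dx; have := transfer_nsq point_mass_linear sD Dact Done phiA phi1 point_mass_ortho Dx.
by rewrite mul0r normr_le0 subr_eq0 => /eqP.
Qed.

Lemma emb_intertwines i x : D x ->
  nrm (krep K X (u i) (emb x) - emb (p (u i) x)) <= eps1 * nrm x.
Proof.
apply: (transfer_intertwines point_mass_linear sD Dact Done DK_subsp DK_act _
  point_mass_D kappa00 phi1 _ point_mass_ortho r0 eps00 (phi_slow i)) => //.
- by move=> F _; exact: krep_one.
- by move=> y _; rewrite /nrm nsq_point_mass; have := nrm_ge0 y; rewrite /nrm; lra.
- move=> a act; have [Aa Asa] := activeA act; split=> //.
  exists (kom K (z i a).2 * kap (ko K) (z i a).1); split; first exact: scal_unit.
    exact: near_scal.
  by move=> y _; rewrite krep_z// subrr nrm0 mulr_ge0 ?nrm_ge0.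
Qed.

Definition embadj (F : fspace K X) : X :=
  \sum_a (phi a)%:C *: p (bg a) (krep K X (hinv (bg a)) F (ko K)).

Lemma emb_adj x F : ip (emb x) F = ip x (embadj F).
Proof.
rewrite /emb /transfer /embadj ip_suml ip_sumr; apply: eq_bigr => a _.
rewrite ipZl ipZr conj_real hact_adj ip_point_mass hact_adj hinvK//.
Qed.

Lemma embadj_D F : DK F -> D (embadj F).
Proof.
move=> DF; apply: (subsp_sum sD) => a _ _; apply: (subspZ _ sD).
by apply: Dact; exact: DK_act.
Qed.

Lemma embadj_linear : linear embadj.
Proof.
move=> c F G; rewrite /embadj scaler_sumr -big_split /=; apply: eq_bigr => a _.
transitivity ((phi a)%:C *: p (bg a) ((c *: krep K X (hinv (bg a)) F +
    krep K X (hinv (bg a)) G : fspace K X) (ko K))).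
  exact: (congr1 (fun H : {ffun K -> X} => (phi a)%:C *: p (bg a) (H (ko K)))
    (hact_linear (krep K X) (hinv (bg a)) c F G)).
rewrite [in LHS]ffunE [in LHS]ffunE (hact_linear p) scalerDr !scalerA.
by rewrite [c * _]mulrC.
Qed.

(** Polarization of [emb_nsq]; replacing [x] by [i x] gives the imaginary part. *)
Lemma emb_ip x y : D x -> D y -> ip (emb x) (emb y) = ip x y.
Proof.
have re x' y' : D x' -> D y' -> Re (ip (emb x') (emb y')) = Re (ip x' y').
  move=> Dx Dy; have := nsqD (emb x') (emb y'); have := nsqD x' y'.
  rewrite -(linD _ _ emb_linear) !emb_nsq//; last exact: (subspD sD).
  by move=> ->; lra.
move=> Dx Dy; have h1 := re _ _ Dx Dy.
have h2 := re _ _ (subspZ 'i%C sD Dx) Dy.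
move: h1 h2; rewrite (linZ _ _ emb_linear) !ipZl.
case: (ip (emb x) _) (ip x y) => a1 a2 [b1 b2] /=.
by rewrite !mul0r !mul1r !sub0r => -> /oppr_inj ->.
Qed.

Lemma embadjK x : D x -> embadj (emb x) = x.
Proof.
move=> Dx; apply/eqP; rewrite -subr_eq0; apply/eqP/definite.
have DS : D (embadj (emb x)) by apply/embadj_D/emb_DK.
rewrite /nsq ipC ipBr -emb_adj emb_ip ?subrr ?rmorph0//.
exact: (subspB sD).
Qed.

Lemma nrm_embadj F : DK F -> nrm (embadj F) <= nrm F.
Proof.
move=> DF; have D1 := embadj_D DF.
have : nsq (embadj F) <= nrm (embadj F) * nrm F.
  rewrite {1}/nsq -emb_adj; apply: le_trans (Re_ip_le _ _) _.
  by rewrite {1}/nrm emb_nsq.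
rewrite -nrm2; have := nrm_ge0 (embadj F); have := nrm_ge0 F; nra.
Qed.

(** Dual to [emb_intertwines]: writing the defect [w] as [p u y] turns [|w|^2] into an inner product
    with the defect of [emb] at [y]. *)
Lemma embadj_intertwines i F : DK F ->
  nrm (embadj (krep K X (u i) F) - p (u i) (embadj F)) <= eps1 * nrm F.
Proof.
move=> DF; set w := _ - _.
have Dw : D w.
  by apply: (subspB sD); [exact/embadj_D/DK_act | exact/Dact/embadj_D].
have [y Dy wy] : exists2 y, D y & w = p (u i) y.
  by exists (p (hinv (u i)) w); [exact: Dact | rewrite hactV// Done].
have ny : nrm y = nrm w by rewrite wy hact_nrm ?Done.
have h : nsq w <= eps1 * nrm F * nrm w.
  have e : ip w w = - ip (krep K X (u i) (emb y) - emb (p (u i) y)) (krep K X (u i) F).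
    rewrite -ipNl opprB [RHS]ipBl.
    transitivity (ip w (embadj (krep K X (u i) F)) - ip w (p (u i) (embadj F))).
      exact: ipBr.
    congr (_ - _); first by rewrite -emb_adj -wy.
    by rewrite wy hact_ip ?Done// (hact_ip (p := krep K X)) ?krep_one// emb_adj.
  rewrite {1}/nsq e -ipNl; apply: le_trans (Re_ip_le _ _) _; rewrite nrmN.
  rewrite (hact_nrm (p := krep K X)) ?krep_one// mulrAC ler_wpM2r ?nrm_ge0//.
  by rewrite -ny; exact: emb_intertwines.
move: h; rewrite -nrm2; have := nrm_ge0 w.
have := mulr_ge0 eps1_ge0 (nrm_ge0 F); set c := eps1 * _; nra.
Qed.

(** The vectors are taken one at a time, each orthogonal to all relevant translates of the earlier
    ones. *)
Lemma supply_family (J : finType) (tau : R) (F : seq X) : 0 < tau ->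
  exists eta : J -> X, forall t, [/\ D (eta t), nsq (eta t) = 1,
    forall f, f \in F -> ip (eta t) f = 0,
    forall a a', Ap a -> Ap a' -> a != a' ->
      cabs (ip (p (hmul (hinv (bg a)) (bg a')) (eta t)) (eta t)) <= tau &
    forall t' a a', t != t' -> ip (p (hmul (hinv (bg a)) (bg a')) (eta t)) (eta t') = 0].
Proof.
move=> tau0.
suff [eta h] : exists eta : J -> X, forall t, t \in enum J ->
   [/\ D (eta t), nsq (eta t) = 1,
    forall f, f \in F -> ip (eta t) f = 0,
    forall a a', Ap a -> Ap a' -> a != a' ->
      cabs (ip (p (hmul (hinv (bg a)) (bg a')) (eta t)) (eta t)) <= tau &
    forall t' a a', t' \in enum J -> t != t' ->
      ip (p (hmul (hinv (bg a)) (bg a')) (eta t)) (eta t') = 0].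
  exists eta => t; have [|h1 h2 h3 h4 h5] := h t; first by rewrite mem_enum.
  by split=> // t' a a'; apply: h5; rewrite mem_enum.
elim: (enum J) => [|t0 l [eta IH]]; first by exists (fun=> 0).
have [x [Dx x1 xF xtau]] := supply (F ++ [seq p (hmul (hinv (bg aa.1)) (bg aa.2)) (eta t) |
   aa <- enum {: K * K}, t <- l]) tau0.
have xg t a a' : t \in l -> ip x (p (hmul (hinv (bg a)) (bg a')) (eta t)) = 0.
  move=> tl; apply: xF; rewrite mem_cat; apply/orP; right.
  by apply/allpairsP; exists ((a, a'), t); rewrite mem_enum.
have hinvg a a' : hinv (hmul (hinv (bg a)) (bg a')) = hmul (hinv (bg a')) (bg a).
  rewrite /hmul /hinv /bg /=; congr (_, _); first by rewrite opprD opprK addrC.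
  rewrite oppr0 !add0r !addr0 !trmx_add !trmx_opp !mulmxDl !mulmxDr !mulNmx !mulmxN.
  by rewrite !opprK !opprD !opprK; apply/matrixP => i j; rewrite !mxE; ring.
exists (fun t => if t == t0 then x else eta t) => t.
rewrite inE; have [->|tt0] /= := eqVneq t t0 => tl.
  split=> //; first by move=> f fF; apply: xF; rewrite mem_cat fF.
  move=> t' a a'; rewrite inE eq_sym => t'l /negPf tt'; rewrite tt'.
  rewrite tt' /= in t'l.
  by rewrite hact_adj hinvg; exact: xg.
have [h1 h2 h3 h4 h5] := IH _ tl; split=> // t' a a'.
rewrite inE; have [-> _ _|t't0] /= := eqVneq t' t0; last exact: h5.
exact/ip_eq0C/xg.
Qed.

(** Absorption in the manner of Voiculescu. [emb] carries [D] into the monomial multiple, and [V]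
    carries a finite-dimensional invariant part [DG] of that multiple back into [D], both almost
    equivariantly; the image of [V] is orthogonal to [es]. Let [E = e embadj] with [e] a
    quasicentral contraction that fixes [xs]. Then [W = V (1 - emb E) + E] is almost equivariant and
    bounded below on [DG], and [W (emb x) = x] for [x] in [xs], so the image of [DG] under [W] is
    the space sought. *)
Lemma absorb (xs : seq X) (ep : R) : (forall x, x \in xs -> D x) ->
  0 < eps1 -> 20 * eps1 <= ep ->
  exists l, [/\ forall y, y \in l -> D y,
    forall i y, span l y -> exists2 y', span l y' & nrm (p (u i) y - y') <= ep * nrm y,
    forall i y, span l y ->
      exists2 y', span l y' & nrm (p (hinv (u i)) y - y') <= ep * nrm y &
    forall x, x \in xs -> span l x].
Proof.
move=> xsD eps1p ep20.
pose us := [seq u i | i <- enum 'I_d] ++ [seq hinv (u i) | i <- enum 'I_d].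
have usV g : g \in us -> hinv g \in us.
  rewrite !mem_cat => /orP[/mapP[i _ ->]|/mapP[i _ ->]]; apply/orP.
    by right; apply: map_f; rewrite mem_enum.
  by left; rewrite hinvK map_f// mem_enum.
have uus i : u i \in us by rewrite mem_cat map_f// mem_enum.
have lp g := hact_linear p g.
have [es [e [[le es_e ne spe] [esD exs ecomm]]]] :=
  quasicentral definite sD Dact Done usV xsD eps1p.
have spD y : span es y -> D y by move=> /(_ D); apply.
have De x : D (e x) by exact: spD.
(* For [y] in [span es] the function [emb y] takes its values in [span Lg], so the functions with
   values there form a finite-dimensional invariant space containing [emb y]. *)
pose Lg := [seq p (hinv (bg a)) y | a <- enum K, y <- es].
have [gs [ogs g2L L2g]] := gram_schmidt definite Lg.
have spg a y : span es y -> span gs (p (hinv (bg a)) y).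
  move=> /(_ (fun y => span gs (p (hinv (bg a)) y))); apply.
    split; first by rewrite (lin0 (lp _)); exact: (span_subsp _).1.
    by move=> c y1 y2 h1 h2; rewrite lp; exact: (span_subsp _).2.
  move=> w wes; apply: L2g; apply: span_mem; apply/allpairsP.
  by exists (a, w); rewrite mem_enum.
have gsD y : span gs y -> D y.
  move=> /g2L /(_ D); apply => // w /allpairsP[[a v] [/= _ ves ->]].
  by apply: Dact; exact: esD.
pose DG (F : fspace K X) := forall a, span gs (F a).
have DGs : subsp DG.
  split=> [a|c F G DF DG' a]; first by rewrite ffunE; exact: (span_subsp _).1.
  by rewrite !ffunE; apply: (span_subsp _).2.
have DGact g F : DG F -> DG (krep K X g F).
  by move=> DF a; rewrite ffunE; apply: spanZ.
have DGK F : DG F -> DK F by move=> h a; exact: gsD.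
have embDG y : span es y -> DG (emb y).
  move=> sy; rewrite /emb /transfer; apply: (subsp_sum DGs) => a _ _.
  apply: (subspZ _ DGs); apply: DGact => a'; rewrite ffunE.
  by case: ifP => _; [exact: spg | exact: (span_subsp _).1].
pose m := size gs; pose J := (K * 'I_m)%type.
pose n0 : R := #|{: K * J}|%:R.
have n00 : 0 <= n0 by exact: ler0n.
(* Chosen so that [gram_close], applied to all translates of all the [eta t], gives a relative error
   of at most 1/2. *)
pose tau : R := (2 * (n0 + 1))^-1.
have tau0 : 0 < tau by rewrite invr_gt0; lra.
have taun : tau * n0 <= 2^-1.
  rewrite /tau invfM -mulrA ler_piMr ?invr_ge0// mulrC ler_pdivrMr ?mul1r; lra.
have [eta heta] := supply_family J Lg tau0.
have etaD t : D (eta t) by case: (heta t).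
have eta_es a t y : y \in es -> ip (p (bg a) (eta t)) y = 0.
  move=> yes; rewrite hact_adj; case: (heta t) => _ _ h _ _; apply: h.
  by apply/allpairsP; exists (a, y); rewrite mem_enum.
(* [T] sends the basis vector of [DG] given by the j-th vector of [gs] at the point [a] to the fresh
   vector [eta (a, j)]. *)
pose cf (F : fspace K X) (t : J) := ip (F t.1) gs`_t.2.
pose T F := \sum_t cf F t *: eta t.
have lT : linear T.
  move=> c F G; rewrite /T scaler_sumr -big_split /=; apply: eq_bigr => t _.
  by rewrite /cf !ffunE ipDZl scalerDl scalerA.
have TD F : D (T F).
  by apply: (subsp_sum sD) => t _ _; exact: (subspZ _ sD).
have cf_nsq F : DG F -> \sum_t cabs (cf F t) ^+ 2 = nsq F.
  move=> DF; rewrite fspace_nsq -(pair_bigA _ (fun (a : K) (j : 'I_m) => cabs (ip (F a) gs`_j) ^+ 2)).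
  apply: eq_bigr => a _; rewrite -[in RHS](proj_id ogs (DF a)) parseval//.
  by rewrite (big_nth 0) big_mkord.
have vip a a' t t' : ip (p (bg a) (eta t)) (p (bg a') (eta t')) =
    ip (p (hmul (hinv (bg a')) (bg a)) (eta t)) (eta t').
  by rewrite ipC hact_adj -ipC hactM.
have ortho (xs' : K -> fspace K X) : (forall a, DG (xs' a)) ->
    (forall a, ~~ Ap a -> xs' a = 0) ->
    `|nsq (\sum_a p (bg a) (T (xs' a))) - \sum_a nsq (xs' a)| <=
      2^-1 * \sum_a nsq (xs' a).
  move=> Dxs xsA.
  pose v (j : K * J) := p (bg j.1) (eta j.2); pose c (j : K * J) := cf (xs' j.1) j.2.
  have -> : \sum_a p (bg a) (T (xs' a)) = \sum_j c j *: v j.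
    rewrite -(pair_bigA _ (fun (a : K) (t : J) => cf (xs' a) t *: p (bg a) (eta t))).
    apply: eq_bigr => a _; rewrite (lin_sum _ _ _ (lp _)); apply: eq_bigr => t _.
    by rewrite (linZ _ _ (lp _)).
  have -> : \sum_a nsq (xs' a) = \sum_j cabs (c j) ^+ 2.
    rewrite -(pair_bigA _ (fun (a : K) (t : J) => cabs (cf (xs' a) t) ^+ 2)).
    by apply: eq_bigr => a _; rewrite cf_nsq.
  have s0 : 0 <= \sum_j cabs (c j) ^+ 2 by apply: sumr_ge0 => j _; exact: sqr_ge0.
  apply: (@le_trans _ _ (tau * n0 * \sum_j cabs (c j) ^+ 2)); last exact: ler_wpM2r.
  apply: (@gram_close _ _ _ v c (fun j => Ap j.1)); first exact: ltW.
    by move=> [a t] /= na; rewrite /c /cf /= xsA// ffunE ip0l.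
  move=> [a t] [a' t'] /= Aa Aa'; rewrite /v /= vip.
  case: (heta t) => _ h1 _ h2 h3.
  have [tt|tt] := eqVneq t t'; last first.
    rewrite h3// (_ : ((a, t) == (a', t')) = false) ?subrr ?cabs0 ?(ltW tau0)//.
    by apply/negP => /eqP[_ /eqP]; exact/negP.
  rewrite -tt xpair_eqE eqxx andbT; have [aa|aa] := eqVneq a a'.
    rewrite aa hVmul Done// ipxx h1 subrr cabs0; exact: ltW.
  by rewrite subr0; apply: h2 => //; rewrite eq_sym.
have Tbound F : DG F -> nrm (T F) <= 2 * nrm F.
  move=> DF; rewrite nrm_leP ?mulr_ge0 ?nrm_ge0// /T nsq_sumT_orth; last first.
    move=> t t' tt; rewrite ipZl ipZr; case: (heta t) => _ _ _ _ /(_ t' (ko K) (ko K) tt).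
    by rewrite hVmul Done// => ->; rewrite !mulr0.
  rewrite (eq_bigr (fun t => cabs (cf F t) ^+ 2)); last first.
    by move=> t _; rewrite nsqZ; case: (heta t) => _ -> _ _ _; rewrite mulr1.
  by rewrite cf_nsq// exprMn nrm2; have := nsq_ge0 F; lra.
pose V := transfer (krep K X) p T b phi.
have lV : linear V by exact: transfer_linear.
have one_k F : DG F -> krep K X hone F = F by move=> _; exact: krep_one.
have k2 : 0 <= (2^-1 : R) <= 1 by apply/andP; split; lra.
have TDG F : DG F -> D (T F) by move=> _; exact: TD.
have V_nsq F : DG F -> `|nsq (V F) - nsq F| <= 2^-1 * nsq F.
  exact: (transfer_nsq lT DGs DGact one_k phiA phi1 ortho).
have V_int i F : DG F -> nrm (p (u i) (V F) - V (krep K X (u i) F)) <= eps1 * nrm F.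
  apply: (transfer_intertwines lT DGs DGact one_k sD Dact Done TDG k2 phi1 Tbound ortho
    r0 eps00 (phi_slow i)).
  move=> a act; have [Aa Asa] := activeA act; split=> //.
  exists (kom K (z i a).2 * kap (ko K) (z i a).1); split; first exact: scal_unit.
    by move=> F' _; rewrite krep_z// subrr nrm0 mulr_ge0 ?nrm_ge0.
  by move=> F' _; apply: near_scal.
have V_D F : DG F -> D (V F) by exact: (transfer_D2 DGact sD Dact TDG).
have V_es F y : span es y -> ip (V F) y = 0.
  move=> sy; apply: ip_eq0C; apply: span_orth sy => w wes; apply: ip_eq0C.
  rewrite /V /transfer ip_suml big1// => a _; rewrite ipZl /T (lin_sum _ _ _ (lp _)).
  rewrite ip_suml big1 ?mulr0// => t _; rewrite (linZ _ _ (lp _)) ipZl.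
  by rewrite (eta_es a t w wes) mulr0.
have V_2 F : DG F -> nrm (V F) <= 2 * nrm F.
  move=> DF; rewrite nrm_leP ?mulr_ge0 ?nrm_ge0// exprMn nrm2.
  by have := V_nsq _ DF; rewrite ler_norml => /andP[_]; have := nsq_ge0 F; lra.
pose E F := e (embadj F).
pose W F := V (F - emb (E F)) + E F.
have lE : linear E by move=> c F G; rewrite /E embadj_linear le.
have lW : linear W.
  move=> c F G; rewrite /W lE emb_linear.
  rewrite opprD addrACA -scalerBr lV scalerDr !addrA; congr (_ + _).
  by rewrite [LHS]addrAC.
have EDG F : DG (emb (E F)) by apply: embDG; exact: spe.
have F1DG F : DG F -> DG (F - emb (E F)) by move=> DF; exact: (subspB DGs).
(* The two summands of [W F] are orthogonal, so [|W F|] controls both terms of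
   [|F| <= |F - emb (E F)| + |E F|]. *)
have W_low F : DG F -> nrm F <= 2 * nrm (W F).
  move=> DF; have h1 := nrm_triangle (F - emb (E F)) (emb (E F)).
  rewrite subrK in h1.
  have h2 : nrm (emb (E F)) = nrm (E F) by rewrite /nrm emb_nsq; last exact: De.
  have h3 : nsq (W F) = nsq (V (F - emb (E F))) + nsq (E F).
    by rewrite /W pythagoras// V_es//; exact: spe.
  have := V_nsq _ (F1DG _ DF); rewrite ler_norml => /andP[h4 _].
  rewrite -(@ler_pXn2r _ 2)// ?nnegrE ?mulr_ge0 ?nrm_ge0// exprMn [X in _ * X]nrm2 h3.
  rewrite h2 in h1; move: h4 h1; rewrite -(nrm2 (F - emb (E F))) -(nrm2 (E F)).
  have := nrm_ge0 (F - emb (E F)); have := nrm_ge0 (E F); have := nrm_ge0 F.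
  move: (nrm (F - _)) (nrm (E F)) (nrm F) (nsq (V _)) => a1 a2 a3 a4 q1 q2 q3 q4 q5.
  have : a3 ^+ 2 <= (a1 + a2) ^+ 2 by rewrite ler_pXn2r ?nnegrE ?addr_ge0.
  by have := sqr_ge0 (a1 - a2); nra.
have nE F : DG F -> nrm (E F) <= nrm F.
  by move=> /DGK DF; apply: le_trans (ne _) _; exact: nrm_embadj.
(* The defects of [V] on [F - emb (E F)], of [emb E] seen through [V], and of [E] contribute 2, 6
   and 2 times [eps1 |F|]. With the factor 2 of [W_low] this accounts for [20 * eps1 <= ep]. *)
have W_int i F : DG F -> nrm (p (u i) (W F) - W (krep K X (u i) F)) <= ep / 2 * nrm F.
  move=> DF; pose G := krep K X (u i) F; have DG' : DG G by exact: DGact.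
  have KF := DGK _ DF.
  (* defect of E as an intertwiner *)
  have dE : nrm (p (u i) (E F) - E G) <= 2 * eps1 * nrm F.
    have -> : p (u i) (E F) - E G = - (e (p (u i) (embadj F)) - p (u i) (e (embadj F)))
       - e (embadj G - p (u i) (embadj F)).
      by rewrite (linB _ _ le) !opprB -/(E F) -/(E G) [RHS]addrA subrK.
    apply: le_trans (nrm_triangleB _ _) _; rewrite nrmN.
    have h1 := ecomm _ (embadj F) (uus i).
    have h2 := ne (embadj G - p (u i) (embadj F)).
    have h3 := embadj_intertwines i KF; have h4 := nrm_embadj KF.
    have h5 : eps1 * nrm (embadj F) <= eps1 * nrm F by rewrite ler_wpM2l ?(ltW eps1p).
    by lra.
  have d2 : nrm (krep K X (u i) (emb (E F)) - emb (E G)) <= 3 * eps1 * nrm F.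
    apply: le_trans (nrm_dist _ (emb (p (u i) (E F))) _) _.
    have h1 := emb_intertwines i (De (embadj F)); rewrite -/(E F) in h1.
    have h2 : nrm (emb (p (u i) (E F)) - emb (E G)) = nrm (p (u i) (E F) - E G).
      rewrite -(linB _ _ emb_linear) /nrm emb_nsq//.
      by apply: (subspB sD); [apply: Dact|]; exact: De.
    have h3 : eps1 * nrm (E F) <= eps1 * nrm F by rewrite ler_wpM2l ?(ltW eps1p) ?nE.
    by rewrite h2; lra.
  have -> : p (u i) (W F) - W G =
      (p (u i) (V (F - emb (E F))) - V (krep K X (u i) (F - emb (E F)))) +
      (V (- (krep K X (u i) (emb (E F)) - emb (E G))) + (p (u i) (E F) - E G)).
    rewrite /W (linD _ _ (lp _)) opprD addrACA.
    have -> : V (G - emb (E G)) = V (krep K X (u i) (F - emb (E F))) +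
        V (krep K X (u i) (emb (E F)) - emb (E G)).
      rewrite -(linD _ _ lV); congr V.
      by rewrite [krep K X (u i) (F - _)](linB _ _ (hact_linear _ _)) addrA subrK.
    by rewrite opprD -!(linN _ lV) !addrA.
  apply: le_trans (nrm_triangle _ _) _.
  have h1 := V_int i _ (F1DG _ DF).
  have h2 : nrm (F - emb (E F)) <= 2 * nrm F.
    apply: le_trans (nrm_triangleB _ _) _.
    have -> : nrm (emb (E F)) = nrm (E F) by rewrite /nrm emb_nsq; last exact: De.
    by have := nE _ DF; lra.
  have h3 : eps1 * nrm (F - emb (E F)) <= eps1 * (2 * nrm F) by rewrite ler_wpM2l ?(ltW eps1p).
  have h4 := nrm_triangle (V (- (krep K X (u i) (emb (E F)) - emb (E G)))) (p (u i) (E F) - E G).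
  have h5 : nrm (V (- (krep K X (u i) (emb (E F)) - emb (E G)))) <= 2 * (3 * eps1 * nrm F).
    apply: le_trans (V_2 _ _) _; last by rewrite nrmN ler_wpM2l.
    have -> : - (krep K X (u i) (emb (E F)) - emb (E G)) =
      emb (E G) - krep K X (u i) (emb (E F)) by rewrite opprB.
    by apply: (subspB DGs) => //; exact: DGact.
  have h6 : 10 * eps1 * nrm F <= ep / 2 * nrm F.
    by rewrite ler_wpM2r ?nrm_ge0//; lra.
  by lra.
pose pt a g : fspace K X := [ffun a' => if a' == a then g else 0].
have ptDG a g : g \in gs -> DG (pt a g).
  move=> ggs a'; rewrite ffunE; case: ifP => _; first exact: span_mem.
  exact: (span_subsp _).1.
pose l := [seq W (pt a g) | a <- enum K, g <- gs].
have l2W y : span l y -> exists2 F, DG F & y = W F.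
  move=> /(_ (fun y => exists2 F, DG F & y = W F)); apply.
    split; first by exists 0; [exact: DGs.1 | rewrite (lin0 lW)].
    move=> c _ _ [F DF ->] [G DG' ->]; exists (c *: F + G); first exact: DGs.2.
    by rewrite lW.
  by move=> _ /allpairsP[[a g] [/= _ ggs ->]]; exists (pt a g) => //; exact: ptDG.
have W2l F : DG F -> span l (W F).
  move=> DF.
  pose pa a : fspace K X := \sum_(g <- gs) ip (F a) g *: pt a g.
  have paE a a' : pa a a' = if a' == a then F a' else 0.
    rewrite /pa fspace_sumE; have [->|h] := eqVneq a' a.
      rewrite -[in RHS](proj_id ogs (DF a)); apply: eq_bigr => g _.
      by rewrite !ffunE eqxx.
    by rewrite big1// => g _; rewrite !ffunE (negPf h) scaler0.
  have -> : F = \sum_(a in K) pa a.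
    apply/ffunP => a; rewrite fspace_sumE (bigD1 a)//= paE eqxx big1 ?addr0//.
    by move=> a' /negPf a'a; rewrite paE eq_sym a'a.
  rewrite (lin_sum _ _ _ lW); apply: (subsp_sum (span_subsp _)) => a _ _.
  rewrite /pa (lin_sum _ _ _ lW); apply: (subsp_sum (span_subsp _)) => g ggs _.
  rewrite (linZ _ _ lW); apply: spanZ; apply: span_mem; apply/allpairsP.
  by exists (a, g); rewrite mem_enum.
have epW c F : DG F -> c <= ep / 2 * nrm F -> c <= ep * nrm (W F).
  move=> DF h; apply: le_trans h _.
  have : ep / 2 * nrm F <= ep / 2 * (2 * nrm (W F)).
    by rewrite ler_wpM2l ?W_low//; have := ltW eps1p; lra.
  by lra.
exists l; split.
- move=> y /span_mem/l2W[F DF ->]; apply: (subspD sD); last exact: De.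
  by apply: V_D; exact: F1DG.
- move=> i _ /l2W[F DF ->]; exists (W (krep K X (u i) F)); first by apply: W2l; exact: DGact.
  by apply: epW => //; exact: W_int.
- move=> i _ /l2W[F DF ->]; pose G := krep K X (hinv (u i)) F.
  have DG' : DG G by exact: DGact.
  exists (W G); first exact: W2l.
  apply: epW => //.
  have FG : krep K X (u i) G = F by rewrite hactV// krep_one.
  have WD H : DG H -> D (W H).
    by move=> DH; apply: (subspD sD); [apply: V_D; exact: F1DG | exact: De].
  have -> : nrm (p (hinv (u i)) (W F) - W G) = nrm (p (u i) (W G) - W (krep K X (u i) G)).
    rewrite FG nrmBC -(hact_nrm (p := p) (u i)); last first.
      by apply: Done; apply: (subspB sD); [apply: WD | apply: Dact; exact: WD].
    by rewrite (linB _ _ (lp _)) hactV// Done//; exact: WD.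
  apply: le_trans (W_int i _ DG') _.
  by rewrite /G (hact_nrm (p := krep K X)) ?krep_one.
- move=> x xxs; have sx : span es x by rewrite -(exs _ xxs); exact: spe.
  have -> : x = W (emb x).
    by rewrite /W /E embadjK ?exs ?subrr ?(lin0 lV) ?add0r//; exact: xsD.
  by apply: W2l; exact: embDG.
Qed.

End Absorption.

(** * Diffuse vectors *)

Section Pigeonhole.
Variables (R : realType) (X : choiceType).

Lemma disc_net (tol : R) : 0 < tol -> exists cs : seq R[i],
  forall z, cabs z <= 1 -> exists2 s, s \in cs & cabs (z - s) <= tol.
Proof.
move=> tol0; pose N := (Num.truncn (2 / tol)).+1.
have N0 : 0 < N%:R :> R by rewrite ltr0n.
have Ntol : 2 / N%:R <= tol.
  by rewrite ler_pdivrMr// mulrC -ler_pdivrMr// ltW// truncnS_gt.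
pose pt (i : nat) : R := (i%:R - N%:R) / N%:R.
exists [seq Complex (pt i) (pt j) | i <- iota 0 (N.*2).+1, j <- iota 0 (N.*2).+1].
have near (a : R) : `|a| <= 1 -> exists2 i, i \in iota 0 (N.*2).+1 & `|a - pt i| <= N%:R^-1.
  rewrite ler_norml => /andP[a1 a2].
  have b0 : 0 <= (a + 1) * N%:R by rewrite mulr_ge0//; lra.
  exists (Num.truncn ((a + 1) * N%:R)).
    rewrite mem_iota /= add0n ltnS -(ler_nat R) -addnn natrD.
    have /andP[+ _] := truncn_itv b0; nra.
  set i := Num.truncn _.
  have h1 : i%:R <= (a + 1) * N%:R by have /andP[] := truncn_itv b0.
  have h2 : (a + 1) * N%:R < i%:R + 1 by rewrite natr1 truncnS_gt.
  have -> : a - pt i = ((a + 1) * N%:R - i%:R) / N%:R.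
    by rewrite /pt; field; rewrite gt_eqF.
  rewrite normrM normfV (gtr0_norm N0) ler_piMl ?invr_ge0 ?ler_norml//.
  by apply/andP; split; lra.
move=> [a b] z1.
have re1 : `|a| <= 1 by apply: le_trans (ler_Re_cabs (Complex a b)) z1.
have im1 : `|b| <= 1.
  apply: le_trans z1; rewrite -(ler_pXn2r (n := 2))// ?nnegrE ?cabs_ge0//.
  rewrite /cabs normc_def /= sqr_sqrtr ?addr_ge0 ?sqr_ge0//.
  by rewrite real_normK ?num_real// lerDr sqr_ge0.
have [i hi ai] := near _ re1; have [j hj bj] := near _ im1.
exists (Complex (pt i) (pt j)); first by apply/allpairsP; exists (i, j).
apply: le_trans Ntol.
have -> : Complex a b - Complex (pt i) (pt j) =
    (a - pt i)%:C + 'i%C * (b - pt j)%:C.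
  by apply/eqP; rewrite eq_complex /= !(mul0r, mul1r, mulr0, subr0, add0r, addr0, oppr0) !eqxx.
apply: le_trans (cabsD _ _) _; rewrite cabsM !cabs_real.
have -> : cabs ('i%C : R[i]) = 1 by rewrite /cabs normc_def /= expr0n expr1n add0r sqrtr1.
by rewrite mul1r; lra.
Qed.

(** Compactness of the disc: if for each point [c] of a finite net some constraint [F c] excluded
    values near [c], the concatenation of these constraints would admit no [x]. *)
Lemma pigeonhole (Q : seq X -> X -> Prop) (I : eqType) (w : I -> X -> R[i]) (l : seq I) (tol : R) :
  0 < tol -> (forall F F' x, Q (F ++ F') x -> Q F x /\ Q F' x) ->
  (forall F, exists x, Q F x) ->
  (forall F x i, Q F x -> i \in l -> cabs (w i x) <= 1) ->
  exists s : I -> R[i], forall F, exists x, Q F x /\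
    forall i, i \in l -> cabs (w i x - s i) <= tol.
Proof.
move=> tol0 Qcat Qex; elim: l => [|i l IH] w1.
  by exists (fun=> 0) => F; have [x] := Qex F; exists x.
have [|s hs] := IH; first by move=> F x j Qx jl; apply: w1 Qx _; rewrite inE jl orbT.
have [cs hcs] := disc_net tol0.
suff [c hc] : exists c, forall F, exists x, [/\ Q F x,
    forall j, j \in l -> cabs (w j x - s j) <= tol & cabs (w i x - c) <= tol].
  exists (fun j => if j == i then c else s j) => F; have [x [h1 h2 h3]] := hc F.
  exists x; split=> // j; rewrite inE; have [-> _ //|_ /= jl] := eqVneq j i.
  exact: h2.
apply/not_existsP => no.
have /choice[F hF] : forall c, exists F, forall x, Q F x ->
    (forall j, j \in l -> cabs (w j x - s j) <= tol) -> ~ cabs (w i x - c) <= tol.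
  move=> c; have /existsNP[F /forallNP h] := no c; exists F => x h1 h2 h3.
  by apply: (h x).
pose FF := flatten [seq F c | c <- cs].
have [x [Qx xs]] := hs FF.
have [|c ccs hc] := hcs (w i x); first by apply: w1 Qx _; rewrite inE eqxx.
apply: (hF c x _ xs hc).
move: Qx; rewrite /FF; elim: (cs) ccs => [//|c' cs' IH2].
rewrite inE /= => /orP[/eqP <-|/IH2 h]; first by move/Qcat => [].
by move/Qcat => [_ /h].
Qed.

End Pigeonhole.

Section Supply.
Variables (R : realType) (d : nat) (X : ipspace R) (p : hrep d X).
Variable D : X -> Prop.
Hypothesis sD : subsp D.
Hypothesis Dact : forall g x, D x -> D (p g x).
Hypothesis Done : forall x, D x -> p hone x = x.

(** Each new vector avoids the translates of the earlier ones by [G] and by the inverses of [G],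
    which settles both orders of the two indices. *)
Lemma indep_family (J : finType) (P : X -> Prop) (F : seq X) (G : seq (heis d)) :
  (forall F' : seq X, exists x, P x /\ forall f, f \in F' -> ip x f = 0) ->
  exists xs : J -> X, forall t, [/\ P (xs t),
    forall f, f \in F -> ip (xs t) f = 0 &
    forall t' g, t != t' -> g \in G -> ip (p g (xs t)) (xs t') = 0].
Proof.
move=> supply.
suff [xs h] : exists xs : J -> X, forall t, t \in enum J -> [/\ P (xs t),
    forall f, f \in F -> ip (xs t) f = 0 &
    forall t' g, t' \in enum J -> t != t' -> g \in G -> ip (p g (xs t)) (xs t') = 0].
  exists xs => t; have [|h1 h2 h3] := h t; first by rewrite mem_enum.
  by split=> // t' g; apply: h3; rewrite mem_enum.
elim: (enum J) => [|t0 l [xs IH]]; first by exists (fun=> 0).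
have [x [Px xF]] := supply (F ++ [seq p gt.1 (xs gt.2) |
   gt <- [seq (g, t) | g <- G ++ [seq hinv g | g <- G], t <- l]]).
have xg t g : t \in l -> g \in G ++ [seq hinv g | g <- G] -> ip x (p g (xs t)) = 0.
  move=> tl gG; apply: xF; rewrite mem_cat; apply/orP; right.
  by apply/mapP; exists (g, t) => //; apply/allpairsP; exists (g, t).
exists (fun t => if t == t0 then x else xs t) => t.
rewrite inE; have [->|tt0] /= := eqVneq t t0 => tl.
  split=> //; first by move=> f fF; apply: xF; rewrite mem_cat fF.
  move=> t' g; rewrite inE eq_sym => t'l /negPf tt' gG; rewrite tt'.
  rewrite tt' /= in t'l.
  by rewrite hact_adj; apply: xg => //; rewrite mem_cat map_f ?orbT.
have [h1 h2 h3] := IH _ tl; split=> // t' g.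
rewrite inE; have [-> _ _ gG|t't0] /= := eqVneq t' t0; last exact: h3.
by apply: ip_eq0C; apply: xg => //; rewrite mem_cat gG.
Qed.

Hypothesis Dinf : forall F : seq X, exists x, [/\ D x, nsq x = 1 & forall f, f \in F -> ip x f = 0].

(** The central component of the commutator of [(k, c)] with the i-th generator. *)
Definition cm (k : 'rV[int]_d) i : 'M[int]_d :=
  k^T *m delta_mx 0 i - (delta_mx 0 i)^T *m k.

(** Conjugation by powers of the i-th generator multiplies [(k, c)] by powers of a central element
    that stays away from 1; averaging over these conjugates makes coefficients small. *)
Definition drift k := exists i (del : R), 0 < del /\
  forall x, D x -> del * nrm x <= nrm (p (0, cm k i) x - x).

Let pw i n : heis d := (delta_mx 0 i *+ n, 0).

Lemma conj_pw i n k c :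
  hmul (hinv (pw i n)) (hmul (k, c) (pw i n)) = (k, c + cm k i *+ n) :> heis d.
Proof.
rewrite /hmul /hinv /pw /=; congr (_, _).
  by rewrite addrC addrK.
rewrite oppr0 add0r addr0 trmx_opp !mulmxDr !mulNmx.
set A := (_ *+ n)^T *m (_ *+ n).
have -> : k^T *m (delta_mx 0 i *+ n) = (k^T *m delta_mx 0 i) *+ n.
  by rewrite -scaler_nat -scalemxAr scaler_nat.
have -> : (delta_mx 0 i *+ n)^T *m k = ((delta_mx 0 i)^T *m k) *+ n.
  by rewrite -scaler_nat linearZ /= -scalemxAl scaler_nat.
rewrite /cm mulrnBl.
by rewrite [LHS](AC (1*2*2) (2*(3*4)*(1*5)))%AC /= subrr addr0.
Qed.

(** Applying [p (0, c) - 1] telescopes the geometric sum to a difference of two vectors of norm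
    [|y|]. *)
Lemma geometric_bound c (del : R) T y : D y -> 0 < del ->
  (forall x, D x -> del * nrm x <= nrm (p (0, c) x - x)) ->
  del * nrm (\sum_(n < T) p (0, c *+ n) y) <= 2 * nrm y.
Proof.
move=> Dy del0 h; have lp g := hact_linear p g.
set Z := \sum_(n < T) _.
have DZ : D Z by apply: (subsp_sum sD) => n _ _; exact: Dact.
apply: le_trans (h _ DZ) _.
have -> : p (0, c) Z - Z = p (0, c *+ T) y - y.
  rewrite /Z (lin_sum _ _ _ (lp _)).
  rewrite (eq_bigr (fun n : 'I_T => p (0, c *+ n.+1) y)); last first.
    move=> n _; rewrite -hactM; congr (p _ _).
    by rewrite /hmul /= trmx0 mul0mx !addr0 mulrS.
  rewrite -sumrB.
  rewrite -(big_mkord xpredT (fun n => p (0, c *+ n.+1) y - p (0, c *+ n) y)).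
  by rewrite telescope_sumr// mulr0n Done.
apply: le_trans (nrm_triangleB _ _) _; rewrite hact_nrm ?Done//; lra.
Qed.

(** Induction on [Ks]. For a new [k0], take [T] mutually independent vectors [x l] that are diffuse
    for [Ks] and have nearly equal coefficients at [k0], conjugate the l-th by the l-th power of the
    generator witnessing the drift, and add. The coefficient at [k0] becomes nearly the average of a
    geometric sum applied to one vector, hence small. *)
Lemma diffuse_supply (Ks : seq 'rV[int]_d) : (forall k, k \in Ks -> drift k) ->
  forall (tau : R) (F : seq X) (cs : seq 'M[int]_d), 0 < tau ->
  exists x, [/\ D x, nsq x = 1, forall f, f \in F -> ip x f = 0 &
    forall k c, k \in Ks -> c \in cs -> cabs (ip (p (k, c) x) x) <= tau].
Proof.
elim: Ks => [|k0 Ks IH] hK tau F cs tau0.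
  by have [x [h1 h2 h3]] := Dinf F; exists x.
have {}IH := IH (fun k kK => hK k (mem_behead (s := k0 :: Ks) kK)).
have [i [del [del0 hdel]]] := hK k0 (mem_head _ _).
(* Averaging the geometric sum over [T] terms leaves [2 / (del T) <= tau / 4]. *)
pose T := (Num.truncn (8 / (del * tau))).+1.
have T0 : 0 < T%:R :> R by rewrite ltr0n.
have hT : 8 <= T%:R * (del * tau).
  by rewrite -ler_pdivrMr ?mulr_gt0// ltW// truncnS_gt.
(* Conjugation by the l-th power changes [c] into [c + cm k i *+ l]; the coefficients at the old [k]
   must be small for all of these. *)
pose cs' := [seq c.1 + cm c.2.1 i *+ c.2.2 | c <-
  [seq (c, kl) | c <- cs, kl <- [seq (k, l) | k <- Ks, l <- iota 0 T]]].
pose Q (F' : seq X) x := [/\ D x, nsq x = 1, forall f, f \in F' -> ip x f = 0 &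
    forall k c, k \in Ks -> c \in cs' -> cabs (ip (p (k, c) x) x) <= tau / 2].
have tau20 : 0 < tau / 2 by rewrite divr_gt0.
have tau40 : 0 < tau / 4 by rewrite divr_gt0.
pose w (cl : 'M[int]_d * nat) x := ip (p (k0, cl.1 + cm k0 i *+ cl.2) x) x.
pose cls := [seq (c, l) | c <- cs, l <- iota 0 T].
(* This makes the coefficients at [k0] of all the [x l] agree with common values [s] up to
   [tau / 4], so that a single vector [x0] can stand for all of them. *)
have [|||s hs] := @pigeonhole R X Q _ w cls (tau / 4) tau40.
- move=> F1 F2 x [h1 h2 h3 h4]; split; split=> // f hf; apply: h3.
    by rewrite mem_cat hf.
  by rewrite mem_cat hf orbT.
- by move=> F'; exact: IH.
- move=> F' x cl [Dx x1 _ _] _; apply: le_trans (cauchy_schwarz _ _) _.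
  by rewrite hact_nrm ?Done// -expr2 nrm2 x1.
pose P x := [/\ D x, nsq x = 1,
    forall k c, k \in Ks -> c \in cs' -> cabs (ip (p (k, c) x) x) <= tau / 2 &
    forall cl, cl \in cls -> cabs (w cl x - s cl) <= tau / 4].
pose gs := hone :: [seq (k, c) | k <- k0 :: Ks, c <- cs].
pose G := [seq hmul (hinv (pw i a.2.2)) (hmul a.1 (pw i a.2.1)) |
  a <- [seq (g, ll) | g <- gs, ll <- [seq (l, l') | l <- iota 0 T, l' <- iota 0 T]]].
pose F1 := [seq p (hinv (pw i a.1)) a.2 | a <- [seq (l, f) | l <- iota 0 T, f <- F]].
have [|x hx] := @indep_family 'I_T P F1 G.
  move=> F'; have [x [[h1 h2 h3 h4] h5]] := hs F'.
  by exists x.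
pose y (l : 'I_T) := p (pw i l) (x l).
have Dx l : D (x l) by have [[]] := hx l.
have x1 l : nsq (x l) = 1 by have [[]] := hx l.
have memT (l : 'I_T) : (l : nat) \in iota 0 T by rewrite mem_iota ltn_ord.
have yy l l' g : l != l' -> g \in gs -> ip (p g (y l)) (y l') = 0.
  move=> ll gg; rewrite /y ipC hact_adj -ipC -[p g (p _ _)]hactM -hactM.
  have [_ _ h] := hx l; apply: h => //; apply/mapP; exists (g, (l : nat, l' : nat)) => //.
  apply/allpairsP; exists (g, (l : nat, l' : nat)); split=> //.
  by apply/allpairsP; exists (l : nat, l' : nat); split=> //=; exact: memT.
have ny1 (t : 'I_T) : nsq (y t) = 1 by rewrite /y hact_nsq ?x1//; exact: Done.
have yorth (t t' : 'I_T) : t != t' -> ip (y t) (y t') = 0.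
  move=> ll; have := yy t t' hone ll; rewrite inE eqxx => /(_ isT).
  by rewrite hact_one.
have yg (t : 'I_T) k c : ip (p (k, c) (y t)) (y t) = ip (p (k, c + cm k i *+ t) (x t)) (x t).
  by rewrite /y ipC hact_adj -ipC -[p (k, c) (p _ _)]hactM -hactM conj_pw.
pose q : R := (Num.sqrt T%:R)^-1.
have q2 : q ^+ 2 = T%:R^-1 by rewrite exprVn sqr_sqrtr// ltW.
have q0 : 0 <= q by rewrite invr_ge0 sqrtr_ge0.
(* The [y l] stay mutually orthogonal when moved by [gs], so the coefficients of [eta] are plain
   averages of those of the [y l]. *)
pose eta := q%:C *: \sum_l y l.
have etag g : g \in gs -> ip (p g eta) eta = (T%:R^-1)%:C * \sum_l ip (p g (y l)) (y l).
  move=> gg; rewrite /eta (linZ _ _ (hact_linear p g)) ipZl ipZr conj_real mulrA.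
  rewrite -rmorphM /= -expr2 q2; congr (_ * _).
  rewrite (lin_sum _ _ _ (hact_linear p g)) ip_suml; apply: eq_bigr => l _.
  rewrite ip_sumr (bigD1 l)//= big1 ?addr0// => l' ll; apply: yy => //.
  by rewrite eq_sym.
exists eta; split.
- apply: (subspZ _ sD); apply: (subsp_sum sD) => l _ _; exact: Dact.
- rewrite /eta nsqZ cabs_real real_normK ?num_real// q2 nsq_sumT_orth//.
  rewrite (eq_bigr (fun=> 1)) ?sumr_const ?card_ord => [|l _]; last exact: ny1.
  by rewrite mulVf ?gt_eqF.
- move=> f fF; rewrite /eta ipZl ip_suml big1 ?mulr0// => l _.
  rewrite /y hact_adj; have [_ h _] := hx l; apply: h.
  apply/mapP; exists (l : nat, f) => //; apply/allpairsP.
  by exists (l : nat, f); split=> //=; exact: memT.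
move=> k c; rewrite inE => kK ccs.
have gg : (k, c) \in gs.
  by rewrite inE; apply/orP; right; apply/allpairsP; exists (k, c); rewrite inE.
rewrite etag// cabsM cabs_real ger0_norm ?invr_ge0 ?(ltW T0)// ler_pdivrMl//.
have memcs l : (l : 'I_T, c).2 \in cs by [].
case/orP: kK => [/eqP kk|kK]; last first.
  apply: le_trans (cabs_sum _ _ _) _.
  apply: (@le_trans _ _ (\sum_(l < T) (tau / 2))).
    apply: ler_sum => l _; rewrite yg; have [[_ _ h _] _ _] := hx l; apply: h => //.
    apply/mapP; exists (c, (k, l : nat)) => //; apply/allpairsP; exists (c, (k, l : nat)).
    by split=> //; apply/allpairsP; exists (k, l : nat); split=> //=; exact: memT.
  rewrite sumr_const card_ord -[_ *+ _]mulr_natl ler_wpM2l ?ler0n//; lra.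
have clm (l : 'I_T) : (c, l : nat) \in cls by apply/allpairsP; exists (c, l : nat); split=> //=; exact: memT.
have near l : cabs (ip (p (k, c) (y l)) (y l) - s (c, l : nat)) <= tau / 4.
  by rewrite kk yg; have [[_ _ _ h] _ _] := hx l; exact: (h _ (clm l)).
pose x0 := x ord0.
have near0 (l : 'I_T) : cabs (s (c, l : nat) - w (c, l : nat) x0) <= tau / 4.
  by rewrite cabsB; have [[_ _ _ h] _ _] := hx ord0; exact: (h _ (clm l)).
have zero : cabs (\sum_(l < T) w (c, l : nat) x0) <= T%:R * (tau / 4).
  have -> : \sum_(l < T) w (c, l : nat) x0 =
     ip (\sum_(l < T) p (0, cm k0 i *+ l) (p (k0, c) x0)) x0.
    rewrite ip_suml; apply: eq_bigr => l _; rewrite /w -hactM; congr (ip (p _ _) _).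
    by rewrite /hmul /= add0r trmx0 mul0mx addr0 addrC.
  apply: le_trans (cauchy_schwarz _ _) _.
  have nx0 : nrm x0 = 1 by rewrite /nrm x1 sqrtr1.
  have := @geometric_bound (cm k0 i) del T (p (k0, c) x0) (Dact _ (Dx _)) del0 hdel.
  have nk : nrm (p (k0, c) x0) = 1.
    by rewrite hact_nrm; [exact: nx0 | apply: Done; exact: Dx].
  rewrite nk nx0 !mulr1; set n := nrm _ => h.
  by rewrite -(ler_pM2l del0); move: h hT; nra.
have -> : \sum_l ip (p (k, c) (y l)) (y l) =
    \sum_l (ip (p (k, c) (y l)) (y l) - s (c, l : nat)) +
    (\sum_(l < T) (s (c, l : nat) - w (c, l : nat) x0) + \sum_(l < T) w (c, l : nat) x0).
  rewrite -!big_split /=; apply: eq_bigr => l _; by rewrite !subrK.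
have sumb (f : 'I_T -> R[i]) : (forall l, cabs (f l) <= tau / 4) ->
    cabs (\sum_l f l) <= T%:R * (tau / 4).
  move=> h; apply: le_trans (cabs_sum _ _ _) _.
  apply: (@le_trans _ _ (\sum_(l < T) (tau / 4))); first exact: ler_sum.
  by rewrite sumr_const card_ord mulr_natl.
apply: le_trans (cabsD _ _) _.
have h1 := sumb _ near; have h2 := sumb _ near0.
have h3 := cabsD (\sum_(l < T) (s (c, l : nat) - w (c, l : nat) x0)) (\sum_(l < T) w (c, l : nat) x0).
have : 0 <= T%:R * (tau / 4) by rewrite mulr_ge0 ?ler0n ?(ltW tau40).
by lra.
Qed.

End Supply.

(** * A Folner function *)

Section FolnerFunction.
Variables (R : realType) (d : nat) (K : kdata R d) (s : nat).
Let dl i : 'rV[int]_d := delta_mx 0 i.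

Let vec n (sh : int) (k : {ffun 'I_d -> 'I_n}) : 'rV[int]_d := \row_i ((k i)%:Z - sh).
Let box := {ffun 'I_d -> 'I_s.+1}.
Let N (a : K) : nat := (\sum_(k : box) (ktr (ko K) (vec 0 k) == a))%N.

Lemma card_face (i : 'I_d) : (#|[pred k : box | k i == ord_max]| * s.+1 = s.+1 ^ d)%N.
Proof.
have -> : #|[pred k : box | k i == ord_max]| =
    #|family (fun x => if x == i then pred1 (@ord_max s) else predT)|.
  apply: eq_card => k; rewrite !inE; apply/eqP/familyP => [h x|/(_ i)].
    by case: eqP => [->|//]; rewrite inE h.
  by rewrite eqxx inE => /eqP.
rewrite card_family.
have -> (f : 'I_d -> nat) : foldr muln 1%N [seq f x | x : 'I_d] = (\prod_x f x)%N.
  by rewrite -big_enum/= /image_mem unlock; elim: (enum _) => //= x l ->.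
rewrite (bigD1 i)//= eqxx card1 mul1n.
rewrite (eq_bigr (fun=> s.+1)); last by move=> x /negPf ->; rewrite card_ord.
rewrite -{2}[s.+1]muln1 mulnC muln1.
have -> : (s.+1 ^ d = \prod_(x < d) s.+1)%N by rewrite prod_nat_const card_ord.
by rewrite [RHS](bigD1 i).
Qed.

Let cyc (i : 'I_d) (k : box) : box := [ffun x => if x == i then ordS (k x) else k x].

Lemma cyc_bij i : bijective (cyc i).
Proof.
exists (fun k : box => [ffun x => if x == i then ord_pred (k x) else k x] : box) => k;
  apply/ffunP => x; rewrite !ffunE; case: eqP => // _.
  exact: ordSK.
exact: ord_predK.
Qed.

Lemma vec_cyc i (k : box) : k i != ord_max -> vec 0 (cyc i k) - dl i = vec 0 k.
Proof.
move=> kx; apply/rowP => x; rewrite !mxE !ffunE eqxx/= !subr0.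
have [->|ne] := eqVneq x i; last by rewrite subr0.
rewrite /= modn_small.
  by rewrite -addn1 PoszD addrK.
by move: kx; rewrite -val_eqE/=; have := ltn_ord (k i); lia.
Qed.

Lemma sum_indicator (x : K) : \sum_(a : K) (x == a)%:R = 1 :> R.
Proof. by rewrite (bigD1 x)//= eqxx big1 ?addr0// => a /negPf h; rewrite eq_sym h. Qed.

(** The rotation [cyc i] of the box agrees with the translation by the i-th unit vector off the face
    where that coordinate is maximal, so only this face contributes. *)
Lemma sum_N_shift i : (\sum_a `|(N a)%:R - (N (ktr a (dl i)))%:R| <=
  2 * #|[pred k : box | k i == ord_max]|%:R :> R).
Proof.
have NS a : N (ktr a (dl i)) = (\sum_(k : box) (ktr (ko K) (vec 0 (cyc i k) - dl i) == a))%N.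
  rewrite /N (reindex (cyc i)); last by apply: onW_bij; exact: cyc_bij.
  apply: eq_bigr => k _; congr (nat_of_bool _).
  by rewrite ktrD; apply/eqP/eqP => [->|<-]; rewrite ?ktrK ?ktrVK.
have st a : `|(N a)%:R - (N (ktr a (dl i)))%:R| <= \sum_(k : box | k i == ord_max)
    ((ktr (ko K) (vec 0 k) == a)%:R + (ktr (ko K) (vec 0 (cyc i k) - dl i) == a)%:R) :> R.
  rewrite NS /N !natr_sum -sumrB [in leRHS]big_mkcond/=.
  apply: le_trans (ler_norm_sum _ _ _) _; apply: ler_sum => k _; case: ifP => [_|/negbT kx].
    by apply: le_trans (ler_normB _ _) _; rewrite !ger0_norm ?ler0n.
  by rewrite vec_cyc// subrr normr0.
apply: le_trans (ler_sum _ (fun a _ => st a)) _.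
rewrite exchange_big/= -sum1_card natr_sum mulr_sumr.
rewrite (eq_bigl (fun k : box => k i == ord_max))//; apply: ler_sum => k _.
by rewrite big_split/= !sum_indicator; lra.
Qed.

Lemma sum_N : (\sum_a (N a) = s.+1 ^ d)%N.
Proof.
rewrite exchange_big/= (eq_bigr (fun=> 1%N)).
  by rewrite sum1_card card_ffun !card_ord.
move=> k _; rewrite (bigD1 (ktr (ko K) (vec 0 k)) isT)/= eqxx big1// => a /negPf h.
by rewrite eq_sym h.
Qed.

Lemma N_gt0 a : (0 < N a)%N -> exists k : box, ktr (ko K) (vec 0 k) = a.
Proof.
rewrite lt0n sum_nat_eq0 => /forallPn[k]; rewrite eqb0 negbK => /eqP h.
by exists k.
Qed.

(** [phi] is the square root of the image of the uniform measure on a box. As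
    [(x - y)^2 <= |x^2 - y^2|] for nonnegative numbers, its variation reduces to the face count, at
    most [2 / (s + 1)] of the box. [Ap] is the image of a box wider by 1 on each side, so it
    contains the neighbours of the support of [phi]. *)
Lemma folner_function (eps0 : R) : 0 <= eps0 -> 2 <= eps0 ^+ 2 * s.+1%:R ->
  exists (b : K -> 'rV[int]_d) (phi : K -> R) (Ap : pred K),
  [/\ forall a, Ap a -> ktr (ko K) (b a) = a /\ forall i, `|b a 0 i| <= s.+1%:R,
      forall a, phi a != 0 -> Ap a,
      \sum_a phi a ^+ 2 = 1,
      forall i, \sum_a (phi a - phi (ktr a (dl i))) ^+ 2 <= eps0 ^+ 2 &
      (forall i a, (phi a != 0) || (phi (ktr a (dl i)) != 0) -> Ap a /\ Ap (ktr a (dl i))) /\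
      (#|Ap| <= s.+3 ^ d)%N].
Proof.
move=> e0 es.
pose bigbox := {ffun 'I_d -> 'I_s.+3}.
pose Ap (a : K) := [exists k : bigbox, ktr (ko K) (vec 1 k) == a].
pose b (a : K) := if [pick k : bigbox | ktr (ko K) (vec 1 k) == a] is Some k then vec 1 k else 0.
pose phi (a : K) : R := Num.sqrt ((N a)%:R / (s.+1 ^ d)%:R).
have sd0 : 0 < (s.+1 ^ d)%:R :> R by rewrite ltr0n expn_gt0.
have phi2 a : phi a ^+ 2 = (N a)%:R / (s.+1 ^ d)%:R.
  by rewrite sqr_sqrtr// divr_ge0// ltW.
have phi0 a : 0 <= phi a by exact: sqrtr_ge0.
have phiN a : phi a != 0 -> exists k : box, ktr (ko K) (vec 0 k) = a.
  move=> h; apply: N_gt0; rewrite lt0n; apply: contra h => /eqP h.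
  by rewrite /phi h mul0r sqrtr0.
have ApP (k : 'rV[int]_d) : (forall i, - 1 <= k 0 i <= s.+1%:Z) -> Ap (ktr (ko K) k).
  move=> hk; apply/existsP.
  have hh i : (absz (k 0 i + 1)%R < s.+3)%N by have := hk i; lia.
  exists [ffun i => Ordinal (hh i)]; apply/eqP; congr ktr; apply/rowP => i.
  by rewrite !mxE ffunE/=; have := hk i; lia.
have box_le (k : box) i : 0 <= vec 0 k 0 i <= s%:Z.
  by rewrite mxE subr0; have := ltn_ord (k i); lia.
have dl01 i j : 0 <= dl i 0 j <= 1 by rewrite mxE eqxx; case: eqP.
exists b, phi, Ap; split.
- move=> a /existsP[k hk]; rewrite /b; case: pickP => [k' /eqP h|/(_ k)]; last by rewrite hk.
  split=> // i; rewrite mxE; have := ltn_ord (k' i).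
  rewrite natz ler_norml; move: (nat_of_ord (k' i)) => m hm; clear -hm.
  by apply/andP; split; lia.
- by move=> a /phiN[k <-]; apply: ApP => i; have := box_le k i; lia.
- by rewrite (eq_bigr _ (fun a _ => phi2 a)) -mulr_suml -natr_sum sum_N mulfV// lt0r_neq0.
- move=> i; apply: (@le_trans _ _ (\sum_a `|phi a ^+ 2 - phi (ktr a (dl i)) ^+ 2|)).
    apply: ler_sum => a _; rewrite subr_sqr normrM -[leLHS]ger0_norm ?sqr_ge0// normrX expr2.
    rewrite ler_wpM2l// [leRHS]ger0_norm ?addr_ge0//.
    by rewrite ler_norml; have := phi0 a; have := phi0 (ktr a (dl i)); lra.
  rewrite (eq_bigr (fun a => `|(N a)%:R - (N (ktr a (dl i)))%:R| / (s.+1 ^ d)%:R)); last first.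
    by move=> a _; rewrite !phi2 -mulrBl normrM (ger0_norm (x := _^-1))// invr_ge0 ltW.
  rewrite -mulr_suml ler_pdivrMr//; apply: le_trans (sum_N_shift i) _.
  rewrite -(card_face i) natrM [X in eps0 ^+ 2 * X]mulrC mulrA ler_wpM2r//.
- split.
    move=> i a h; have : exists k : 'rV[int]_d, ((forall j, 0 <= k 0 j <= s%:Z) /\ ktr (ko K) k = a) \/
        ((forall j, 0 <= k 0 j <= s%:Z) /\ ktr (ko K) k = ktr a (dl i)).
      case/orP: h => /phiN[k hk]; exists (vec 0 k); [left|right]; split => // j; exact: box_le.
    case=> k [[hk <-]|[hk ha]].
      rewrite -ktrD; split; apply: ApP => j; first by have := hk j; lia.
      rewrite [(k + _) 0 j]mxE; have := hk j; have := dl01 i j.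
      by move: (dl i 0 j) (k 0 j) => x y; lia.
    split; last rewrite -ha.
      have -> : a = ktr (ko K) (k - dl i) by rewrite ktrD ha ktrK.
      by apply: ApP => j; rewrite [(k - _) 0 j]mxE [(- dl i) 0 j]mxE;
        have := hk j; have := dl01 i j; move: (dl i 0 j) (k 0 j) => x y; lia.
    by apply: ApP => j; have := hk j; lia.
  have -> : (s.+3 ^ d = #|{: bigbox}|)%N by rewrite card_ffun !card_ord.
  have := leq_image_card (fun k : bigbox => ktr (ko K) (vec 1 k)) predT.
  move/(leq_trans _); apply; apply: subset_leq_card; apply/fintype.subsetP => a.
  by rewrite unfold_in => /existsP[k /eqP <-]; apply/mapP; exists k; rewrite ?mem_enum.
Qed.

End FolnerFunction.

(** * Construction of monomial representations *)

Section MonomialData.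
Variables (R : realType) (d : nat).
Local Notation fn := ('I_d -> int).

Definition bf (M : 'I_d -> 'I_d -> R) (v w : fn) : R :=
  \sum_i \sum_j M i j * (v i)%:~R * (w j)%:~R.

Lemma bfDl M v v' w : bf M (fun i => v i + v' i) w = bf M v w + bf M v' w.
Proof.
rewrite /bf -big_split; apply: eq_bigr => i _ /=; rewrite -big_split; apply: eq_bigr => j _ /=.
by rewrite intrD mulrDr mulrDl.
Qed.

Lemma bfDr M v w w' : bf M v (fun i => w i + w' i) = bf M v w + bf M v w'.
Proof.
rewrite /bf -big_split; apply: eq_bigr => i _ /=; rewrite -big_split; apply: eq_bigr => j _ /=.
by rewrite intrD mulrDr.
Qed.

Lemma bfDM M M' v w : bf (fun i j => M i j + M' i j) v w = bf M v w + bf M' v w.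
Proof.
rewrite /bf -big_split; apply: eq_bigr => i _ /=; rewrite -big_split; apply: eq_bigr => j _ /=.
by rewrite !mulrDl.
Qed.

Lemma bf_sym M v w : (forall i j, M i j = M j i) -> bf M v w = bf M w v.
Proof.
move=> h; rewrite /bf exchange_big; apply: eq_bigr => i _; apply: eq_bigr => j _ /=.
by rewrite h mulrAC.
Qed.

Variables (Rm : 'M[int]_d) (N : nat) (mm q : 'I_d -> nat).
Hypothesis mmq : forall i, (mm i * q i = N.+1)%N.

Definition co (k : 'rV[int]_d) : fn := fun i => (k *m invmx Rm) 0 i.
Definition coM (c : 'M[int]_d) := (invmx Rm)^T *m c *m invmx Rm.

Lemma coD k l : co (k + l) = (fun i => co k i + co l i).
Proof. by apply/funext => i; rewrite /co mulmxDl mxE. Qed.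

Lemma co0 i : co 0 i = 0.
Proof. by rewrite /co mul0mx mxE. Qed.

Lemma coM_outer k l i j : coM (k^T *m l) i j = co k i * co l j.
Proof.
rewrite /coM mulmxA -mulmxA -trmx_mul mxE big_ord_recl big_ord0 addr0 mxE.
by [].
Qed.

Let A := {ffun 'I_d -> 'I_N.+1}.

(** Translation on [(Z / (N + 1))^d] in the coordinates of the basis [Rm]. The factor [q i] makes
    the stabilizer the lattice where [mm i] divides the i-th coordinate. *)
Definition mtr (a : A) (k : 'rV[int]_d) : A :=
  [ffun i => inord (absz (((a i)%:Z + (q i)%:Z * co k i) %% N.+1%:Z)%Z)].

Lemma mtrE a k i : (mtr a k i)%:Z = (((a i)%:Z + (q i)%:Z * co k i) %% N.+1%:Z)%Z.
Proof.
rewrite ffunE inordK; first by rewrite gez0_abs// modz_ge0.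
by have := modz_ge0 ((a i)%:Z + (q i)%:Z * co k i) (isT : N.+1%:Z != 0);
  have := ltz_pmod ((a i)%:Z + (q i)%:Z * co k i) (isT : 0 < N.+1%:Z); lia.
Qed.

Lemma mtr0 a : mtr a 0 = a.
Proof.
apply/ffunP => i; apply: val_inj; apply: (can_inj absz_nat) => /=; rewrite mtrE co0 mulr0 addr0.
by rewrite modz_nat modn_small.
Qed.

Lemma mtrD a k l : mtr a (k + l) = mtr (mtr a k) l.
Proof.
apply/ffunP => i; apply: val_inj; apply: (can_inj absz_nat) => /=.
by rewrite !mtrE coD modzDml mulrDr addrA.
Qed.

Lemma mmq_gt0 i : (0 < mm i)%N /\ (0 < q i)%N.
Proof. by apply/andP; rewrite -muln_gt0 mmq. Qed.

Let o : A := [ffun=> ord0].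

Lemma mtr_stab k : mtr o k = o <-> forall i, ((mm i)%:Z %| co k i)%Z.
Proof.
have dv i : ((mm i)%:Z %| co k i)%Z = (N.+1%:Z %| (q i)%:Z * co k i)%Z.
  have [_ qi] := mmq_gt0 i.
  rewrite -(mmq i) PoszM. by rewrite [(mm i)%:Z * _]mulrC dvdz_mul2l// lt0r_neq0.
split=> [h i|h].
  by rewrite dv; apply/dvdz_mod0P; have := mtrE o k i; rewrite h ffunE add0r => <-.
apply/ffunP => i; apply: val_inj; apply: (can_inj absz_nat) => /=.
by rewrite mtrE ffunE add0r; have := h i; rewrite dv => /dvdz_mod0P ->.
Qed.

Lemma mtr_stab_all k a : mtr o k = o -> mtr a k = a.
Proof.
move=> /mtr_stab h; apply/ffunP => i; apply: val_inj; apply: (can_inj absz_nat) => /=.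
rewrite mtrE; have /dvdzP[t ->] := h i.
rewrite [_ * (mm i)%:Z]mulrC mulrA [(q i)%:Z * _]mulrC -PoszM mmq mulrC addrC modzMDl.
by rewrite modz_nat modn_small.
Qed.

(** Lifts points to coordinate vectors; by [sec_mtr] it is equivariant up to multiples of [mm i]. *)
Definition sec (a : A) : fn := fun i => ((a i)%:Z %/ (q i)%:Z)%Z.

Lemma sec_mtr a k i : exists t, sec (mtr a k) i = sec a i + co k i + (mm i)%:Z * t.
Proof.
have [_ qi] := mmq_gt0 i.
set x := (a i)%:Z + (q i)%:Z * co k i.
exists (- (x %/ N.+1%:Z)%Z); rewrite /sec mtrE -/x.
have -> : (x %% N.+1%:Z)%Z = (co k i + (mm i)%:Z * - (x %/ N.+1%:Z)%Z) * (q i)%:Z + (a i)%:Z.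
  have e : N.+1%:Z = (mm i)%:Z * (q i)%:Z by rewrite -PoszM mmq.
  have := divz_eq x N.+1%:Z; move: (x %/ _)%Z (x %% _)%Z => u v; rewrite e /x => h.
  have -> : v = (a i)%:Z + (q i)%:Z * co k i - u * ((mm i)%:Z * (q i)%:Z) by rewrite h; ring.
  ring.
by rewrite divzMDl ?lt0r_neq0//; lia.
Qed.

Lemma sec_o i : sec o i = 0.
Proof. by rewrite /sec ffunE div0z. Qed.

Variables (T Sy : 'I_d -> 'I_d -> R) (y : 'I_d -> R).
Hypothesis Tint : forall i j, T i j * (mm i)%:R \is a Num.int /\ T i j * (mm j)%:R \is a Num.int.
Hypothesis Ssym : forall i j, Sy i j = Sy j i.

Lemma ex_intr (x : R) : x \is a Num.int -> ex x = 1.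
Proof. by move/intrP => [n ->]; exact: ex_int. Qed.

(** A character of the centre; the symmetric [Sy] is invisible on commutators, whose phases come
    from [T]. *)
Definition mom (c : 'M[int]_d) : R[i] :=
  ex (\sum_i \sum_j (T i j + Sy i j) * (coM c i j)%:~R).

Definition mphase (a : A) (l : 'rV[int]_d) : R :=
  \sum_i y i * (co l i)%:~R + bf T (sec a) (co l) - 2^-1 * bf Sy (co l) (co l).

Lemma momD c c' : mom (c + c') = mom c * mom c'.
Proof.
rewrite /mom -exD; congr ex; rewrite -big_split; apply: eq_bigr => i _ /=.
rewrite -big_split; apply: eq_bigr => j _ /=.
by rewrite /coM mulmxDr mulmxDl mxE intrD mulrDr.
Qed.

(** The term [- 1/2 Sy (l, l)] has the symmetric cocycle [Sy (k, l)] as coboundary. The term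
    [T (sec a, l)] yields [T (k, l)] up to the failure of [sec] to be equivariant, a multiple of
    [mm], on which [T] is integral. *)
Lemma mphaseD a k l :
  ex (mphase a k) * ex (mphase (mtr a k) l) = ex (mphase a (k + l)) * mom (k^T *m l).
Proof.
rewrite /mom -!exD.
have -> : \sum_i \sum_j (T i j + Sy i j) * (coM (k^T *m l) i j)%:~R =
    bf T (co k) (co l) + bf Sy (co k) (co l).
  rewrite -bfDM; apply: eq_bigr => i _; apply: eq_bigr => j _.
  by rewrite coM_outer intrM mulrA.
pose t := bf T (fun i => sec (mtr a k) i - sec a i - co k i) (co l).
have tE : bf T (sec (mtr a k)) (co l) = bf T (sec a) (co l) + bf T (co k) (co l) + t.
  have {1}-> : sec (mtr a k) = fun i => sec a i + co k i + (sec (mtr a k) i - sec a i - co k i).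
    by apply/funext => i; ring.
  by rewrite (bfDl T (fun i => sec a i + co k i)) (bfDl T (sec a)).
have t1 : ex t = 1.
  apply: ex_intr; apply: rpred_sum => i _; apply: rpred_sum => j _.
  have [w ->] := sec_mtr a k i.
  have -> : sec a i + co k i + (mm i)%:Z * w - sec a i - co k i = (mm i)%:Z * w by ring.
  have -> : T i j * ((mm i)%:Z * w)%:~R * (co l j)%:~R = T i j * (mm i)%:R * (w * co l j)%:~R.
    by rewrite !intrM -pmulrn; ring.
  by rewrite rpredM ?intr_int//; case: (Tint i j).
have -> : mphase a k + mphase (mtr a k) l = mphase a (k + l) +
    (bf T (co k) (co l) + bf Sy (co k) (co l)) + t.
  rewrite /mphase tE coD !bfDl !bfDr (bf_sym (co l) (co k) Ssym).
  have -> : \sum_i y i * (co k i + co l i)%:~R =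
      \sum_i y i * (co k i)%:~R + \sum_i y i * (co l i)%:~R.
    by rewrite -big_split; apply: eq_bigr => i _; rewrite intrD mulrDr.
  by field.
by rewrite exD t1 mulr1.
Qed.

(** On the stabilizer the coordinates of [l] are multiples of [mm], and the integrality of [T] in
    its second index removes the dependence on [a]. *)
Lemma mphase_stab l : mtr o l = o -> forall a, mtr a l = a /\ ex (mphase a l) = ex (mphase o l).
Proof.
move=> h a; split; first exact: mtr_stab_all.
have -> : mphase a l = mphase o l + bf T (sec a) (co l).
  rewrite /mphase; have -> : bf T (sec o) (co l) = 0; last by ring.
  by apply: big1 => i _; apply: big1 => j _; rewrite sec_o mulr0 mul0r.
rewrite exD [ex (bf _ _ _)]ex_intr ?mulr1//; apply: rpred_sum => i _; apply: rpred_sum => j _.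
have /dvdzP[t ->] := (mtr_stab l).1 h j.
have -> : T i j * (sec a i)%:~R * (t * (mm j)%:Z)%:~R = T i j * (mm j)%:R * (sec a i * t)%:~R.
  by rewrite !intrM -pmulrn; ring.
by rewrite rpredM ?intr_int//; case: (Tint i j).
Qed.

Definition monomial_data : kdata R d := @KData R d A mtr o mom
  (fun a l => ex (mphase a l)) mtr0 mtrD momD (fun=> cabs_ex _) (fun _ _ => cabs_ex _)
  mphaseD mphase_stab.

Lemma monomial_data_phase l :
  mphase o l = \sum_i y i * (co l i)%:~R - 2^-1 * bf Sy (co l) (co l).
Proof.
rewrite /mphase; have -> : bf T (sec o) (co l) = 0; last by ring.
by apply: big1 => i _; apply: big1 => j _; rewrite sec_o mulr0 mul0r.
Qed.

End MonomialData.

(** * Words and almost scalar elements *)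

Lemma zmod_scale (V : lmodType int) (C : V -> Prop) : C 0 ->
  (forall k l, C k -> C l -> C (k - l)) -> forall (n : int) k, C k -> C (n *: k).
Proof.
move=> C0 CB.
have CN k : C k -> C (- k) by move=> hk; rewrite -sub0r; exact: CB.
move=> n k hk; have nat_case (j : nat) : C (j%:Z *: k).
  elim: j => [|j IH]; first by rewrite scale0r.
  have -> : j.+1%:Z = j%:Z + 1 by lia.
  by rewrite scalerDl scale1r -[X in _ + X]opprK; apply: CB => //; exact: CN.
case: n => [j|j]; first exact: nat_case.
by rewrite NegzE scaleNr; apply: CN; exact: nat_case.
Qed.

Section NearScalars.
Variables (R : realType) (d : nat) (X : hspace R) (p : hrep d X) (e : X -> X).
Hypothesis he : piece p e.
Implicit Types (g h : heis d) (t : R[i]) (r : R).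

Lemma near_one : near p e hone 1 0.
Proof. by move=> x ex; rewrite (piece_one he ex) scale1r subrr nrm0 mul0r. Qed.

Lemma near_mul g h t t' r r' : cabs t' = 1 -> near p e g t r -> near p e h t' r' ->
  near p e (hmul g h) (t * t') (r + r').
Proof.
move=> t1 hg hh x ex; have sp := piece_subsp he.
have -> : p (hmul g h) x - (t * t') *: x = p g (p h x - t' *: x) + t' *: (p g x - t *: x).
  rewrite hactM (linB _ _ (hact_linear p g)) (linZ _ _ (hact_linear p g)) scalerBr scalerA.
  by rewrite [t' * t]mulrC addrA subrK.
have d1 : e (p h x - t' *: x) = p h x - t' *: x.
  by apply: (subspB sp); [exact: piece_act|exact: (subspZ _ sp ex)].
apply: le_trans (nrm_triangle _ _) _.
rewrite hact_nrm; last exact: (piece_one he d1).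
by rewrite nrmZ t1 mul1r mulrDl addrC lerD// ?hg ?hh.
Qed.

Lemma near_inv g t r : cabs t = 1 -> near p e g t r -> near p e (hinv g) (t^*) r.
Proof.
move=> t1 hg x ex; have sp := piece_subsp he.
have tt : t^* * t = 1 by rewrite mulrC mulJ_cabs t1 expr1n.
have -> : p (hinv g) x - t^* *: x = - (t^* *: p (hinv g) (p g x - t *: x)).
  rewrite (linB _ _ (hact_linear p _)) (linZ _ _ (hact_linear p _)) hactVK; last exact: (piece_one he ex).
  by rewrite scalerBr scalerA tt scale1r opprB.
have d1 : e (p g x - t *: x) = p g x - t *: x.
  by apply: (subspB sp); [exact: piece_act|exact: (subspZ _ sp ex)].
rewrite nrmN nrmZ cabsJ t1 mul1r hact_nrm ?hg//; exact: (piece_one he d1).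
Qed.

Lemma near_weaken g t r r' : r <= r' -> near p e g t r -> near p e g t r'.
Proof. by move=> rr h x ex; apply: le_trans (h x ex) _; rewrite ler_wpM2r ?nrm_ge0. Qed.

Lemma near_scalar g t t' r r' : cabs (t - t') <= r' -> near p e g t r -> near p e g t' (r + r').
Proof.
move=> tt h x ex; have -> : p g x - t' *: x = (p g x - t *: x) + (t - t') *: x.
  by rewrite scalerBl addrA subrK.
apply: le_trans (nrm_triangle _ _) _; rewrite nrmZ mulrDl lerD ?h//.
by rewrite ler_wpM2r ?nrm_ge0.
Qed.

Lemma near_exp n g t r : cabs t = 1 -> near p e g t r ->
  near p e (iter n (hmul g) hone) (t ^+ n) (r *+ n).
Proof.
move=> t1 h; elim: n => [|n IH]; first exact: near_one.
by rewrite exprS mulrS; apply: near_mul => //; rewrite cabsX t1 expr1n.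
Qed.

End NearScalars.

Section Words.
Variables (d : nat) (gens : seq (heis d)).

Definition word z := forall P : heis d -> Prop, P hone ->
  (forall z w, P z -> P w -> P (hmul z w)) -> (forall z, P z -> P (hinv z)) ->
  (forall g, g \in gens -> P g) -> P z.

Lemma word1 : word hone. Proof. by move=> P. Qed.

Lemma wordM z w : word z -> word w -> word (hmul z w).
Proof. by move=> hz hw P h1 hM hV hg; exact: (hM _ _ (hz P h1 hM hV hg) (hw P h1 hM hV hg)). Qed.

Lemma wordV z : word z -> word (hinv z).
Proof. by move=> hz P h1 hM hV hg; exact: (hV _ (hz P h1 hM hV hg)). Qed.

Lemma word_gen g : g \in gens -> word g.
Proof. by move=> gg P h1 hM hV; apply. Qed.

(** [C] depends on the word alone, so that [r] can be chosen after it. [chi] is multiplicative on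
    words only: it will be a character of the stabilizer, not of the whole group. *)
Lemma near_word (R : realType) z : word z -> exists C : nat,
  forall (X : hspace R) (p : hrep d X) e (chi : heis d -> R[i]) r, piece p e -> 0 <= r ->
  (forall z w, word z -> word w -> chi (hmul z w) = chi z * chi w) ->
  (forall z, cabs (chi z) = 1) -> (forall g, g \in gens -> near p e g (chi g) r) ->
  near p e z (chi z) (C%:R * r).
Proof.
move=> wz; suff [] : word z /\ exists C : nat,
  forall (X : hspace R) (p : hrep d X) e (chi : heis d -> R[i]) r, piece p e -> 0 <= r ->
  (forall z w, word z -> word w -> chi (hmul z w) = chi z * chi w) ->
  (forall z, cabs (chi z) = 1) -> (forall g, g \in gens -> near p e g (chi g) r) ->
  near p e z (chi z) (C%:R * r) by [].
have chi1 (chi : heis d -> R[i]) : (forall z w, word z -> word w -> chi (hmul z w) = chi z * chi w) ->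
    (forall z, cabs (chi z) = 1) -> chi hone = 1.
  move=> cM c1; have := cM _ _ word1 word1; rewrite hmul1 -{1}[chi hone]mulr1 => /mulfI -> //.
  by apply/eqP => h; have := c1 hone; rewrite h cabs0 => /esym/eqP; rewrite oner_eq0.
apply: (wz (fun z => word z /\ exists C : nat, _)).
- split; first exact: word1.
  by exists 0%N => X p e chi r he r0 cM c1 hg; rewrite chi1// mul0r; exact: near_one.
- move=> {wz}{}z w [wz [C hz]] [ww [C' hw]]; split; first exact: wordM.
  exists (C + C')%N => X p e chi r he r0 cM c1 hg; rewrite cM// natrD mulrDl.
  by apply: near_mul => //; [exact: hz|exact: hw].
- move=> {wz}{}z [wz [C hz]]; split; first exact: wordV.
  exists C => X p e chi r he r0 cM c1 hg.
  have -> : chi (hinv z) = (chi z)^*.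
    by apply: unit_conj => //; rewrite -cM// ?hmulV ?chi1//; exact: wordV.
  by apply: near_inv => //; exact: hz.
- move=> g gg; split; first exact: word_gen.
  by exists 1%N => X p e chi r he r0 cM c1 hg; rewrite mul1r; exact: hg.
Qed.

End Words.

Section SmithWords.
Variables (d : nat) (Rm : 'M[int]_d) (m : 'I_d -> nat).
Hypothesis Ru : Rm \in unitmx.
Local Notation f i := (row i Rm).

(** By [word_lattice] these generate the preimage in [heis d] of the lattice spanned by the [m i]
    multiples of the basis vectors. *)
Definition smith_gens : seq (heis d) :=
  [seq (0, (f ij.1)^T *m f ij.2) | ij <- enum ({: 'I_d * 'I_d})] ++
  [seq (f i *+ m i, 0) | i <- enum 'I_d].
Local Notation word := (word smith_gens).

Lemma word_sub (c c' : 'M[int]_d) : word (0, c) -> word (0, c') -> word (0, c - c').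
Proof.
move=> h h'; have := wordM h (wordV h').
by rewrite /hmul /hinv /= oppr0 !trmx0 !mul0mx !addr0.
Qed.

Lemma word_center c : word (0, c).
Proof.
have -> : c = \sum_i \sum_j coM Rm c i j *: ((f i)^T *m f j).
  transitivity (Rm^T *m coM Rm c *m Rm).
    by rewrite /coM !mulmxA -trmx_mul mulVmx// trmx1 mul1mx -mulmxA mulVmx// mulmx1.
  rewrite {1}[coM Rm c]matrix_sum_delta mulmx_sumr mulmx_suml; apply: eq_bigr => i _.
  rewrite mulmx_sumr mulmx_suml; apply: eq_bigr => j _.
  rewrite -scalemxAr -scalemxAl; congr (_ *: _).
  have -> : delta_mx i j = delta_mx i (0 : 'I_1) *m delta_mx 0 j :> 'M[int]_d.
    by rewrite mul_delta_mx.
  by rewrite !rowE trmx_mul trmx_delta !mulmxA.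
have wD c1 c2 : word (0, c1) -> word (0, c2) -> word (0, c1 + c2).
  move=> h1 h2; rewrite -[c2]opprK; apply: word_sub => //.
  by rewrite -sub0r; apply: word_sub => //; exact: word1.
have w1 : word (0, 0) by exact: word1.
apply: (big_ind (fun c => word (0, c))) => // i _; apply: (big_ind (fun c => word (0, c))) => //.
move=> j _; apply: (zmod_scale (C := fun c => word (0, c))); [by []|exact: word_sub|].
apply: word_gen.
rewrite mem_cat; apply/orP; left.
by apply/mapP; exists (i, j); rewrite ?mem_enum.
Qed.

Lemma word_pair l c c' : word (l, c) -> word (l, c').
Proof.
move=> h; have := wordM h (word_center (c' - c)).
by rewrite /hmul /= addr0 mulmx0 addr0 addrC subrK.
Qed.

Lemma word_lattice l c : (forall i, ((m i)%:Z %| co Rm l i)%Z) -> word (l, c).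
Proof.
move=> h.
have wD k k' : word (k, 0) -> word (k', 0) -> word (k + k', 0).
  by move=> h1 h2; apply: word_pair; exact: (wordM h1 h2).
have wB k k' : word (k, 0) -> word (k', 0) -> word (k - k', 0).
  move=> h1 h2; apply: wD => //; apply: word_pair; exact: (wordV h2).
apply: (@word_pair _ 0).
have -> : l = \sum_i (co Rm l i %/ (m i)%:Z)%Z *: (f i *+ m i).
  rewrite -{1}[l](mulmxKV Ru) mulmx_sum_row; apply: eq_bigr => i _.
  by rewrite -scaler_nat scalerA natz divzK.
have w1 : word (0, 0) by exact: word1.
apply: (big_rec (fun k => word (k, 0))) => // i k _ hk.
apply: wD => //; apply: (zmod_scale (C := fun k => word (k, 0))) => //.
apply: word_gen; rewrite mem_cat; apply/orP; right.
by apply: map_f; rewrite mem_enum.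
Qed.

End SmithWords.

(** * Lattices and rounding *)

Definition boxseq d (B : nat) : seq 'rV[int]_d :=
  [seq \row_i ((k i)%:Z - B%:Z) | k : {ffun 'I_d -> 'I_(B + B).+1}].

Lemma mem_boxseq d B (k : 'rV[int]_d) : (forall i, `|k 0 i| <= B%:Z) -> k \in boxseq d B.
Proof.
move=> hk; have hh i : (absz (k 0 i + B%:Z)%R < (B + B).+1)%N.
  by have := hk i; rewrite ler_norml; move: (k 0 i) => x; lia.
apply/mapP; exists [ffun i => Ordinal (hh i)]; first by rewrite mem_enum.
apply/rowP => i; rewrite mxE ffunE /=.
by have := hk i; rewrite ler_norml; move: (k 0 i) => x; lia.
Qed.

(** If [M = L D R] is the Smith form of the matrix of [rows], the rows of [R] are a basis in which
    the j-th coordinates of [rows] are divisible by [d_j]; and [D R = L^-1 M] writes [d_j] times the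
    j-th basis vector as a combination of [rows]. *)
Lemma smith_lattice d (C : 'rV[int]_d -> Prop) (rows : seq 'rV[int]_d) :
  C 0 -> (forall k l, C k -> C l -> C (k - l)) -> (forall k, k \in rows -> C k) ->
  exists (Rm : 'M[int]_d) (m : 'I_d -> nat), [/\ Rm \in unitmx,
    forall k, k \in rows -> forall j, ((m j)%:Z %| co Rm k j)%Z &
    forall j, C (row j Rm *+ m j)].
Proof.
move=> C0 CB Crows.
have CN k : C k -> C (- k) by move=> hk; rewrite -sub0r; exact: CB.
have CD k l : C k -> C l -> C (k + l) by move=> hk hl; rewrite -[l]opprK; apply: CB => //; exact: CN.
have Cz := zmod_scale C0 CB.
pose n := size rows; pose M : 'M[int]_(n, d) := \matrix_(i < n) nth 0 rows i.
have CM i : C (row i M) by rewrite rowK; apply: Crows; exact: mem_nth.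
have [L Lu [Rm Ru [dd _ Mdef]]] := int_Smith_normal_form M.
pose Dg : 'M[int]_(n, d) := \matrix_(i, j) (dd`_i *+ (i == j :> nat)).
rewrite -/Dg in Mdef.
(* Basis vectors beyond the number of rows get [m j = 0]. *)
exists Rm, (fun j : 'I_d => if (j < n)%N then absz dd`_j else 0%N); split=> //.
- move=> k /(nthP 0)[i0 hi <-] j; pose i := Ordinal hi.
  have -> : nth 0 rows i0 = row i M by rewrite rowK.
  have -> : co Rm (row i M) j = \sum_a L i a * Dg a j.
    by rewrite /co Mdef -row_mul mulmxK// 2!mxE.
  case: ltnP => jn.
    have -> : \sum_a L i a * Dg a j = L i (Ordinal jn) * dd`_j.
      rewrite (bigD1 (Ordinal jn))//= mxE eqxx mulr1n big1 ?addr0// => a.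
      by rewrite -val_eqE /= mxE => /negPf ->; rewrite mulr0n mulr0.
    by apply: dvdz_mull; rewrite dvdzE dvdnn.
  rewrite big1 ?dvdz0// => a _; rewrite mxE.
  by have -> : (a == j :> nat) = false; [apply/eqP; have := ltn_ord a; lia|rewrite mulr0n mulr0].
- move=> j; case: ltnP => jn; last by rewrite mulr0n.
  pose i := Ordinal jn.
  have hC : C (dd`_j *: row j Rm).
    have -> : dd`_j *: row j Rm = row i (Dg *m Rm).
      rewrite row_mul; apply/rowP => b; rewrite !mxE (bigD1 j)//= !mxE eqxx mulr1n big1 ?addr0// => a.
      by rewrite -val_eqE /= !mxE eq_sym => /negPf ->; rewrite mulr0n mul0r.
    have -> : Dg *m Rm = invmx L *m M by rewrite Mdef -mulmxA mulKmx.
    rewrite row_mul mulmx_sum_row; apply: (big_ind C) => // a _; exact: Cz.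
  have -> : row j Rm *+ `|dd`_j| = Num.sg dd`_j *: (dd`_j *: row j Rm).
    by rewrite scalerA -normrEsg -abszE -scaler_nat natz.
  exact: Cz.
Qed.

Section Rounding.
Variable R : realType.

Lemma ex_dist (s t : R) : cabs (ex s - ex t) = cabs (ex (s - t) - 1).
Proof.
have -> : ex s - ex t = ex t * (ex (s - t) - 1).
  by rewrite mulrBr mulr1 -exD [t + _]addrC subrK.
by rewrite cabsM cabs_ex mul1r.
Qed.

(** A zero invariant factor means infinite order; the large number [n] replaces it to keep the orbit
    finite. *)
Definition modulus (n k : nat) : nat := if k == 0%N then n else k.

(* An approximate phase becomes rational with denominator dividing the moduli. *)
Lemma round_phase (del eta rr x : R) (k l n : nat) :
  (forall t, `|t| <= eta -> cabs (ex t - 1) <= rr) ->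
  (forall t, cabs (ex t - 1) <= del -> exists j : int, `|t - j%:~R| <= eta) ->
  (0 < n)%N -> (k %| n \/ k = 0)%N -> (l %| n \/ l = 0)%N -> 1 <= eta * n%:R ->
  (gcdn k l != 0%N -> cabs (ex ((gcdn k l)%:R * x) - 1) <= del) ->
  exists t : R, [/\ t * (modulus n k)%:R \is a Num.int, t * (modulus n l)%:R \is a Num.int &
    cabs (ex t - ex x) <= rr].
Proof.
move=> hc hn n0 kn ln en hg.
have int_div (a b : nat) (j : int) : (0 < b)%N -> (b %| a)%N -> j%:~R / b%:R * a%:R \is a (@Num.int R).
  move=> b0 /dvdnP[c ->]; rewrite natrM mulrCA mulfVK; last by rewrite pnatr_eq0 -lt0n.
  by rewrite rpredM ?intr_int// -[c%:R]/(c%:Z%:~R) intr_int.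
have [g0|g0] := eqVneq (gcdn k l) 0%N; last first.
  have {}g0' : (0 < gcdn k l)%N by rewrite lt0n.
  have [j hj] := hn _ (hg g0); exists (j%:~R / (gcdn k l)%:R).
  have dv (a : nat) : (a %| n \/ a = 0)%N -> (gcdn k l %| a)%N -> (gcdn k l %| modulus n a)%N \/
      a = 0%N by rewrite /modulus; case: eqP => [->|]; [right|left].
  have gn : (gcdn k l %| n)%N.
    case: kn => [kn|k0]; first exact: dvdn_trans (dvdn_gcdl _ _) kn.
    case: ln => [ln|l0]; first exact: dvdn_trans (dvdn_gcdr _ _) ln.
    by move: g0; rewrite k0 l0.
  split.
  - apply: int_div => //; rewrite /modulus; case: eqP => // _; exact: dvdn_gcdl.
  - apply: int_div => //; rewrite /modulus; case: eqP => // _; exact: dvdn_gcdr.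
  rewrite ex_dist; apply: hc; have gp : 1 <= (gcdn k l)%:R :> R by rewrite ler1n.
  have -> : j%:~R / (gcdn k l)%:R - x = - (((gcdn k l)%:R * x - j%:~R) / (gcdn k l)%:R).
    by field; rewrite pnatr_eq0.
  rewrite normrN normrM [X in _ * X]ger0_norm ?invr_ge0// ler_pdivrMr; last by lra.
  have e0 : 0 <= eta by exact: le_trans (normr_ge0 _) hj.
  by apply: le_trans hj _; nra.
have kl0 : (k = 0 /\ l = 0)%N.
  by case: (posnP k) (posnP l) g0 => [->|k0] [->|l0] //; move/eqP; rewrite -leqn0 leqNgt gcdn_gt0 ?k0 ?l0 ?orbT.
have [k0 l0] := kl0.
have np : 0 < n%:R :> R by rewrite ltr0n.
exists ((Num.floor (n%:R * x))%:~R / n%:R); rewrite k0 l0 /modulus /=.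
split; [exact: int_div|exact: int_div|].
rewrite ex_dist; apply: hc.
have -> : (Num.floor (n%:R * x))%:~R / n%:R - x = - ((n%:R * x - (Num.floor (n%:R * x))%:~R) / n%:R).
  by field; rewrite pnatr_eq0 -lt0n.
have /andP[f1 f2] := floor_itv (n%:R * x).
rewrite normrN normrM [X in _ * X]ger0_norm ?invr_ge0// ler_pdivrMr// ger0_norm ?subr_ge0//.
by apply: le_trans en; rewrite intrD in f2; lra.
Qed.

End Rounding.

(** * Pieces *)

Section PieceTools.
Variables (R : realType) (d : nat) (X : hspace R) (p : hrep d X).
Implicit Types (e : X -> X).

(** The range of [e] is then the span of the vectors [e f], of finite dimension and exactly
    invariant. *)
Lemma finite_piece us ep e (F : seq X) : 0 <= ep -> piece p e ->
  ~ (exists x, [/\ e x = x, nsq x = 1 & forall f, f \in F -> ip x f = 0]) -> qd p us ep e.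
Proof.
move=> ep0 he hF; have sp := piece_subsp he; have [es ei ec eu] := he.
have [l [lo l1 l2]] := gram_schmidt (@definite _ X) [seq e f | f <- F].
have fl y : y \in [seq e f | f <- F] -> e y = y by move=> /mapP[f _ ->].
have ll y : span l y -> e y = y by move=> /l1; exact: span_piece.
have full x : e x = x -> span l x.
  move=> ex; set y := x - proj l x.
  have ey : e y = y by apply: (subspB sp) => //; apply: ll; exact: proj_span.
  have y0 : nsq y = 0.
    apply/eqP; apply: contra_notT hF => y0.
    have n0 : nrm y != 0 by apply: contra y0 => /eqP h; rewrite -nrm2 h expr0n.
    exists ((nrm y)^-1%:C *: y); split.
    - exact: (subspZ _ sp ey).
    - by rewrite nsqZ cabs_real -nrm2 ger0_norm ?invr_ge0 ?nrm_ge0// exprVn mulVf// expf_neq0.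
    - move=> f fF; rewrite ipZl -ey es proj_orth ?mulr0//.
      by apply: l2; apply: span_mem; exact: map_f.
  have -> : x = proj l x by apply/eqP; rewrite -subr_eq0; apply/eqP; exact: definite y0.
  exact: proj_span.
move=> xs eta hx eta0; exists l; split.
- by move=> y yl; apply: ll; exact: span_mem.
- move=> g gu y yl; exists (p g y); first by apply: full; apply: piece_act => //; exact: ll.
  by rewrite subrr nrm0 mulr_ge0 ?nrm_ge0.
- by move=> x xx; exists x; [exact: full (hx _ xx)|rewrite subrr nrm0 ltW].
Qed.

Lemma cut_centrals (good : (X -> X) -> Prop) (gens : seq (heis d)) (r : R) e :
  (forall e e1 e2, subpiece p e1 e -> subpiece p e2 e ->
    (forall x, e x = e1 x + e2 x) -> (forall x, e1 (e2 x) = 0) -> good e1 -> good e2 -> good e) ->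
  0 < r -> piece p e -> (forall g, g \in gens -> central_on p e g) ->
  (forall e', subpiece p e' e -> (forall g, g \in gens -> exists t, near p e' g (ex t) r) -> good e') ->
  good e.
Proof.
move=> good_add r0; elim: gens e => [|g gens IH] e he hc hg.
  by apply: hg => //; exact: subpiece_refl.
apply: (cut_central good_add r0 he (hc _ (mem_head _ _))) => e' s [t ht].
have [he' _] := s; apply: IH => //.
  by move=> h hh; apply: (central_sub s); apply: hc; rewrite inE hh orbT.
move=> e'' s' hn; apply: hg; first exact: subpiece_trans s' s.
move=> h; rewrite inE => /orP[/eqP ->|/hn//].
by exists t; exact: near_sub s' ht.
Qed.

Lemma center_central e c : central_on p e (0, c).
Proof.
move=> h x ex; rewrite -!hactM; congr (p _ x).
by rewrite /hmul /= trmx0 mul0mx mulmx0 !addr0 add0r [c + _]addrC.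
Qed.

Definition trivial_on e c := forall x, e x = x -> p (0, c) x = x.

Section Trivial.
Variable e : X -> X.
Hypothesis he : piece p e.

Lemma trivial0 : trivial_on e 0.
Proof. by move=> x ex; exact: (piece_one he ex). Qed.

Lemma trivialB c c' : trivial_on e c -> trivial_on e c' -> trivial_on e (c - c').
Proof.
move=> h h' x ex.
have -> : (0, c - c') = hmul (0, c) (hinv (0, c')) :> heis d.
  by rewrite /hmul /hinv /= oppr0 !trmx0 !mul0mx !addr0.
by rewrite hactM -{1}(h' x ex) hactVK ?h//; exact: (piece_one he ex).
Qed.

Lemma trivialZ (n : int) c : trivial_on e c -> trivial_on e (n *: c).
Proof. by apply: zmod_scale; [exact: trivial0|exact: trivialB]. Qed.

Lemma trivial_sum (I : Type) (l : seq I) (F : I -> 'M[int]_d) :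
  (forall i, trivial_on e (F i)) -> trivial_on e (\sum_(i <- l) F i).
Proof.
move=> h; apply: (big_ind (trivial_on e)) => //; first exact: trivial0.
move=> c c' hc hc'; rewrite -[c']opprK; apply: trivialB => //.
by rewrite -sub0r; apply: trivialB => //; exact: trivial0.
Qed.

(** The commutator is bilinear: this matrix is the combination of the [cm k j] with the entries of
    [l] as coefficients. *)
Lemma trivial_comm k l : (forall j, trivial_on e (cm k j)) ->
  trivial_on e (k^T *m l - l^T *m k).
Proof.
move=> h; have -> : k^T *m l - l^T *m k = \sum_j l 0 j *: cm k j.
  rewrite {1 2}[l]row_sum_delta mulmx_sumr linear_sum mulmx_suml -sumrB; apply: eq_bigr => j _.
  by rewrite /cm scalerBr -scalemxAr linearZ /= -scalemxAl.
by apply: trivial_sum => j; exact: trivialZ.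
Qed.

Lemma cmB (k l : 'rV[int]_d) j : cm (k - l) j = cm k j - cm l j.
Proof.
by rewrite /cm trmx_add trmx_opp mulmxDl mulNmx mulmxBr !opprB addrACA [RHS]addrACA [- _ + _]addrC.
Qed.

Lemma trivial_central k c : (forall j, trivial_on e (cm k j)) -> central_on p e (k, c).
Proof.
move=> h [l b] x ex; rewrite -!hactM.
have -> : hmul (k, c) (l, b) = hmul (hmul (l, b) (k, c)) (0, k^T *m l - l^T *m k).
  rewrite /hmul /= addr0 mulmx0 addr0; congr (_, _); first exact: addrC.
  by rewrite [b + c]addrC -[RHS]addrA [l^T *m k + _]addrC subrK.
by rewrite hactM trivial_comm.
Qed.

End Trivial.

(** The two outcomes of [kern_cut]. *)
Definition dich e c := trivial_on e c \/
  exists2 del : R, 0 < del & forall x, e x = x -> del * nrm x <= nrm (p (0, c) x - x).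

Lemma dich_cut us ep (cs : seq 'M[int]_d) e : 0 <= ep -> piece p e ->
  (forall e', subpiece p e' e -> (forall c, c \in cs -> dich e' c) -> qd p us ep e') ->
  qd p us ep e.
Proof.
move=> ep0; elim: cs e => [|c cs IH] e he h; first by apply: h => //; exact: subpiece_refl.
apply: qd_approx => xs eta hx eta0.
have [e0 [e1 [del [[d0 s0 s1 o] [h0 h1 h2]]]]] := kern_cut he (@center_central e c) hx eta0.
have [sf sf0 sf1] := piece_sum he s0 s1 o.
exists (fun x => e0 x + e1 x); split => //.
have [p0 _] := s0; have [p1 _] := s1.
apply: (qd_add ep0 sf0 sf1) => //.
  apply: IH => // e' s' hd; apply: h; first exact: subpiece_trans s' s0.
  move=> c'; rewrite inE => /orP[/eqP ->|/hd//]; left => x ex; apply: h0; exact: subpieceP s' ex.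
apply: IH => // e' s' hd; apply: h; first exact: subpiece_trans s' s1.
move=> c'; rewrite inE => /orP[/eqP ->|/hd//]; right; exists del => // x ex.
by apply: h1; exact: subpieceP s' ex.
Qed.

End PieceTools.

(** * Matching near scalars by an exact character *)

Section CharacterData.
Variables (R : realType) (d : nat) (X : hspace R) (p : hrep d X) (e : X -> X).
Hypothesis he : piece p e.
Variables (Rm : 'M[int]_d) (m : 'I_d -> nat) (N : nat).
Hypothesis Ru : Rm \in unitmx.
Local Notation f i := (row i Rm).
Hypothesis mN : forall i, (m i %| N.+1 \/ m i = 0)%N.
Hypothesis mcentral : forall i j, trivial_on p e (cm (f i *+ m i) j).
Variables (r0 r1 del eta : R).
Hypothesis r00 : 0 <= r0.
Hypothesis r01 : r0 <= r1 / 2.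
Hypothesis r0del : forall i j, (gcdn (m i) (m j))%:R * (r0 + r0) <= del.
Hypothesis etaN : 1 <= eta * N.+1%:R.
Hypothesis hcont : forall t : R, `|t| <= eta -> cabs (ex t - 1) <= r1 / 2.
Hypothesis hint : forall t, cabs (ex t - 1) <= del -> exists j : int, `|t - j%:~R| <= eta.
Hypothesis hgens : forall g, g \in smith_gens Rm m -> exists t, near p e g (ex t) r0.
Hypothesis e_neq0 : exists2 x, e x = x & nsq x = 1.

Lemma co_row i k a : co Rm (f i *+ k) a = (k * (i == a))%N%:Z.
Proof.
rewrite /co -scaler_nat -scalemxAl -row_mul mulmxV// !mxE natz.
by case: (i == a); rewrite ?mulr1 ?mulr0 ?muln1 ?muln0.
Qed.

Lemma sum_delta (M : 'I_d -> 'I_d -> R) i j (k l : nat) :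
  \sum_a \sum_b M a b * ((k * (i == a))%N%:Z)%:~R * ((l * (j == b))%N%:Z)%:~R =
  M i j * k%:R * l%:R.
Proof.
rewrite (bigD1 i)//= [X in _ + X]big1 => [|a /negPf h]; last first.
  by apply: big1 => b _; rewrite eq_sym h muln0 mulr0 mul0r.
rewrite addr0 (bigD1 j)//= big1 => [|b /negPf h]; last by rewrite eq_sym h muln0 mulr0.
by rewrite addr0 !eqxx !muln1.
Qed.

(** [x.1 - x.2] is nearly the phase of the commutator of [f i] and [f j]. Its powers [m i] and [m j]
    act trivially, hence by Bezout so does its power [gcdn (m i) (m j)]; a unit vector in the piece
    turns this into an estimate of phases. *)
Lemma comm_phase i j : exists2 x : R * R,
  near p e (0, (f i)^T *m f j) (ex x.1) r0 /\ near p e (0, (f j)^T *m f i) (ex x.2) r0 &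
  (gcdn (m i) (m j) != 0)%N -> cabs (ex ((gcdn (m i) (m j))%:R * (x.1 - x.2)) - 1) <= del.
Proof.
have gen a b : (0, (f a)^T *m f b) \in smith_gens Rm m.
  by rewrite mem_cat; apply/orP; left; apply/mapP; exists (a, b); rewrite ?mem_enum.
have [s hs] := hgens (gen i j); have [t ht] := hgens (gen j i).
exists (s, t) => //= _; set g := gcdn _ _.
pose W := (f i)^T *m f j - (f j)^T *m f i.
have nW : near p e (0, W) (ex (s - t)) (r0 + r0).
  rewrite exD exN; have -> : (0, W) = hmul (0, (f i)^T *m f j) (hinv (0, (f j)^T *m f i)) :> heis d.
    by rewrite /hmul /hinv /= oppr0 !trmx0 !mul0mx !addr0.
  by apply: near_mul => //; [rewrite cabsJ cabs_ex|apply: near_inv => //; exact: cabs_ex].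
have tW : trivial_on p e (g%:Z *: W).
  have t1 : trivial_on p e ((m i)%:Z *: W).
    have := trivial_comm he (f j) (mcentral i).
    rewrite -scaler_nat natz linearZ /= -scalemxAl -scalemxAr -scalerBr; exact.
  have t2 : trivial_on p e ((m j)%:Z *: W).
    have := trivial_comm he (f i) (mcentral j).
    rewrite -scaler_nat natz linearZ /= -scalemxAl -scalemxAr -scalerBr => h.
    by have := trivialB he (trivial0 he) h; rewrite sub0r -scalerN opprB.
  have [u [v uv]] := Bezoutz (m i)%:Z (m j)%:Z.
  have -> : g%:Z = u * (m i)%:Z - - v * (m j)%:Z by rewrite mulNr opprK uv.
  by rewrite scalerBl -!scalerA; apply: (trivialB he) => //; exact: (trivialZ he).
have [x ex1 x1] := e_neq0.
have itE n : iter n (hmul (0, W)) hone = (0, W *+ n).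
  by elim: n => [|n IH] //=; rewrite IH /hmul /= trmx0 mul0mx !addr0 -mulrS.
have := near_exp he g (cabs_ex _) nW ex1.
rewrite itE -exMn; have -> : W *+ g = g%:Z *: W by rewrite -scaler_nat natz.
rewrite tW// -{1}[x]scale1r -scalerBl nrmZ.
have -> : nrm x = 1 by rewrite /nrm x1 sqrtr1.
rewrite !mulr1 => h.
by rewrite -cabsN opprB; apply: le_trans h _; rewrite -mulr_natl; exact: r0del.
Qed.

(** The commutator phases are rounded so that the moduli kill them, which makes the induced
    representation finite-dimensional; the remaining phases are kept and fitted by [Sy] and [y]. *)
Lemma character_data : exists K : kdata R d,
  (forall l, ktr (ko K) l = ko K <-> forall i, ((modulus N.+1 (m i))%:Z %| co Rm l i)%Z) /\
  (forall g, g \in smith_gens Rm m -> near p e g (kom K g.2 * kap (ko K) g.1) r1).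
Proof.
have hr1 : r0 + r1 / 2 <= r1 by have := r01; lra.
have r0r1 : r0 <= r1 by have := r01; have := r00; lra.
have : forall ij : 'I_d * 'I_d, exists x : R,
    near p e (0, (f ij.1)^T *m f ij.2) (ex x) r0.
  by move=> [i j]; have [[s t] [/= h _] _] := comm_phase i j; exists s.
case/choice => xx0 hxx0.
have : forall ij : 'I_d * 'I_d, exists xT : R * R * R, [/\
    near p e (0, (f ij.1)^T *m f ij.2) (ex xT.1.1) r0,
    near p e (0, (f ij.2)^T *m f ij.1) (ex xT.1.2) r0,
    xT.2 * (modulus N.+1 (m ij.1))%:R \is a Num.int,
    xT.2 * (modulus N.+1 (m ij.2))%:R \is a Num.int &
    cabs (ex xT.2 - ex (xT.1.1 - xT.1.2)) <= r1 / 2].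
  move=> [i j]; have [x [h1 h2] h3] := comm_phase i j.
  have [T [T1 T2 T3]] := round_phase hcont hint (ltn0Sn N) (mN i) (mN j) etaN h3.
  by exists (x, T).
case/choice => xT hxT.
(* [T] is strictly lower triangular and carries the rounded commutator phases; [Sy] keeps the phases
   on and above the diagonal, so [T + Sy] is near all of them. *)
pose xd (i j : 'I_d) : R := if (i < j)%N then (xT (j, i)).1.2 else if (j < i)%N then (xT (i, j)).1.1 else xx0 (i, j).
pose T (i j : 'I_d) : R := if (j < i)%N then (xT (i, j)).2 else 0.
pose Sy (i j : 'I_d) : R := if (i < j)%N then xd i j else xd j i.
have Ssym i j : Sy i j = Sy j i.
  by rewrite /Sy; case: ltngtP => // /val_inj ->.
pose mm i := modulus N.+1 (m i).
have mmN i : (mm i %| N.+1)%N.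
  by rewrite /mm /modulus; case: eqP => // h; case: (mN i).
pose q i := (N.+1 %/ mm i)%N.
have mmq i : (mm i * q i)%N = N.+1 by rewrite mulnC divnK.
have Tint i j : T i j * (mm i)%:R \is a Num.int /\ T i j * (mm j)%:R \is a Num.int.
  rewrite /T; case: ifP => _; last by rewrite !mul0r rpred0.
  by have [_ _ ? ? _] := hxT (i, j).
have hX i j : near p e (0, (f i)^T *m f j) (ex (T i j + Sy i j)) r1.
  rewrite /T /Sy /xd; case: (ltngtP i j) => [ij|ji|/val_inj ->].
  - rewrite add0r; have [_ h _ _ _] := hxT (j, i); exact: near_weaken h.
  - have [h1 h2 _ _ h3] := hxT (i, j).
    apply: near_weaken hr1 _; apply: near_scalar h1.
    move: h3 => /=; case: (xT (i, j)) => -[x x'] t /=; rewrite ex_dist -[X in _ -> X <= _]cabsN opprB.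
    by rewrite [- (ex _ - _)]opprB ex_dist -addrA.
  - by rewrite add0r; have h := hxx0 (j, j); exact: near_weaken h.
have : forall i, exists x, near p e (f i *+ m i, 0) (ex x) r0.
  move=> i; apply: hgens; rewrite mem_cat; apply/orP; right.
  by apply: map_f; rewrite mem_enum.
case/choice => x1 hx1.
(* For [m i != 0] this solves [y i * m i - Sy i i * m i ^ 2 / 2 = x1 i], which gives the generator
   [(f i *+ m i, 0)] exactly the phase [x1 i]; for [m i = 0] that generator is [hone]. *)
pose y i := (x1 i + 2^-1 * (Sy i i * (m i)%:R * (m i)%:R)) / (m i)%:R.
exists (monomial_data Rm mmq y Tint Ssym); split=> [l|g]; first exact: mtr_stab.
rewrite mem_cat => /orP[/mapP[[i j] _ ->]|/mapP[i _ ->]] /=.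
  have -> : mphase Rm q T Sy y [ffun=> @ord0 N] 0 = 0.
    rewrite monomial_data_phase big1 ?sub0r => [|a _]; last by rewrite co0 mulr0.
    by rewrite /bf big1 ?mulr0 ?oppr0// => a _; apply: big1 => b _; rewrite co0 mulr0 mul0r.
  rewrite ex0 mulr1 /mom.
  suff -> : \sum_a \sum_b (T a b + Sy a b) * (coM Rm ((f i)^T *m f j) a b)%:~R = T i j + Sy i j by [].
  transitivity (\sum_a \sum_b (T a b + Sy a b) * ((1 * (i == a))%N%:Z)%:~R * ((1 * (j == b))%N%:Z)%:~R).
    apply: eq_bigr => a _; apply: eq_bigr => b _.
    by rewrite coM_outer -(co_row i 1) -(co_row j 1) !mulr1n intrM mulrA.
  by rewrite sum_delta !mulr1.
have -> : mom Rm T Sy 0 = 1.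
  rewrite /mom -ex0; congr ex; apply: big1 => a _; apply: big1 => b _.
  by rewrite /coM mulmx0 mul0mx mxE mulr0.
rewrite mul1r monomial_data_phase.
have coE : co Rm (f i *+ m i) = fun a => (m i * (i == a))%N%:Z.
  by apply/funext => a; exact: co_row.
have -> : bf Sy (co Rm (f i *+ m i)) (co Rm (f i *+ m i)) = Sy i i * (m i)%:R * (m i)%:R.
  by rewrite coE -sum_delta.
have -> : \sum_a y a * (co Rm (f i *+ m i) a)%:~R = y i * (m i)%:R.
  rewrite (bigD1 i)//= big1 ?addr0 => [|a /negPf h]; rewrite co_row ?eqxx ?muln1//.
  by rewrite eq_sym h muln0 mulr0.
have [m0|m0] := eqVneq (m i) 0%N.
  rewrite m0 !mulr0 subrr ex0 mulr0n; have := near_one he; apply: near_weaken.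
  by have := r01; have := r00; lra.
have -> : y i * (m i)%:R - 2^-1 * (Sy i i * (m i)%:R * (m i)%:R) = x1 i.
  by rewrite /y divfK ?pnatr_eq0// addrK.
by apply: near_weaken (hx1 i); have := r01; have := r00; lra.
Qed.

End CharacterData.

Lemma near_words (R : realType) d (gens zs : seq (heis d)) : exists C : nat,
  forall z, z \in zs -> word gens z ->
  forall (X : hspace R) (p : hrep d X) e (chi : heis d -> R[i]) r, piece p e -> 0 <= r ->
  (forall z w, word gens z -> word gens w -> chi (hmul z w) = chi z * chi w) ->
  (forall z, cabs (chi z) = 1) -> (forall g, g \in gens -> near p e g (chi g) r) ->
  near p e z (chi z) (C%:R * r).
Proof.
elim: zs => [|z zs [C hC]]; first by exists 0%N.
have [wz|nwz] := pselect (word gens z); last first.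
  by exists C => w; rewrite inE => /orP[/eqP -> //|]; exact: hC.
have [C' hC'] := near_word R wz; exists (C + C')%N => w + ww X p e chi r he r0 cM c1 hg.
rewrite inE natrD mulrDl => /orP[/eqP ->|wzs].
  by apply: near_weaken (hC' X p e chi r he r0 cM c1 hg); rewrite lerDr mulr_ge0.
by apply: near_weaken (hC w wzs ww X p e chi r he r0 cM c1 hg); rewrite lerDl mulr_ge0.
Qed.

Definition usteps d : seq (heis d) :=
  [seq (delta_mx 0 i, 0) | i <- enum 'I_d] ++ [seq hinv (delta_mx 0 i, 0) | i <- enum 'I_d].

Lemma box_step (x y : int) (t : bool) (s : nat) : `|x| <= s.+1%:Z -> `|y| <= s.+1%:Z ->
  `|- y + (t%:R + x)| <= (s.+1 + s.+1).+1%:Z.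
Proof. by rewrite !ler_norml; case: t => /=; lia. Qed.

(** * Quasidiagonality of a piece after the dichotomy *)

Section RegularPiece.
Variables (R : realType) (d : nat) (X : hspace R) (p : hrep d X).
Variables (ep eps0 r : R) (s : nat).
Hypothesis eps00 : 0 < eps0.
Hypothesis r_gt0 : 0 < r.
Hypothesis hs : 2 <= eps0 ^+ 2 * s.+1%:R.
Hypothesis hep : 20 * (2 * eps0 + 4 * (s.+3 ^ d)%:R * r) <= ep.
(** Bounds the entries of a difference of two coset representatives plus a generator. *)
Let B := (s.+1 + s.+1).+1.

(** [Ce] is the lattice of the vectors that are central on [e]. Its part generated in the box has an
    adapted basis, whose [smith_gens] are central, may be cut to near scalars, and are matched by a
    monomial representation [K]. Coset representatives of different points differ by a vector
    outside [Ce], to which the dichotomy gives drift; so diffuse vectors exist and [absorb] applies.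
    Pieces of finite dimension are settled by [finite_piece]. *)
Lemma regular_piece e : piece p e -> (forall k, k \in boxseq d B -> forall j, dich p e (cm k j)) ->
  qd p (usteps d) ep e.
Proof.
move=> he hd.
have ep0 : 0 <= ep.
  by apply: le_trans hep; rewrite mulr_ge0// addr_ge0// ?mulr_ge0// ltW.
pose Ce k := forall j, trivial_on p e (cm k j).
have Ce0 : Ce 0 by move=> j; rewrite /cm trmx0 mul0mx mulmx0 subrr; exact: (trivial0 he).
have CeB k l : Ce k -> Ce l -> Ce (k - l).
  by move=> hk hl j; rewrite cmB; exact: (trivialB he).
pose rows := [seq k <- boxseq d B | `[< Ce k >]].
have rowsC k : k \in rows -> Ce k by rewrite mem_filter => /andP[/asboolP].
have [Rm [m [Ru rows_m Cm]]] := smith_lattice Ce0 CeB rowsC.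
pose gens := smith_gens Rm m.
(* This list contains every stabilizer element [z i a] met by [absorb]; it fixes the word constant
   [C] before the tolerance [r1] is chosen. *)
pose zs : seq (heis d) := [seq hmul (hinv (k', 0)) (hmul (delta_mx 0 ik.1, 0) (ik.2, 0)) |
  ik <- [seq (i, k) | i <- enum 'I_d, k <- boxseq d s.+1], k' <- boxseq d s.+1].
have [C hC] := near_words R gens zs.
pose r1 := r / C.+1%:R.
have r1_gt0 : 0 < r1 by rewrite divr_gt0.
have Cr1 : C%:R * r1 <= r.
  rewrite /r1 mulrA ler_pdivrMr// mulrC ler_wpM2l ?ltW// ltr_nat; exact: ltnSn.
have [|eta eta0 hcont] := @ex_cont R (r1 / 2); first by rewrite divr_gt0.
have [del del0 hint] := ex_near_int eta0.
pose G := (\sum_i m i + \sum_i m i)%N.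
have mG i j : (gcdn (m i) (m j) <= G)%N.
  have le1 i' : (m i' <= \sum_i m i)%N by rewrite (bigD1 i')//= leq_addr.
  apply: leq_trans (leq_add (le1 i) (le1 j)).
  have [->|i0] := posnP (m i); first by rewrite gcd0n leq_addl.
  exact: leq_trans (dvdn_leq i0 (dvdn_gcdl _ _)) (leq_addr _ _).
pose r0 := Num.min (r1 / 2) (del / (2 * G.+1%:R)).
have r0_gt0 : 0 < r0 by rewrite lt_min !divr_gt0// mulr_gt0.
have r01 : r0 <= r1 / 2 by rewrite ge_min lexx.
have r0del i j : (gcdn (m i) (m j))%:R * (r0 + r0) <= del.
  have h : r0 <= del / (2 * G.+1%:R) by rewrite ge_min lexx orbT.
  have hG : (gcdn (m i) (m j))%:R <= G.+1%:R :> R by rewrite ler_nat ltnW// ltnS.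
  apply: le_trans (ler_wpM2r _ hG) _; first by rewrite addr_ge0 ?ltW.
  move: h; rewrite ler_pdivlMr ?mulr_gt0//; move: (G.+1%:R : R) => g; lra.
pose P0 := (\prod_i maxn (m i) 1)%N.
have P0_gt0 : (0 < P0)%N by apply: prodn_gt0 => i; rewrite leq_max orbT.
pose c1 := (\sum_(k <- boxseq d B) \sum_j absz (co Rm k j))%N.
pose c2 := (Num.truncn (eta^-1)).+1.
(* [N + 1] is divisible by every nonzero [m i], exceeds all coordinates of vectors in the box, and
   is at least [1 / eta]. *)
pose N := (P0 * (c1 + c2)).-1.
have NE : N.+1 = (P0 * (c1 + c2))%N by rewrite prednK// muln_gt0 P0_gt0 addn_gt0 orbT.
have leN : (c1 + c2 <= N.+1)%N by rewrite NE leq_pmull.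
have mN i : (m i %| N.+1 \/ m i = 0)%N.
  have [->|mi] := posnP (m i); [by right|left].
  rewrite NE dvdn_mulr// /P0 (bigD1 i)//= dvdn_mulr//.
  by have -> : maxn (m i) 1 = m i by apply/maxn_idPl.
have small k j : k \in boxseq d B -> (absz (co Rm k j) < N.+1)%N.
  move=> kB; apply: leq_trans leN; rewrite addnS ltnS; apply: leq_trans (leq_addr _ _).
  rewrite /c1 (big_rem k)//=; apply: leq_trans (leq_addr _ _).
  by rewrite (bigD1 j)//= leq_addr.
have etaN : 1 <= eta * N.+1%:R.
  have h1 : eta^-1 < c2%:R by rewrite truncnS_gt.
  have h2 : c2%:R <= N.+1%:R :> R by rewrite ler_nat; apply: leq_trans leN; exact: leq_addl.
  by rewrite -ler_pdivrMl// mulr1 ltW// (lt_le_trans h1).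
have gens_central g : g \in gens -> central_on p e g.
  rewrite mem_cat => /orP[/mapP[[i j] _ ->]|/mapP[i _ ->]]; first exact: center_central.
  exact: (trivial_central he _ (Cm i)).
have good_add := fun e e1 e2 => @qd_add R d X p (usteps d) ep e e1 e2 ep0.
apply: (cut_centrals good_add r0_gt0 he gens_central) => e' s' hn.
have [he' _] := s'; have sp' := piece_subsp he'.
have [[F hF]|hinf] := pselect (exists F : seq X,
  ~ exists x, [/\ e' x = x, nsq x = 1 & forall f, f \in F -> ip x f = 0]).
  exact: (finite_piece (usteps d) ep0 he' hF).
have Dinf (F : seq X) : exists x, [/\ e' x = x, nsq x = 1 & forall f, f \in F -> ip x f = 0].
  by apply: contra_notP hinf => h; exists F.
have Dact g x : e' x = x -> e' (p g x) = p g x by exact: piece_act.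
have Done x : e' x = x -> p hone x = x by exact: piece_one.
have mcentral i j : trivial_on p e' (cm (row i Rm *+ m i) j).
  by move=> x ex; apply: Cm; exact: subpieceP s' ex.
have [K [Kst Kn]] : exists K : kdata R d,
    (forall l, ktr (ko K) l = ko K <-> forall i, ((modulus N.+1 (m i))%:Z %| co Rm l i)%Z) /\
    (forall g, g \in gens -> near p e' g (kom K g.2 * kap (ko K) g.1) r1).
  apply: (character_data he' Ru mN mcentral (ltW r0_gt0) r01 r0del etaN hcont hint hn).
  by have [x [h1 h2 _]] := Dinf [::]; exists x.
have [b [phi [Ap [hb phiA phi1 slow [act cardA]]]]] := folner_function K (ltW eps00) hs.
have bK a : Ap a -> ktr (ko K) (b a) = a by move=> /hb[].
have bB a : Ap a -> b a \in boxseq d s.+1.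
  by move=> /hb[_ h]; apply: mem_boxseq => i; have := h i; rewrite natz.
have bb a i : Ap a -> `|b a 0 i| <= s.+1%:Z by move=> /hb[_ h]; have := h i; rewrite natz.
(* If [m j = 0] the modulus is [N + 1], larger than the coordinate, so divisibility forces the
   coordinate to be 0. *)
have stab_m k : k \in boxseq d B -> ktr (ko K) k = ko K -> forall j, ((m j)%:Z %| co Rm k j)%Z.
  move=> kB /Kst h j; have := h j; rewrite /modulus; case: eqP => // -> hdv.
  have -> : co Rm k j = 0; last exact: dvdz0.
  have := small _ j kB; rewrite ltnNge => /negP h'; apply/eqP; rewrite -absz_eq0.
  rewrite dvdzE /= in hdv; have [//|pos] := posnP (absz (co Rm k j)).
  by case: h'; exact: dvdn_leq.
pose chi (w : heis d) := kom K w.2 * kap (ko K) w.1.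
have word_stab z : word gens z -> ktr (ko K) z.1 = ko K.
  move/(_ (fun z => ktr (ko K) z.1 = ko K)); apply => /=; first exact: ktr0.
  - by move=> z1 w h1 h2; rewrite ktrD h1.
  - by move=> z1 h; rewrite -{1}h ktrK.
  - move=> g; rewrite mem_cat => /orP[/mapP[[i j] _ ->]|/mapP[i _ ->]] /=; first exact: ktr0.
    apply/Kst => j; rewrite co_row//; have [->|_] := eqVneq i j; last by rewrite muln0 dvdz0.
    by rewrite muln1 /modulus; case: eqP => [->|_]; [exact: dvdz0|exact: dvdzz].
have chiM z w : word gens z -> word gens w -> chi (hmul z w) = chi z * chi w.
  move=> hz hw; rewrite /chi /= !komD.
  have := kapD (ko K) z.1 w.1; rewrite (word_stab _ hz) => h.
  by rewrite [RHS]mulrACA h -!mulrA; congr (_ * (_ * _)); rewrite mulrC.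
have chi1 z : cabs (chi z) = 1 by rewrite cabsM cabs_kom cabs_kap mulr1.
have near_scal i a : Ap a -> Ap (ktr a (delta_mx 0 i)) -> forall x, e' x = x ->
    let z := hmul (hinv (b (ktr a (delta_mx 0 i)), 0)) (hmul (delta_mx 0 i, 0) (b a, 0)) in
    nrm (p z x - (kom K z.2 * kap (ko K) z.1) *: x) <= r * nrm x.
  move=> ha hsa x ex; set z := hmul _ _; cbv zeta.
  have zst : ktr (ko K) z.1 = ko K := z_stab bK ha hsa.
  have zzs : z \in zs.
    apply/allpairsP; exists ((i, b a), b (ktr a (delta_mx 0 i))); split => //=; last exact: bB.
    by apply/allpairsP; exists (i, b a); split => //=; [rewrite mem_enum|exact: bB].
  have z1B : z.1 \in boxseq d B.
    apply: mem_boxseq => j; rewrite !mxE /=.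
    exact: box_step (bb _ j ha) (bb _ j hsa).
  have wz : word gens z by have := word_lattice Ru z.2 (stab_m _ z1B zst); rewrite -surjective_pairing.
  have := near_weaken Cr1 (hC _ zzs wz _ _ _ _ _ he' (ltW r1_gt0) chiM chi1 Kn).
  exact.
have supply (tau : R) (F : seq X) : 0 < tau ->
    exists x, [/\ e' x = x, nsq x = 1, forall f, f \in F -> ip x f = 0 &
      forall a a', Ap a -> Ap a' -> a != a' ->
        cabs (ip (p (hmul (hinv (b a, 0)) (b a', 0)) x) x) <= tau].
  move=> tau0; pose Dp x := e' x = x.
  pose Ks := [seq k <- boxseq d B | `[< drift p Dp k >]].
  have KsP k : k \in Ks -> drift p Dp k by rewrite mem_filter => /andP[/asboolP].
  pose cs := [seq (hmul (hinv (b a, 0)) (b a', 0)).2 | a <- enum K, a' <- enum K].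
  have [x [h1 h2 h3 h4]] := diffuse_supply sp' Dact Done Dinf KsP F cs tau0.
  exists x; split=> // a a' ha ha' aa'; apply: h4; last first.
    by apply/allpairsP; exists (a, a'); rewrite /= !mem_enum.
  set k := _ + _; have kB : k \in boxseq d B.
    apply: mem_boxseq => j; rewrite /k !mxE /=.
    by have := @box_step _ _ false _ (bb _ j ha') (bb _ j ha); rewrite add0r.
  (* Without drift the dichotomy makes all commutators of [k] trivial, so [k] is among [rows] and
     fixes [ko K], whence [a = a']. *)
  rewrite mem_filter kB andbT; apply/asboolP; apply: contra_notP (negP aa') => ndr.
  have kC : Ce k.
    move=> j; have [//|[dl dl0 h]] := hd _ kB j.
    case: ndr; exists j, dl; split => // y ey; apply: h; exact: subpieceP s' ey.
  have krows : k \in rows by rewrite mem_filter kB andbT; apply/asboolP.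
  have kst : ktr (ko K) k = ko K.
    apply/Kst => j; have := rows_m _ krows j; rewrite /modulus; case: eqP => // ->.
    by rewrite dvd0z => /eqP ->; exact: dvdz0.
  have -> : a' = a; last by rewrite eqxx.
  rewrite -(bK _ ha') -(bK _ ha); have -> : b a' = k + b a by rewrite /k /= addrAC addNr add0r.
  by rewrite ktrD kst.
move=> xs eta' hx eta'0.
have cA : 2 * eps0 + 4 * #|Ap|%:R * r <= 2 * eps0 + 4 * (s.+3 ^ d)%:R * r.
  by rewrite lerD2l; apply: ler_wpM2r; [exact: ltW|apply: ler_wpM2l => //; rewrite ler_nat].
have e1 : 0 < 2 * eps0 + 4 * #|Ap|%:R * r.
  by rewrite ltr_wpDr ?mulr_gt0// !mulr_ge0// ltW.
have e2 : 20 * (2 * eps0 + 4 * #|Ap|%:R * r) <= ep by apply: le_trans hep; rewrite ler_wpM2l.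
have [l [l1 l2 l3 l4]] := absorb (@definite _ X) sp' Dact Done bK phiA phi1 (ltW eps00) (ltW r_gt0)
  slow act near_scal supply hx e1 e2.
exists l; split => //.
- by move=> g; rewrite mem_cat => /orP[/mapP[i _ ->]|/mapP[i _ ->]] y yl; [exact: l2|exact: l3].
- by move=> x xxs; exists x; [exact: l4|rewrite subrr nrm0 ltW].
Qed.

End RegularPiece.

Theorem piece_qd (R : realType) (d : nat) (X : hspace R) (p : hrep d X) (ep : R) e :
  0 < ep -> piece p e -> qd p (usteps d) ep e.
Proof.
(* With these constants [20 * 2 * eps0] and [20 * 4 * C * r] are [ep / 2] each; [C] bounds the size
   of [Ap]. *)
move=> ep0 he; pose eps0 := ep / 80; have e0 : 0 < eps0 by rewrite divr_gt0.
pose s := Num.truncn (2 / eps0 ^+ 2).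
have hs : 2 <= eps0 ^+ 2 * s.+1%:R.
  by rewrite mulrC -ler_pdivrMr ?exprn_gt0// ltW// truncnS_gt.
pose C : R := (s.+3 ^ d)%:R; have C0 : 0 < C by rewrite ltr0n expn_gt0.
pose r := ep / (160 * C); have r0 : 0 < r by rewrite divr_gt0// mulr_gt0.
have hep : 20 * (2 * eps0 + 4 * C * r) <= ep.
  suff -> : 20 * (2 * eps0 + 4 * C * r) = ep by [].
  by rewrite /r /eps0; field; rewrite lt0r_neq0.
pose B := (s.+1 + s.+1).+1.
apply: (dich_cut (cs := [seq cm k j | k <- boxseq d B, j <- enum 'I_d]) (ltW ep0) he) => e' s' hd.
have [he' _] := s'; apply: (regular_piece e0 r0 hs hep he') => k kB j; apply: hd.
by apply/allpairsP; exists (k, j); rewrite /= kB mem_enum.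
Qed.

(** * Groups of class two *)

Section ClassTwo.
Variable G : groupType.
Local Open Scope group_scope.

Lemma generated_ind (s : seq G) (Q : G -> Prop) : Q 1 -> (forall x y, Q x -> Q y -> Q (x * y)) ->
  (forall x, Q x -> Q x^-1) -> (forall x, x \in s -> Q x) -> forall x, generated s x -> Q x.
Proof.
move=> Q1 QM QV Qs x gx; pose K : {pred G} := [pred x | `[< Q x >]].
have KP y : (y \in K) <-> Q y by split=> h; [exact: (asboolW h)|exact: (asboolT h)].
have KM : mulg_closed K by move=> y z /KP hy /KP hz; apply/KP; exact: QM.
have K1 : 1 \in K by apply/KP.
have KV : invg_closed K by move=> y /KP hy; apply/KP; exact: QV.
pose KG : groupClosed G := HB.pack K (isInvClosed.Build G K KV) (isMul1Closed.Build G K K1)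
  (isMulClosed.Build G K KM).
by apply/KP; apply: (gx KG) => y ys; apply/KP; exact: Qs.
Qed.

Definition zpow (x : G) (k : int) : G := match k with Posz n => x ^+ n | Negz n => x ^- n.+1 end.

Lemma zpowS x k : zpow x (k + 1)%R = zpow x k * x.
Proof.
case: k => [n|[|n]].
- by rewrite -PoszD addn1 /= expgSr.
- by rewrite /= expg1 mulVg.
- have -> : (Negz n.+1 + 1)%R = Negz n by lia.
  by rewrite /= [x ^+ n.+2]expgS invgM mulgVK.
Qed.

Lemma zpowB x k : zpow x (k - 1)%R = zpow x k * x^-1.
Proof. by rewrite -{2}(subrK 1%R k) zpowS mulgK. Qed.

Lemma zpowD x k l : zpow x (k + l)%R = zpow x k * zpow x l.
Proof.
elim/int_rect: l => [|n IH|n IH]; first by rewrite addr0 mulg1.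
  have -> : (n.+1 : int) = (n%:Z + 1)%R by lia.
  by rewrite addrA !zpowS IH mulgA.
have -> : (- (n.+1%:Z))%R = (- n%:Z - 1)%R by lia.
by rewrite addrA !zpowB IH mulgA.
Qed.

Lemma zpowM x k l : zpow x (k * l)%R = zpow (zpow x k) l.
Proof.
elim/int_rect: l => [|n IH|n IH]; first by rewrite mulr0.
  have -> : (n.+1 : int) = (n%:Z + 1)%R by lia.
  by rewrite mulrDr mulr1 [in LHS]zpowD IH zpowS.
have -> : (- (n.+1%:Z))%R = (- n%:Z - 1)%R by lia.
rewrite mulrBr mulr1 [in LHS]zpowD IH zpowB; congr (_ * _).
by apply: (@mulIg _ (zpow x k)); rewrite -zpowD addNr mulVg.
Qed.

Hypothesis com_central : forall x y z : G, commute [~ x, y] z.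

Lemma com_uniq x y c : x * y = y * x * c -> [~ x, y] = c :> G.
Proof. by rewrite [LHS]commgC => /mulgI. Qed.

Lemma comMl x y z : [~ x * y, z] = [~ x, z] * [~ y, z] :> G.
Proof.
apply: com_uniq; move: (commgC x z) (commgC y z) (com_central x z y).
move: [~ x, z] [~ y, z] => c c' h1 h2 h3.
rewrite -mulgA h2 !mulgA h1 -!mulgA; congr (_ * (_ * _)).
by rewrite !mulgA; congr (_ * _).
Qed.

Lemma comMr x y z : [~ x, y * z] = [~ x, y] * [~ x, z] :> G.
Proof.
apply: com_uniq.
move: (commgC x y) (commgC x z) (com_central x y z) (com_central x y [~ x, z]).
move: [~ x, y] [~ x, z] => c c' h1 h2 h3 h4.
rewrite mulgA h1 -[LHS]mulgA h3 mulgA -(mulgA y x z) h2 -!mulgA.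
by do 3 congr (_ * _); exact/esym.
Qed.

Lemma com1g x : [~ 1, x] = 1 :> G.
Proof. by apply: com_uniq; rewrite mul1g !mulg1. Qed.

Lemma com_zpowl x y k : [~ zpow x k, y] = zpow [~ x, y] k :> G.
Proof.
have cV : [~ x^-1, y] = [~ x, y]^-1 :> G.
  by apply: (@mulIg _ [~ x, y]); rewrite -comMl !mulVg com1g.
elim/int_rect: k => [|n IH|n IH]; first by rewrite /= com1g.
  have -> : (n.+1 : int) = (n%:Z + 1)%R by lia.
  by rewrite !zpowS comMl IH.
have -> : (- (n.+1%:Z))%R = (- n%:Z - 1)%R by lia.
by rewrite !zpowB comMl IH cV.
Qed.

Lemma com_zpowr x y k : [~ x, zpow y k] = zpow [~ x, y] k :> G.
Proof.
have cV : [~ x, y^-1] = [~ x, y]^-1 :> G.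
  by apply: (@mulIg _ [~ x, y]); rewrite -comMr !mulVg commg1.
elim/int_rect: k => [|n IH|n IH]; first by rewrite /= commg1.
  have -> : (n.+1 : int) = (n%:Z + 1)%R by lia.
  by rewrite !zpowS comMr IH.
have -> : (- (n.+1%:Z))%R = (- n%:Z - 1)%R by lia.
by rewrite !zpowB comMr IH cV.
Qed.

Lemma zpow_central x y k z : commute (zpow [~ x, y] k : G) z.
Proof. by rewrite -com_zpowl. Qed.

Variables (d : nat) (u : 'I_d -> G).
Implicit Types (r : seq 'I_d) (k l : 'I_d -> int) (c : 'I_d -> 'I_d -> int).

Definition wprod r k := \prod_(i <- r) zpow (u i) (k i).

(** Only pairs with [j] after [i] occur: these are the commutators created by multiplying two
    ordered words. *)
Fixpoint cprod r c : G :=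
  if r is i :: r' then (\prod_(j <- r') zpow [~ u j, u i] (c j i)) * cprod r' c else 1.

Lemma cprod_central r c z : commute (cprod r c) z.
Proof.
elim: r => [|i r IH] /=; first exact/commute_sym/commute1.
apply: commute_sym; apply: commuteM; last exact: commute_sym.
by apply: commute_prod => j _; apply: commute_sym; exact: zpow_central.
Qed.

Lemma cprodD r c c' : cprod r (fun j i => c j i + c' j i)%R = cprod r c * cprod r c'.
Proof.
elim: r => [|i r IH] /=; first by rewrite mulg1.
have -> : \prod_(j <- r) zpow [~ u j, u i] (c j i + c' j i)%R =
    \prod_(j <- r) zpow [~ u j, u i] (c j i) * \prod_(j <- r) zpow [~ u j, u i] (c' j i).
  elim: {IH} r => [|j s IHs]; first by rewrite !big_nil mulg1.
  rewrite !big_cons zpowD IHs -!mulgA; congr (_ * _).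
  by rewrite [LHS]mulgA (zpow_central (u j) (u i) (c' j i) (\prod_(k <- s) zpow [~ u k, u i] (c k i))) -mulgA.
rewrite IH -!mulgA; congr (_ * _).
by rewrite [LHS]mulgA -(cprod_central r c) -mulgA.
Qed.

Lemma com_wprod r k i (l : int) :
  [~ wprod r k, zpow (u i) l] = \prod_(j <- r) zpow [~ u j, u i] (k j * l)%R :> G.
Proof.
rewrite /wprod; elim: r => [|j r IH]; first by rewrite !big_nil com1g.
by rewrite !big_cons comMl IH com_zpowl com_zpowr -zpowM mulrC.
Qed.

(** Collection: the factor [u i] to the power [l i] moves left past the later factors of the first
    word, and each [u j] to the power [k j] that it crosses contributes a central power of
    [[~ u j, u i]] with exponent [k j * l i]. *)
Lemma wprodM r k l : wprod r k * wprod r l =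
  wprod r (fun i => k i + l i)%R * cprod r (fun j i => k j * l i)%R.
Proof.
elim: r => [|i r IH] /=; first by rewrite /wprod !big_nil.
rewrite {1 2 3}/wprod !big_cons -!/(wprod _ _) -com_wprod zpowD.
move: (commgC (wprod r k) (zpow (u i) (l i))) (com_central (wprod r k) (zpow (u i) (l i))).
move: [~ _, _] => c h1 h2; rewrite -!mulgA; congr (_ * _).
rewrite [wprod r k * (_ * _)]mulgA h1 -!mulgA; congr (_ * _).
by rewrite h2 mulgA IH -!mulgA; congr (_ * _); exact/esym/h2.
Qed.

Definition heis_hom (g : heis d) : G :=
  wprod (enum 'I_d) (fun i => g.1 0%R i) * cprod (enum 'I_d) (fun j i => g.2 j i).

Lemma heis_homM g g' : heis_hom (hmul g g') = heis_hom g * heis_hom g'.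
Proof.
rewrite /heis_hom /=; set r := enum _.
have -> : (fun i => (g.1 + g'.1)%R 0%R i) = (fun i => g.1 0 i + g'.1 0 i)%R.
  by apply/funext => i; rewrite mxE.
have -> : (fun j i => (g.2 + g'.2 + g.1^T *m g'.1)%R j i) =
    (fun j i => (g.2 j i + g'.2 j i) + (g.1 0 j * g'.1 0 i))%R.
  by apply/funext => j; apply/funext => i; rewrite 3!mxE big_ord1 mxE.
rewrite !cprodD -!mulgA (mulgA (cprod r (fun j i => g.2 j i)) (wprod _ _)).
rewrite (cprod_central r _ (wprod _ _)) -!mulgA [RHS]mulgA wprodM -!mulgA; congr (_ * _).
by rewrite mulgA -(cprod_central r _ (_ * _)).
Qed.

Lemma heis_hom_gen i : heis_hom (delta_mx 0 i, 0)%R = u i.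
Proof.
rewrite /heis_hom /=.
have -> r : cprod r (fun j i => (0 : 'M[int]_d)%R j i) = 1.
  by elim: r => [|j r IH] //=; rewrite IH mulg1 big1// => a _; rewrite mxE.
rewrite mulg1 /wprod.
have P0 r : i \notin r -> \prod_(j <- r) zpow (u j) ((delta_mx 0 i : 'rV[int]_d)%R 0%R j) = 1.
  elim: r => [|j r IH]; first by rewrite big_nil.
  rewrite inE negb_or => /andP[ij ir]; rewrite big_cons IH// mulg1 mxE eqxx.
  by rewrite eq_sym (negPf ij).
have : i \in enum 'I_d by rewrite mem_enum.
elim: (enum _) (enum_uniq 'I_d) => // j r IH /= /andP[jr ur]; rewrite inE big_cons mxE eqxx.
case: (eqVneq i j) => [ij _|ij /= ir]; first by rewrite /= P0 ?mulg1 ij.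
by rewrite mul1g; exact: IH.
Qed.

End ClassTwo.

Section Cover.
Local Open Scope group_scope.

(** Commutators lie in [Delta], hence are central, so [heis_hom] applies to lifts of generators of
    the quotient together with generators of [Delta]. Generation by their images is stated as an
    induction principle, which serves both for surjectivity and for almost commutation. *)
Theorem heis_cover (Gamma : groupType) (Delta : groupClosed Gamma) (Dc : central Delta) :
  finitely_generated [set` Delta] ->
  finitely_generated [set: quotient (central_normal Dc)] ->
  abelian [set: quotient (central_normal Dc)] ->
  exists d (h : heis d -> Gamma), (forall g g', h (hmul g g') = h g * h g') /\
    forall Q : Gamma -> Prop, (forall x y, Q x -> Q y -> Q (x * y)) ->
      (forall x, Q x -> Q x^-1) -> (forall i, Q (h (delta_mx 0%R i, 0)%R)) -> forall x, Q x.
Proof.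
move=> [sD hD] [sq hq] ab.
pose N := central_normal Dc; pose pi (x : Gamma) : quotient N := \pi_(quotient N)%qT x.
have comD x y : [~ x, y] \in Delta.
  have := ab (pi x) (pi y) I I; rewrite /commute => h.
  have : same_coset N (y * x) (x * y).
    apply/same_cosetP; rewrite -!quotient_piM; exact/esym.
  by rewrite /same_coset invgM -mulgA.
have cc (x y z : Gamma) : commute [~ x, y] z := Dc _ z (comD x y).
(* The entry 1 provides [Q 1], as [Q] is closed under products and inverses only. *)
pose s := 1 :: [seq repr a | a <- sq] ++ sD.
pose u (i : 'I_(size s)) := nth 1 s i.
exists (size s), (heis_hom u); split; first exact: heis_homM.
move=> Q QM QV Qu x.
have Qs y : y \in s -> Q y.
  move=> /(nthP 1)[i si <-]; have := Qu (Ordinal si); rewrite heis_hom_gen//.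
have Q1 : Q 1 by apply: Qs; exact: mem_head.
have QD y : y \in Delta -> Q y.
  move=> yD; apply: (generated_ind (s := sD)) => //.
    by move=> z zs; apply: Qs; rewrite inE mem_cat zs !orbT.
  by rewrite -hD.
have [y [hy Qy]] : exists y, pi y = pi x /\ Q y.
  apply: (generated_ind (s := sq) (Q := fun a => exists y, pi y = a /\ Q y)) => //.
  - by exists 1.
  - move=> _ _ [a [<- Qa]] [b [<- Qb]]; exists (a * b); split; last exact: QM.
    exact/esym/quotient_piM.
  - by move=> _ [a [<- Qa]]; exists a^-1; split; [exact/esym/quotient_piV|exact: QV].
  - move=> a asq; exists (repr a); split; first exact: reprK.
    by apply: Qs; rewrite inE mem_cat map_f ?orbT.
  - by rewrite -hq.
rewrite -[x](mulVKg y); apply: QM => //; apply: QD.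
by have /same_cosetP := hy.
Qed.

End Cover.

(** * Finite-dimensional almost invariant subspaces *)

Section Filtration.
Variables (R : realType) (d : nat) (X : hspace R) (p : hrep d X).
Local Notation us := (usteps d).
Let lp g := hact_linear p g.

Lemma hinv_one : hinv hone = hone :> heis d.
Proof. by rewrite /hinv /hone /= trmx0 mul0mx addr0 !oppr0. Qed.

Lemma unit_piece : piece p (p hone).
Proof.
split=> [x y|x|g x|x].
- by rewrite hact_adj hinv_one.
- by rewrite -hactM hmul1.
- by rewrite -!hactM hmul1 h1mul.
- by rewrite -hactM hmul1.
Qed.

Lemma hact_unit g x : p g (p hone x) = p g x.
Proof. by rewrite -hactM hmul1. Qed.

Lemma hact_contr g x : nrm (p g x) <= nrm x.
Proof.
rewrite -hact_unit hact_nrm; last by rewrite -hactM hmul1.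
exact: (piece_nrm x unit_piece).
Qed.

Lemma usteps_inv g : g \in us -> hinv g \in us.
Proof.
rewrite !mem_cat => /orP[/mapP[i _ ->]|/mapP[i _ ->]]; apply/orP.
  by right; apply: map_f; rewrite mem_enum.
by left; rewrite hinvK map_f// mem_enum.
Qed.

(** The action vanishes on the complement of the range of [p hone], so the components [x - E x] can
    be added without spoiling almost invariance. *)
Lemma qd_whole (ep eta : R) (xs : seq X) : 0 < ep -> 0 < eta ->
  exists l : seq X, ainv p us ep l /\ forall x, x \in xs -> exists2 y, span l y & nrm (x - y) <= eta.
Proof.
move=> ep0 eta0; pose E := p hone; have he : piece p E := unit_piece.
have lE := piece_linear he; have [Es Ei Ec Eu] := he.
have [|//|l [lE1 l2 l3]] := piece_qd ep0 he (xs := [seq E x | x <- xs]) (eta := eta).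
  by move=> _ /mapP[x _ ->].
pose l' := [seq x - E x | x <- xs].
have dec y : span (l ++ l') y -> span l (E y).
  move/(_ (fun y => span l (E y))); apply.
    split; first by rewrite (lin0 lE); exact: (span_subsp l).1.
    by move=> a x z hx hz; rewrite lE; exact: (span_subsp l).2.
  move=> z; rewrite mem_cat => /orP[zl|/mapP[x _ ->]].
    by rewrite lE1//; exact: span_mem.
  by rewrite (linB _ _ lE) Ei subrr; exact: (span_subsp l).1.
have lsub y : span l y -> span (l ++ l') y.
  by apply: span_sub => z zl; apply: span_mem; rewrite mem_cat zl.
exists (l ++ l'); split.
  move=> g gu y /dec yl; have [y' y'l hy'] := l2 g gu _ yl; exists y'; first exact: lsub.
  rewrite -(hact_unit g y); apply: le_trans hy' _.
  by apply: ler_wpM2l; [exact: ltW|exact: piece_nrm].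
move=> x xxs; have [|y yl hy] := l3 (E x); first exact: map_f.
exists (y + (x - E x)).
  apply: spanD; first exact: lsub.
  by apply: span_mem; rewrite mem_cat; apply/orP; right; apply: (map_f (fun x => x - E x)).
by have -> : x - (y + (x - E x)) = E x - y by rewrite opprD opprB addrCA [x + _]addrC subrK addrC.
Qed.

(* One orthonormal vector at a time is moved into the span, by a perturbation
   of the identity that fixes the vectors orthogonal to it. *)
Lemma perturb (ep eta M : R) (xi : X) (l xs ys : seq X) : 0 < ep -> ep <= 1 -> 0 <= eta ->
  eta <= ep / 20 -> nsq xi = 1 -> ainv p us (ep / 4) l ->
  (exists2 y, span l y & nrm (xi - y) <= eta) ->
  (forall x, x \in xs -> nrm x <= M /\ exists2 y, span l y & nrm (x - y) <= eta) ->
  (forall y, y \in ys -> span l y /\ ip xi y = 0) ->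
  exists l' : seq X, [/\ ainv p us ep l', span l' xi, forall y, y \in ys -> span l' y &
    forall x, x \in xs -> exists2 y, span l' y & nrm (x - y) <= eta + 2 * eta * (M + 1)].
Proof.
move=> ep0 ep1 eta0 etaep xi1 linv [y0 y0l hy0] hxs hys.
have [es [oes e1 e2]] := gram_schmidt (@definite _ X) l.
pose P := proj es; have lP : linear P := proj_linear es.
have Pl x : span l (P x) by apply: e1; exact: proj_span.
have hP : nrm (xi - P xi) <= eta by apply: le_trans hy0; apply: proj_nearest => //; exact: e2.
have nxi : nrm xi = 1 by rewrite /nrm xi1 sqrtr1.
have Phalf : 2^-1 <= nrm (P xi) by have := nrm_rev xi (P xi); rewrite nxi; lra.
pose q := nsq (P xi); have qE : q = nrm (P xi) ^+ 2 by rewrite nrm2.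
have q0 : q != 0 by rewrite qE expf_neq0//; apply: lt0r_neq0; lra.
(* [Z] takes [P xi] to [xi], and since [|P xi| >= 1/2] it is within [2 eta] of the identity. *)
pose w := xi - P xi; pose Z y := y + (ip y (P xi) / q%:C) *: w.
have lZ : linear Z.
  by move=> a x y; rewrite /Z ipDZl mulrDl scalerDl (scalerDr a x) scalerA mulrA addrACA.
have Zn y : nrm (Z y - y) <= 2 * eta * nrm y.
  rewrite /Z addrC addKr nrmZ cabsM -(rmorphV (real_complex R)) ?unitfE// cabs_real.
  rewrite ger0_norm ?invr_ge0 ?nsq_ge0// qE.
  have := cauchy_schwarz y (P xi); move: hP Phalf; rewrite -/w.
  have := nrm_ge0 w; have := nrm_ge0 y; have := cabs_ge0 (ip y (P xi)).
  move: (cabs _) (nrm y) (nrm w) (nrm (P xi)) => c ny nw np c0 ny0 nw0 hw hp hc.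
  have np0 : 0 < np by lra.
  have -> : c / np ^+ 2 * nw = c / np * (nw / np) by field; rewrite lt0r_neq0.
  have h1 : c / np <= ny by rewrite ler_pdivrMr.
  have h2 : nw / np <= 2 * eta by rewrite ler_pdivrMr//; nra.
  rewrite mulrC; apply: ler_pM => //; rewrite divr_ge0// ltW//.
have ZP : Z (P xi) = xi.
  rewrite /Z ipxx -/q mulfV ?scale1r; first by rewrite /w addrC subrK.
  by rewrite -(rmorph0 (real_complex R)) (inj_eq (@complexI R)).
have Zl y : span l y -> span [seq Z z | z <- l] (Z y).
  move/(_ (fun y => span [seq Z z | z <- l] (Z y))); apply.
    split; first by rewrite (lin0 lZ); exact: (span_subsp _).1.
    by move=> a x z hx hz; rewrite lZ; exact: (span_subsp _).2.
  by move=> z zl; apply: span_mem; exact: map_f.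
have Zr y : span [seq Z z | z <- l] y -> exists2 z, span l z & y = Z z.
  move/(_ (fun y => exists2 z, span l z & y = Z z)); apply.
    split; first by exists 0; [exact: (span_subsp _).1|rewrite (lin0 lZ)].
    by move=> a _ _ [x xl ->] [z zl ->]; exists (a *: x + z); [exact: (span_subsp _).2|rewrite lZ].
  by move=> _ /mapP[z zl ->]; exists z => //; exact: span_mem.
exists [seq Z z | z <- l]; split.
- move=> g gu _ /Zr[y yl ->]; have [y' y'l hy'] := linv g gu y yl.
  exists (Z y'); first exact: Zl.
  have h1 : nrm (p g (Z y) - Z y') <= nrm (p g (Z y - y)) + nrm (p g y - y') + nrm (Z y' - y').
    have -> : p g (Z y) - Z y' = p g (Z y - y) + (p g y - y') - (Z y' - y').
      by rewrite (linB _ _ (lp g)) addrA subrK opprB addrA subrK.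
    by apply: le_trans (nrm_triangleB _ _) _; rewrite lerD2r; exact: nrm_triangle.
  have h2 := le_trans (hact_contr g _) (Zn y); have h3 := Zn y'.
  have h4 : nrm y' <= nrm y + ep / 4 * nrm y.
    have := nrm_rev y' (p g y); rewrite nrmBC => h; have := hact_contr g y; lra.
  have h5 : nrm y - nrm (Z y) <= 2 * eta * nrm y.
    by apply: le_trans (nrm_rev _ _) _; rewrite nrmBC.
  have := nrm_ge0 y'; have := nrm_ge0 y; have := nrm_ge0 (Z y); move: h1 h2 h3 hy' h4 h5.
  move: (nrm (p g (Z y) - _)) (nrm (p g (Z y - y))) (nrm (p g y - y')) (nrm (Z y' - y')).
  move: (nrm y) (nrm y') (nrm (Z y)) => a b c u1 u2 u3 u4 h1 h2 h3 h4 h5 h6 c0 a0 b0.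
  have k1 : 2 * eta * a <= ep / 10 * a by rewrite ler_wpM2r//; lra.
  have k0 : ep * a <= a by rewrite ler_piMl.
  have k2 : a <= 10 / 9 * c by lra.
  have k3 : b <= 5 / 4 * a by lra.
  have k4 : 2 * eta * b <= ep / 10 * b by rewrite ler_wpM2r//; lra.
  have k5 : ep * a <= ep * (10 / 9 * c) by rewrite ler_pM2l.
  have k6 : ep * b <= ep * (5 / 4 * a) by rewrite ler_pM2l.
  have k7 : 0 <= ep * c by rewrite mulr_ge0// ltW.
  by lra.
- by rewrite -ZP; apply: Zl.
- move=> y /hys[yl hy]; have <- : Z y = y; last exact: Zl.
  rewrite /Z -(proj_self es) proj_id ?(ip_eq0C hy) ?mul0r ?scale0r ?addr0//; exact: e2.
- move=> x /hxs[hM [y yl hy]]; exists (Z y); first exact: Zl.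
  have -> : x - Z y = (x - y) - (Z y - y) by rewrite opprB addrA subrK.
  apply: le_trans (nrm_triangleB _ _) _; apply: lerD => //; apply: le_trans (Zn y) _.
  have : nrm y <= M + 1 by have := nrm_rev y x; rewrite nrmBC; lra.
  by move=> h; rewrite ler_wpM2l// mulr_ge0.
Qed.

Lemma bounded_seq (xs : seq X) : exists2 M : R, 0 <= M & forall x, x \in xs -> nrm x <= M.
Proof.
exists (\sum_(x <- xs) nrm x); first by rewrite sumr_ge0// => x _; exact: nrm_ge0.
elim: xs => [//|y xs IH] x; rewrite inE big_cons => /orP[/eqP ->|/IH h].
  by rewrite lerDl sumr_ge0// => z _; exact: nrm_ge0.
by apply: le_trans h _; rewrite lerDr nrm_ge0.
Qed.

(** The perturbation that brings in [xi] keeps the vectors already contained, as they are orthogonal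
    to [xi]; the induction hypothesis is called with smaller tolerances to pay for it. *)
Lemma exact_ons (todo : seq X) : ons todo -> forall (ep eta : R) (xs : seq X), 0 < ep -> 0 < eta ->
  exists l : seq X, [/\ ainv p us ep l, forall y, y \in todo -> span l y &
    forall x, x \in xs -> exists2 y, span l y & nrm (x - y) <= eta].
Proof.
elim: todo => [|xi todo IH] /= ho ep eta xs ep0 eta0.
  by have [l [h1 h2]] := qd_whole xs ep0 eta0; exists l.
have [xi1 orth /IH{}IH] := ho; have xi1n : nsq xi = 1 by rewrite /nsq xi1.
have [M M0 hM] := bounded_seq xs.
pose ep' := Num.min ep 1; have ep'0 : 0 < ep' by rewrite lt_min ep0 ltr01.
have ep'1 : ep' <= 1 by rewrite ge_min lexx orbT.
have ep'ep : ep' <= ep by rewrite ge_min lexx.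
pose eta' := Num.min (ep' / 20) (eta / (1 + 2 * (M + 1))).
have dM : 0 < 1 + 2 * (M + 1) by lra.
have eta'0 : 0 < eta' by rewrite lt_min !divr_gt0.
have eta'1 : eta' <= ep' / 20 by rewrite ge_min lexx.
have eta'2 : eta' + 2 * eta' * (M + 1) <= eta.
  have : eta' <= eta / (1 + 2 * (M + 1)) by rewrite ge_min lexx orbT.
  by rewrite ler_pdivlMr//; lra.
have [|l [l1 l2 l3]] := IH (ep' / 4) eta' (xi :: xs) _ eta'0; first by rewrite divr_gt0.
have [|x xxs|y yt|l' [k1 k2 k3 k4]] := perturb (M := M) (xs := xs) (ys := todo) ep'0 ep'1 (ltW eta'0) eta'1 xi1n l1.
- by apply: l3; exact: mem_head.
- by split; [exact: hM|apply: l3; rewrite inE xxs orbT].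
- by split; [exact: l2|exact: orth].
exists l'; split.
- move=> g gu y yl; have [y' y'l h] := k1 g gu y yl; exists y' => //.
  by apply: le_trans h _; rewrite ler_wpM2r ?nrm_ge0.
- by move=> y; rewrite inE => /orP[/eqP ->|/k3].
- by move=> x /k4[y yl h]; exists y => //; exact: le_trans h eta'2.
Qed.

Lemma exact_containment (ep : R) (xs : seq X) : 0 < ep ->
  exists l : seq X, [/\ ons l, ainv p us ep l & forall x, x \in xs -> span l x].
Proof.
move=> ep0; have [es [oes e1 e2]] := gram_schmidt (@definite _ X) xs.
have [l [l1 l2 _]] := exact_ons oes [::] ep0 ltr01.
have [fs [ofs f1 f2]] := gram_schmidt (@definite _ X) l.
exists fs; split=> //.
  by move=> g gu y /f1 yl; have [y' y'l h] := l1 g gu y yl; exists y' => //; exact: f2.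
move=> x xxs; apply: f2; have /e2 := span_mem xxs; exact: span_sub.
Qed.

(** Exact containment of the previous space and of the next vector is what makes the projections
    increase to 1. *)
Lemma filtration (x : nat -> X) : exists L : nat -> seq X,
  [/\ forall n, ons (L n), forall n y, span (L n) y -> span (L n.+1) y,
      forall n, span (L n.+1) (x n) & forall n, ainv p us (n.+1%:R^-1) (L n.+1)].
Proof.
have step (nl : nat * seq X) : exists l : seq X, [/\ ons l, ainv p us (nl.1.+1%:R^-1) l &
    forall y, y \in x nl.1 :: nl.2 -> span l y].
  by apply: exact_containment; rewrite invr_gt0.
have [F hF] := choice step.
pose L := fix L n := if n is m.+1 then F (m, L m) else [::].
exists L; split=> [[//|n]|n y|n|n].
- by have [] := hF (n, L n).
- by apply: span_sub => z zl; have [_ _] := hF (n, L n); apply; rewrite inE zl orbT.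
- by have [_ _] := hF (n, L n); apply; exact: mem_head.
- by have [] := hF (n, L n).
Qed.

(** [(1 - P) g P] is small by almost invariance, and [P g (1 - P)] is the adjoint of
    [(1 - P) g^-1 P], small because the generators are closed under inversion. *)
Lemma ainv_commutator (ep : R) (es : seq X) g x : ons es -> 0 <= ep -> ainv p us ep es ->
  g \in us -> nrm (proj es (p g x) - p g (proj es x)) <= 2 * ep * nrm x.
Proof.
move=> oes ep0 hinv_ gu; set P := proj es; have lP : linear P := proj_linear es.
have h1 : nrm (p g (P x) - P (p g (P x))) <= ep * nrm x.
  have [y' y'l h] := hinv_ g gu (P x) (@proj_span _ _ es x).
  apply: le_trans (proj_nearest _ oes y'l) _; apply: le_trans h _.
  by rewrite ler_wpM2l// nrm_proj.
have h2 : nrm (P (p g (x - P x))) <= ep * nrm x.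
  set v := x - P x; set w := P (p g v).
  have wl : span es w by exact: proj_span.
  have [y' y'l h] := hinv_ _ (usteps_inv gu) w wl.
  have : nsq w <= nrm v * (ep * nrm w).
    have -> : nsq w = Re (ip v (p (hinv g) w - y')).
      rewrite /nsq {1}/w proj_self proj_id// hact_adj ipBr ReB.
      by rewrite (proj_orth x oes y'l) subr0.
    by apply: le_trans (Re_ip_le _ _) _; rewrite ler_wpM2l ?nrm_ge0.
  rewrite -nrm2; have := nrm_ge0 w; rewrite le_eqVlt => /orP[/eqP <- _|w0].
    by rewrite mulr_ge0 ?nrm_ge0.
  rewrite expr2 mulrA ler_pM2r// => hv; apply: le_trans hv _.
  by rewrite mulrC ler_wpM2l// nrm_projC.
have -> : P (p g x) - p g (P x) = P (p g (x - P x)) - (p g (P x) - P (p g (P x))).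
  by rewrite (linB _ _ (lp g)) (linB _ _ lP) opprB addrA subrK.
by apply: le_trans (nrm_triangleB _ _) _; lra.
Qed.

End Filtration.

(** * Normed spaces and C*-algebras *)

Import numFieldNormedType.Exports.

Section RealNorm.
Variable R : realType.

Lemma ltr0c (a : R) : (0 < a%:C) = (0 < a).
Proof. by rewrite -(rmorph0 (real_complex R)) ltcR. Qed.

Lemma gt0_complex (z : R[i]) : 0 < z -> z = (Re z)%:C /\ 0 < Re z.
Proof.
move=> z0; have e : z = (Re z)%:C.
  by rewrite -{1}(gtr0_norm z0) cabsE /cabs gtr0_norm.
by split=> //; rewrite -ltr0c -e.
Qed.

Section Normed.
Variable V : normedModType R[i].
Implicit Types x y z : V.

Definition rn x : R := Re `|x|.

Lemma rnE x : `|x| = (rn x)%:C.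
Proof. by rewrite -[LHS]normr_id cabsE /cabs normr_id. Qed.

Lemma rn_ge0 x : 0 <= rn x.
Proof. by rewrite -ler0c -rnE. Qed.

Lemma rn0 : rn 0 = 0.
Proof. by rewrite /rn normr0. Qed.

Lemma rnD x y : rn (x + y) <= rn x + rn y.
Proof. by rewrite -lecR rmorphD /= -!rnE ler_normD. Qed.

Lemma rnZ (a : R[i]) x : rn (a *: x) = cabs a * rn x.
Proof. by apply: complexI; rewrite rmorphM /= -rnE -cabsE -rnE normrZ. Qed.

Lemma rnN x : rn (- x) = rn x.
Proof. by rewrite /rn normrN. Qed.

Lemma rnBC x y : rn (x - y) = rn (y - x).
Proof. by rewrite -rnN opprB. Qed.

Lemma rnB x y : rn (x - y) <= rn x + rn y.
Proof. by rewrite -(rnN y) rnD. Qed.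

Lemma rn_dist x y z : rn (x - z) <= rn (x - y) + rn (y - z).
Proof. by rewrite -{1}(subrK y x) -addrA rnD. Qed.

Lemma rn_eq0 x : rn x = 0 -> x = 0.
Proof. by move=> h; apply/eqP; rewrite -normr_eq0 rnE h. Qed.

Lemma rn_le0 x : (forall e : R, 0 < e -> rn x <= e) -> x = 0.
Proof.
move=> h; apply: rn_eq0; apply/eqP; rewrite eq_le rn_ge0 andbT.
by apply/ler_addgt0Pl => e e0; rewrite addr0; exact: h.
Qed.

Lemma ball_rn x (e : R) y : 0 < e -> ball x e%:C y <-> rn (x - y) < e.
Proof. by move=> e0; rewrite -ball_normE /= rnE ltcR. Qed.

Lemma nbhs_rnP x (P : set V) : nbhs x P <->
  exists2 e : R, 0 < e & forall y, rn (x - y) < e -> P y.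
Proof.
split=> [/nbhs_ballP[e /= e0 h]|[e e0 h]].
  have [ee e1] := gt0_complex e0; exists (Re e) => // y /(ball_rn _ _ e1); rewrite -ee.
  exact: h.
apply/nbhs_ballP; exists e%:C => /=; first by rewrite ltr0c.
by move=> y /(ball_rn _ _ e0)/h.
Qed.

Lemma cvg_rnP (u : nat -> V) (l : V) : u n @[n --> \oo] --> l <->
  forall e : R, 0 < e -> exists N, forall n, (N <= n)%N -> rn (u n - l) <= e.
Proof.
split=> [h e e0|h].
  have : nbhs l [set y | rn (l - y) < e] by apply/nbhs_rnP; exists e.
  move=> /h[N _ hN]; exists N => n Nn; rewrite rnBC ltW//; exact: hN.
move=> P /nbhs_rnP[e e0 hP]; have [|N hN] := h (e / 2); first by rewrite divr_gt0.
exists N => // n /= Nn; apply: hP; rewrite rnBC; apply: le_lt_trans (hN _ Nn) _; lra.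
Qed.

Lemma dense_rnP (D : set V) : dense D <-> forall x (e : R), 0 < e -> exists2 y, D y & rn (x - y) <= e.
Proof.
split=> [h x e e0|h O [x Ox] oO].
  have nb : nbhs x [set y | rn (x - y) < e] by apply/nbhs_rnP; exists e.
  have [|y [hy Dy]] := h [set y | rn (x - y) < e]° _ (open_interior _); first by exists x.
  by exists y => //; apply: ltW; exact: (interior_subset hy).
have /nbhs_rnP[e e0 hO] : nbhs x O by exact: open_nbhs_nbhs.
have [|y Dy hy] := h x (e / 2); first by rewrite divr_gt0.
exists y; split=> //; apply: hO; apply: le_lt_trans hy _; lra.
Qed.

Lemma line_continuous x : continuous (fun a : R => a%:C *: x).
Proof.
move=> a P /nbhs_rnP[e e0 hP].
have d0 : 0 < rn x + 1 by have := rn_ge0 x; lra.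
apply/nbhs_ballP; exists (e / (rn x + 1)) => /=; first by rewrite divr_gt0.
move=> b; rewrite -ball_normE /= => hb; apply: hP.
rewrite -scalerBl -rmorphB /= rnZ cabs_real.
have : `|a - b| * (rn x + 1) < e by rewrite -ltr_pdivlMr.
have := normr_ge0 (a - b); lra.
Qed.

(** The coefficients are real; [precompact_proj] lists both [e] and [i e] to cover complex ones. *)
Fixpoint boxspan (l : seq V) : set V :=
  if l is e :: l' then (fun q : R * V => q.1%:C *: e + q.2) @` (`[-1, 1]%classic `*` boxspan l')
  else [set 0].

Lemma boxspan_compact l : compact (boxspan l).
Proof.
elim: l => [|e l IH] /=; first exact: compact_set1.
apply: continuous_compact; last by apply: compact_setX => //; exact: segment_compact.
apply: continuous_subspaceT => q.
apply: (@cvgD _ _ _ _ _ (fun q : R * V => q.1%:C *: e) snd); last exact: cvg_snd.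
apply: (@continuous_comp _ _ _ fst (fun a : R => a%:C *: e)); first exact: cvg_fst.
exact: line_continuous.
Qed.

End Normed.

Lemma complete_rn (V : completeNormedModType R[i]) (v : nat -> V) :
  (forall e : R, 0 < e -> exists N, forall m n, (N <= m)%N -> (N <= n)%N -> rn (v m - v n) <= e) ->
  exists l, forall e : R, 0 < e -> exists N, forall n, (N <= n)%N -> rn (v n - l) <= e.
Proof.
move=> h; have : cvg (v n @[n --> \oo]).
  apply: cauchy_cvg; apply: cauchy_exP => e e0; have [ee e1] := gt0_complex e0.
  have [|N hN] := h (Re e / 2); first by rewrite divr_gt0.
  exists (v N); exists N => // n /= Nn; rewrite ee; apply/ball_rn => //.
  by apply: le_lt_trans (hN _ _ (leqnn N) Nn) _; lra.
by move=> /cvg_ex[l /cvg_rnP hl]; exists l.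
Qed.

Lemma geometric_cauchy (V : normedModType R[i]) (v : nat -> V) (s : R) : 0 <= s -> s < 1 ->
  (forall n, rn (v n.+1 - v n) <= s ^+ n) ->
  forall e : R, 0 < e -> exists N, forall m n, (N <= m)%N -> (N <= n)%N -> rn (v m - v n) <= e.
Proof.
move=> s0 s1 hv e e0.
have d0 : 0 < 1 - s by lra.
have step n j : rn (v (n + j)%N - v n) <= s ^+ n / (1 - s) - s ^+ (n + j) / (1 - s).
  elim: j => [|j IH]; first by rewrite addn0 !subrr rn0.
  rewrite addnS; apply: le_trans (rn_dist _ (v (n + j)%N) _) _.
  have -> : s ^+ n / (1 - s) - s ^+ (n + j).+1 / (1 - s) =
      s ^+ (n + j) + (s ^+ n / (1 - s) - s ^+ (n + j) / (1 - s)).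
    by rewrite exprS; field; rewrite lt0r_neq0.
  exact: lerD.
have /cvgrPdist_le/(_ (e / 2 * (1 - s))) : (GRing.exp s : R ^nat) x @[x --> \oo] --> 0.
  by apply: cvg_expr; rewrite ger0_norm.
case; first by rewrite mulr_gt0// divr_gt0.
move=> N _ hN; exists N => m n Nm Nn.
have key k : (N <= k)%N -> rn (v k - v N) <= e / 2.
  move=> Nk; have := step N (k - N)%N; rewrite subnKC// => h; apply: le_trans h _.
  have := hN N (leqnn N); rewrite /= sub0r normrN ger0_norm ?exprn_ge0// => h1.
  have h2 : s ^+ N / (1 - s) <= e / 2 by rewrite ler_pdivrMr.
  have h3 : 0 <= s ^+ k / (1 - s) by rewrite divr_ge0 ?exprn_ge0// ltW.
  lra.
by apply: le_trans (rn_dist _ (v N) _) _; have := key _ Nm; have := key _ Nn; rewrite (rnBC (v n)); lra.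
Qed.

End RealNorm.

Section CstarContraction.
Variables (R : realType) (A : cstarType R).
Local Notation "x ** y" := (amul (x : A) y) (at level 40).
Local Notation star := (@Defs.adj R A).

Lemma amul_linl (z : A) : linear (fun x => x ** z).
Proof. by move=> a x y; rewrite amulDZl. Qed.
Lemma amul_linr (z : A) : linear (fun x => z ** x).
Proof. by move=> a x y; rewrite amulDZr. Qed.

Lemma rn_amul (x y : A) : rn (x ** y) <= rn x * rn y.
Proof. by rewrite -lecR rmorphM /= -!rnE norm_amul. Qed.

Lemma rn_star_sq (x : A) : rn (star x ** x) = rn x ^+ 2.
Proof. by apply: complexI; rewrite rmorphXn /= -!rnE norm_adjM. Qed.

Lemma rn_star (x : A) : rn (star x) = rn x.
Proof.
have h (y : A) : rn y <= rn (star y).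
  have [->|y0] := eqVneq (rn y) 0; first exact: rn_ge0.
  have yp : 0 < rn y by rewrite lt0r y0 rn_ge0.
  by rewrite -(ler_pM2r yp) -expr2 -rn_star_sq rn_amul.
by apply/eqP; rewrite eq_le h -{2}[x](@Defs.adjK R A) h.
Qed.

Lemma starB (x y : A) : star (x - y) = star x - star y.
Proof. by have := Defs.adjDZ (-1 : R[i]) y x; rewrite rmorphN rmorph1 !scaleN1r addrC => ->; rewrite addrC. Qed.

(** This is [1 - a = (1 - z)^2] written without a unit. The map sending [z] to [(a + z^2) / 2]
    preserves the ball of radius [rn a] and contracts it by the factor [rn a < 1]. *)
Lemma sqrt_one_minus_cstar (a : A) : star a = a -> rn a < 1 ->
  exists z, star z = z /\ a = 2 *: z - z ** z.
Proof.
move=> sa a1; pose s := rn a; have s0 : 0 <= s := rn_ge0 a.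
pose z := fix z n := if n is m.+1 then (2^-1)%:C *: (a + z m ** z m) else 0.
have half : cabs (2^-1 : R)%:C = 2^-1 by rewrite cabs_real ger0_norm.
have zs n : rn (z n) <= s.
  elim: n => [|n IH] /=; first by rewrite rn0.
  rewrite rnZ half; have := rnD a (z n ** z n); have := rn_amul (z n) (z n).
  have : rn (z n) * rn (z n) <= s * 1 by apply: ler_pM => //; [exact: rn_ge0..|apply: le_trans IH (ltW a1)].
  rewrite -/s; lra.
have sqd x y : rn x <= s -> rn y <= s -> rn (x ** x - y ** y) <= 2 * s * rn (x - y).
  move=> xs ys; have -> : x ** x - y ** y = x ** (x - y) + (x - y) ** y.
    by rewrite (linB _ _ (amul_linr x)) (linB _ _ (amul_linl y)) addrA subrK.
  apply: le_trans (rnD _ _) _; apply: le_trans (lerD (rn_amul _ _) (rn_amul _ _)) _.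
  have := rn_ge0 (x - y); nra.
have zd n : rn (z n.+1 - z n) <= s ^+ n.
  elim: n => [|n IH].
    rewrite expr0 /= subr0 (lin0 (amul_linl 0)) addr0 rnZ half -/s; lra.
  rewrite [z n.+2]/= [X in _ - X]/= -scalerBr rnZ half opprD addrACA subrr add0r exprS.
  have := sqd _ _ (zs n.+1) (zs n); have := ler_wpM2l s0 IH; lra.
have [l hl] := complete_rn (geometric_cauchy s0 a1 zd).
have ls : rn l <= s.
  apply/ler_addgt0Pl => e e0; have [N hN] := hl e e0.
  have := hN N (leqnn N); have := zs N; have := rn_dist l (z N) 0; rewrite !subr0 (rnBC l); lra.
have sz n : star (z n) = z n.
  elim: n => [|n IH] /=.
    by have := starB 0 0; rewrite !subrr.
  have := Defs.adjDZ ((2^-1)%:C : R[i]) (a + z n ** z n) 0; rewrite addr0 => ->.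
  have -> : star 0 = 0 :> A by have := starB 0 0; rewrite !subrr.
  have := Defs.adjDZ (1 : R[i]) a (z n ** z n); rewrite rmorph1 !scale1r => ->.
  by rewrite Defs.adjM IH sa addr0 conj_real.
exists l; split.
  apply/eqP; rewrite -subr_eq0; apply/eqP; apply: rn_le0 => e e0.
  have [|N hN] := hl (e / 2); first by rewrite divr_gt0.
  have := rn_dist (star l) (z N) l; rewrite -{1}(sz N) -starB rn_star (rnBC l) => h.
  by apply: le_trans h _; have := hN N (leqnn N); lra.
apply/eqP; rewrite -subr_eq0; apply/eqP; apply: rn_le0 => e e0.
have [|N hN] := hl (e / 4); first by rewrite divr_gt0.
have hz : a = 2 *: z N.+1 - z N ** z N.
  rewrite /= scalerA -(rmorph_nat (real_complex R)) -rmorphM /= mulfV// rmorph1 scale1r.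
  by rewrite addrK.
have -> : a - (2 *: l - l ** l) = 2 *: (z N.+1 - l) - (z N ** z N - l ** l).
  by rewrite {1}hz scalerBr !opprD !opprK addrACA.
apply: le_trans (rnB _ _) _; rewrite rnZ.
have -> : cabs 2 = 2 :> R by rewrite -(rmorph_nat (real_complex R)) cabs_real ger0_norm.
have h1 := hN N (leqnn N); have h2 := hN N.+1 (leqnSn N); have h3 := sqd _ _ (zs N) ls.
have h4 : s * rn (z N - l) <= 1 * rn (z N - l) by rewrite ler_wpM2r ?rn_ge0// ltW.
lra.
Qed.

End CstarContraction.

(** * Representations *)

Lemma frac_le (R : realType) (c t : R) : 0 <= c -> 0 <= t -> c * (t / (c + 1)) <= t.
Proof. by move=> c0 t0; rewrite mulrA ler_pdivrMr; [nra|lra]. Qed.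

Section HilbertSpaces.
Variables (R : realType) (H : hilbertType R).

Lemma inner_ge0 (x : H) : 0 <= inner x x.
Proof. by rewrite inner_norm exprn_ge0// normr_ge0. Qed.

Definition hilbert_ip : ipspace R := @IPSpace R H (@inner R H) innerDZl innerC inner_ge0.

Lemma nrm_rn (x : H) : nrm (x : hilbert_ip) = rn x.
Proof.
rewrite /nrm /nsq /= inner_norm rnE -rmorphXn /= sqrtr_sqr ger0_norm//; exact: rn_ge0.
Qed.

Lemma hilbert_definite (x : hilbert_ip) : nsq x = 0 -> x = 0.
Proof. by move=> h; apply: (@rn_eq0 R H); rewrite -nrm_rn /nrm h sqrtr0. Qed.

Lemma hilbert_complete (v : nat -> hilbert_ip) :
  (forall e : R, 0 < e -> exists N, forall m n, (N <= m)%N -> (N <= n)%N -> nrm (v m - v n) <= e) ->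
  exists l, forall e : R, 0 < e -> exists N, forall n, (N <= n)%N -> nrm (v n - l) <= e.
Proof.
move=> h; have [|l hl] := @complete_rn R H v.
  by move=> e /h[N hN]; exists N => m n Nm Nn; rewrite -nrm_rn; exact: hN.
by exists l => e /hl[N hN]; exists N => n Nn; rewrite nrm_rn; exact: hN.
Qed.

Definition hilbert : hspace R := HSpace hilbert_definite hilbert_complete.

Lemma mk_bounded (f : H -> H) (C : R) : linear f -> (forall x, rn (f x) <= C * rn x) ->
  exists T : boundedOp H, forall x, T x = f x.
Proof.
move=> lf fC; pose fl : {linear H -> H} := HB.pack f (GRing.isLinear.Build R[i] H H *:%R f lf).
have cf : continuous fl.
  move=> x P /nbhs_rnP[e e0 hP]; apply/nbhs_rnP.
  have C0 : 0 < `|C| + 1 by have := normr_ge0 C; lra.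
  exists (e / (`|C| + 1)); first by rewrite divr_gt0.
  move=> y hy; apply: hP; rewrite /= -(linB _ _ lf); apply: le_lt_trans (fC _) _.
  have : rn (x - y) * (`|C| + 1) < e by rewrite -ltr_pdivlMr.
  have : C * rn (x - y) <= `|C| * rn (x - y) by rewrite ler_wpM2r ?rn_ge0 ?ler_norm.
  have := rn_ge0 (x - y); lra.
by exists (BoundedOp cf).
Qed.

Lemma opnorm_bound (f : H -> H) (c : R) : 0 <= c -> (forall x, rn (f x) <= c * rn x) ->
  0 <= opnorm f <= c.
Proof.
move=> c0 fc; set S := [set Re `|f x| | x in [set x : H | `|x| <= 1]].
have Sc : ubound S c.
  move=> _ [x /= x1 <-]; apply: le_trans (fc x) _; rewrite -[leRHS]mulr1 ler_wpM2l//.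
  by rewrite -lecR -rnE.
have S0 : S (rn (f 0)) by exists 0 => //=; rewrite normr0.
apply/andP; split; last by apply: ge_sup => //; exists (rn (f 0)).
by apply: le_trans (rn_ge0 (f 0)) _; apply: ub_le_sup => //; exists c.
Qed.

Lemma precompact_proj (es : seq hilbert) : ons es ->
  @precompact H (proj es @` [set x : H | `|x| <= 1]).
Proof.
move=> oes.
pose l : seq H := flatten [seq [:: (e : H); (Complex 0 1 : R[i]) *: (e : H)] | e <- es].
apply: (@precompact_subset H _ (boxspan l)); last first.
  by apply: compact_precompact; [exact: norm_hausdorff|exact: boxspan_compact].
move=> _ [x /= x1 <-].
have x1' : nrm (x : hilbert) <= 1 by rewrite nrm_rn -lecR -rnE.
rewrite /proj /l {l}; elim: es oes => [_|e es IH /= [e1 _ /IH{}IH]] /=; first by rewrite big_nil.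
have e1' : ip e e = 1 := e1; have ne : nrm e = 1 by rewrite /nrm /nsq e1' sqrtr1.
have cx : cabs (ip (x : hilbert) e) <= 1.
  by apply: le_trans (cauchy_schwarz _ _) _; rewrite ne mulr1.
have Rc (z : R[i]) : cabs z <= 1 -> `|Re z| <= 1 /\ `|complex.Im z| <= 1.
  case: z => a b; rewrite /cabs normc_def /= => h.
  have h2 : a ^+ 2 + b ^+ 2 <= 1.
    by rewrite -(sqr_sqrtr (addr_ge0 (sqr_ge0 a) (sqr_ge0 b))) expr_le1 ?sqrtr_ge0.
  split; rewrite -(@expr_le1 _ 2)// real_normK ?num_real//.
    by apply: le_trans h2; rewrite lerDl sqr_ge0.
  by apply: le_trans h2; rewrite lerDr sqr_ge0.
have [r1 r2] := Rc _ cx.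
exists (Re (ip (x : hilbert) e), (complex.Im (ip (x : hilbert) e))%:C *: ((Complex 0 1 : R[i]) *: (e : H)) + \sum_(f <- es) ip (x : hilbert) f *: f).
  split => /=; first by rewrite in_itv /= -ler_norml.
  exists (complex.Im (ip (x : hilbert) e), \sum_(f <- es) ip (x : hilbert) f *: f) => //.
  by split => //=; rewrite in_itv /= -ler_norml.
rewrite big_cons /= addrA scalerA -scalerDl; congr (_ *: _ + _).
apply/eqP; rewrite eq_complex /=; by apply/andP; split; apply/eqP; ring.
Qed.

End HilbertSpaces.

Section Representations.
Variables (R : realType) (A : cstarType R) (H : hilbertType R) (sigma : representation A H).
Local Notation X := (hilbert H).
Local Notation "x ** y" := (amul (x : A) y) (at level 40).
Local Notation star := (@Defs.adj R A).

Lemma rep_lin v : linear (fun a => sigma a v).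
Proof. by move=> c a b; rewrite rep_linear. Qed.

Lemma op_lin a : linear (sigma a).
Proof. by move=> c x y; rewrite linearP. Qed.

Lemma rep_ip a (v w : X) : ip (sigma a v : X) w = ip v (sigma (star a) w : X).
Proof. exact: rep_adj. Qed.

(** Write [star a ** a = 2 z - z^2] with [z] self-adjoint and [w = sigma z v]. Then
    [|sigma a v|^2 = 2 Re <v, w> - |w|^2], and [|v - w|^2 >= 0] bounds this by [|v|^2]. *)
Lemma rep_contr_small a (v : H) : rn a < 1 -> rn (sigma a v) <= rn v.
Proof.
move=> a1; have [|//|z [sz az]] := @sqrt_one_minus_cstar R A (star a ** a).
- by rewrite Defs.adjM Defs.adjK.
- by rewrite rn_star_sq expr_lt1 ?rn_ge0.
rewrite -!nrm_rn -(@ler_pXn2r _ 2)// ?nnegrE ?nrm_ge0// !nrm2.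
pose w : X := sigma z v.
have -> : nsq (sigma a v : X) = 2 * Re (ip (v : X) w) - nsq w.
  rewrite {1}/nsq rep_ip -[X in ip _ X](rep_mul sigma) az (linB _ _ (rep_lin v)).
  rewrite (linZ _ _ (rep_lin v)) rep_mul ipBr ipZr ReB; congr (_ - _).
    by rewrite rmorph_nat -(rmorph_nat (real_complex R)) Re_realM.
  by rewrite /nsq {1}/w rep_ip sz.
have := nsq_ge0 ((v : X) - w); rewrite nsqB; lra.
Qed.

Lemma rep_contr a (v : H) : rn (sigma a v) <= rn a * rn v.
Proof.
apply/ler_addgt0Pl => e e0.
pose t := e / (rn v + 1); have v0 := rn_ge0 v; have vp : 0 < rn v + 1 by lra.
have t0 : 0 < t by rewrite divr_gt0.
pose c := rn a + t; have c0 : 0 < c by have := rn_ge0 a; rewrite /c; lra.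
have := @rep_contr_small ((c^-1)%:C *: a) v.
rewrite (linZ _ _ (rep_lin v)) !rnZ cabs_real ger0_norm ?invr_ge0 ?(ltW c0)//.
rewrite ltr_pdivrMl// mulr1 ler_pdivrMl// => h.
apply: le_trans (h _) _; first by rewrite /c; lra.
rewrite /c mulrDl addrC lerD2r /t mulrAC ler_pdivrMr//; nra.
Qed.

Section GroupAction.
Variables (Gamma : groupType) (u : Gamma -> A).
Hypothesis uM : forall g k, u (g * k)%g = u g ** u k.
Hypothesis uV : forall g, u (g^-1)%g = star (u g).
Variables (d : nat) (h : heis d -> Gamma).
Hypothesis hM : forall g k, h (hmul g k) = (h g * h k)%g.

Lemma h_inv g : h (hinv g) = (h g)^-1%g.
Proof.
have h1 : h hone = 1%g.
  by have := hM hone hone; rewrite hmul1 -{1}[h hone]mulg1 => /mulgI.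
by apply/esym/mulg1_eq; rewrite -hM hmulV.
Qed.

Definition heis_act (g : heis d) (x : X) : X := sigma (u (h g)) x.

Lemma heis_act_linear g : linear (heis_act g).
Proof. exact: op_lin. Qed.

Lemma heis_actM g k x : heis_act (hmul g k) x = heis_act g (heis_act k x).
Proof. by rewrite /heis_act hM uM rep_mul. Qed.

Lemma heis_act_adj g x y : ip (heis_act g x) y = ip x (heis_act (hinv g) y).
Proof. by rewrite /heis_act rep_ip h_inv uV. Qed.

Definition heis_rep : hrep d X := HRep heis_act_linear heis_actM heis_act_adj.

End GroupAction.

Section AlmostCommuting.
Variable P : nat -> X -> X.
Hypothesis lP : forall n, linear (P n).
Hypothesis P1 : forall n x, nrm (P n x) <= nrm x.
Hypothesis Pself : forall n x y, ip (P n x) y = ip x (P n y).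

(** Asymptotic commutation in operator norm; such elements form a closed star-subalgebra. *)
Definition acomm (a : A) := forall e : R, 0 < e -> exists N, forall n, (N <= n)%N ->
  forall x : X, nrm (P n (sigma a x) - (sigma a (P n x) : X)) <= e * nrm x.

Lemma sigma_nrm a x : nrm (sigma a x : X) <= rn a * nrm (x : X).
Proof. by rewrite !nrm_rn rep_contr. Qed.

Lemma acommD c a b : acomm a -> acomm b -> acomm (c *: a + b).
Proof.
move=> ha hb e e0; have c0 := cabs_ge0 c; have cp : 0 < cabs c + 1 by lra.
have [|N hN] := ha (e / 2 / (cabs c + 1)); first by rewrite !divr_gt0.
have [|N' hN'] := hb (e / 2); first by rewrite divr_gt0.
exists (maxn N N') => n; rewrite geq_max => /andP[/hN h1 /hN' h2] x.
have -> : P n (sigma (c *: a + b) x) - (sigma (c *: a + b) (P n x) : X) =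
    c *: (P n (sigma a x) - (sigma a (P n x) : X)) + (P n (sigma b x) - (sigma b (P n x) : X)).
  rewrite !(rep_lin _ c a b) (lP n c) scalerBr opprD addrACA; congr (_ - _ + _).
apply: le_trans (nrm_triangle _ _) _; rewrite nrmZ.
have h3 : cabs c * nrm (P n (sigma a x) - (sigma a (P n x) : X)) <= e / 2 * nrm x.
  apply: le_trans (ler_wpM2l c0 (h1 x)) _; rewrite mulrA; apply: ler_wpM2r; first exact: nrm_ge0.
  by apply: frac_le => //; lra.
have := h2 x; lra.
Qed.

Lemma acommM a b : acomm a -> acomm b -> acomm (a ** b).
Proof.
move=> ha hb e e0; have a0 := rn_ge0 a; have b0 := rn_ge0 b.
have [|N hN] := ha (e / 2 / (rn b + 1)); first by rewrite !divr_gt0//; lra.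
have [|N' hN'] := hb (e / 2 / (rn a + 1)); first by rewrite !divr_gt0//; lra.
exists (maxn N N') => n; rewrite geq_max => /andP[/hN h1 /hN' h2] x.
rewrite !rep_mul.
have -> : P n (sigma a (sigma b x)) - (sigma a (sigma b (P n x)) : X) =
    (P n (sigma a (sigma b x)) - (sigma a (P n (sigma b x)) : X)) +
    (sigma a (P n (sigma b x) - (sigma b (P n x) : X)) : X).
  by rewrite (linB _ _ (op_lin a)) addrA subrK.
apply: le_trans (nrm_triangle _ _) _.
have k1 : nrm (P n (sigma a (sigma b x)) - (sigma a (P n (sigma b x)) : X)) <= e / 2 * nrm x.
  apply: le_trans (h1 _) _; apply: le_trans (ler_wpM2l _ (sigma_nrm b x)) _.
    by rewrite ltW// !divr_gt0//; lra.
  by rewrite mulrCA mulrA; apply: ler_wpM2r; [exact: nrm_ge0|apply: frac_le => //; lra].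
have k2 : nrm (sigma a (P n (sigma b x) - (sigma b (P n x) : X)) : X) <= e / 2 * nrm x.
  apply: le_trans (sigma_nrm _ _) _; apply: le_trans (ler_wpM2l a0 (h2 x)) _.
  by rewrite mulrA; apply: ler_wpM2r; [exact: nrm_ge0|apply: frac_le => //; lra].
lra.
Qed.

Lemma acomm_star a : acomm a -> acomm (star a).
Proof.
move=> ha e e0; have [N hN] := ha e e0; exists N => n /hN h x.
apply: nrm_le_of_ip; first by rewrite mulr_ge0 ?nrm_ge0// ltW.
move=> y; have -> : ip (P n (sigma (star a) x) - (sigma (star a) (P n x) : X)) y =
    - ip x (P n (sigma a y) - (sigma a (P n y) : X)).
  rewrite ipBl ipBr Pself rep_ip Defs.adjK rep_ip Defs.adjK Pself opprB; congr (_ - _).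
rewrite -ipNr; apply: le_trans (Re_ip_le _ _) _; rewrite nrmN.
by rewrite [leRHS]mulrAC mulrC ler_wpM2r ?nrm_ge0.
Qed.

Lemma acomm_closed a : (forall e : R, 0 < e -> exists2 b, acomm b & rn (a - b) <= e) -> acomm a.
Proof.
move=> ha e e0; have e40 : 0 < e / 4 by rewrite divr_gt0.
have [b hb ab] := ha _ e40; have [|N hN] := hb (e / 4) => //; exists N => n /hN h x.
have -> : P n (sigma a x) - (sigma a (P n x) : X) = (P n (sigma b x) - (sigma b (P n x) : X)) +
    (P n (sigma (a - b) x) - (sigma (a - b) (P n x) : X)).
  have E v : sigma a v = sigma b v + sigma (a - b) v.
    by rewrite (linB _ _ (rep_lin v)) addrC subrK.
  by rewrite !E (linD _ _ (lP n)) opprD addrACA.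
have k (x' : X) : nrm (sigma (a - b) x' : X) <= e / 4 * nrm x'.
  by apply: le_trans (sigma_nrm _ _) _; rewrite ler_wpM2r ?nrm_ge0.
apply: le_trans (nrm_triangle _ _) _; have := h x.
have := nrm_triangleB (P n (sigma (a - b) x)) (sigma (a - b) (P n x) : X).
have := le_trans (P1 n _) (k x); have := k (P n x); have := ler_wpM2l (ltW e40) (P1 n x).
have := mulr_ge0 (ltW e0) (nrm_ge0 x); lra.
Qed.

End AlmostCommuting.

End Representations.

Lemma cabs_le_ReIm (R : realType) (z : R[i]) : cabs z <= `|Re z| + `|complex.Im z|.
Proof.
case: z => a b; rewrite /cabs normc_def /=.
rewrite -(@ler_pXn2r _ 2)// ?nnegrE ?sqrtr_ge0 ?addr_ge0// sqr_sqrtr ?addr_ge0 ?sqr_ge0//.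
by rewrite sqrrD !real_normK ?num_real// -addrA [_ *+ 2 + _]addrC addrA lerDl mulrn_wge0// mulr_ge0.
Qed.

Lemma rat_approx (R : realType) (z : R[i]) (t : R) : 0 < t ->
  exists q : rat * rat, cabs (z - Complex (ratr q.1) (ratr q.2)) <= t.
Proof.
move=> t0; have real_approx (a : R) : exists q : rat, `|a - ratr q| <= t / 2.
  have [|q] := @rat_in_itvoo R (a - t / 2) (a + t / 2); first by lra.
  by rewrite in_itv /= => /andP[h1 h2]; exists q; rewrite ler_norml; apply/andP; split; lra.
have [q1 h1] := real_approx (Re z); have [q2 h2] := real_approx (complex.Im z).
exists (q1, q2); apply: le_trans (cabs_le_ReIm _) _.
by case: z h1 h2 => a b /= h1 h2; lra.
Qed.

(** * Separability of the algebra and of its images *)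

Section Separability.
Variables (R : realType) (A : cstarType R) (Gamma : groupType) (u : Gamma -> A).
Hypothesis u_dense : dense (range (lin_ext u)).
Variables (C : countType) (h : C -> Gamma).
Hypothesis h_surj : forall x, exists c, h c = x.

Definition rat_comb (l : seq (rat * rat * C)) : A :=
  \sum_(t <- l) (Complex (ratr t.1.1) (ratr t.1.2) : R[i]) *: u (h t.2).

Lemma rat_comb_approx a (e : R) : 0 < e -> exists l, rn (a - rat_comb l) <= e.
Proof.
pose App b := forall e : R, 0 < e -> exists l, rn (b - rat_comb l) <= e.
have App0 : App 0.
  by move=> t t0; exists [::]; rewrite /rat_comb big_nil subrr rn0 ltW.
have AppS c g b : App b -> App (c *: u g + b).
  move=> hb t t0; have g0 := rn_ge0 (u g); have [k hk] := h_surj g.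
  have [|l hl] := hb (t / 2); first by rewrite divr_gt0.
  have [|q hq] := @rat_approx R c (t / 2 / (rn (u g) + 1)); first by rewrite !divr_gt0//; lra.
  exists ((q.1, q.2, k) :: l); rewrite /rat_comb big_cons /= hk -/(rat_comb l).
  rewrite opprD addrACA -scalerBl; apply: le_trans (rnD _ _) _; rewrite rnZ.
  have : cabs (c - Complex (ratr q.1) (ratr q.2)) * rn (u g) <= t / 2.
    apply: le_trans (ler_wpM2r g0 hq) _; rewrite mulrC; apply: frac_le => //; lra.
  by move: hl; lra.
have AppL f : App (lin_ext u f) by apply: (big_rec App) => // g b _; exact: AppS.
move=> e0; have /dense_rnP h1 := u_dense.
have [|_ [f _ <-] hf] := h1 a (e / 2); first by rewrite divr_gt0.
have [|l hl] := AppL f (e / 2); first by rewrite divr_gt0.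
by exists l; apply: le_trans (rn_dist _ (lin_ext u f) _) _; lra.
Qed.

Lemma rat_comb_countable : countable (range rat_comb).
Proof. exact: sub_countable (card_image_le _ _) (countableP _). Qed.

Lemma cstar_separable : separable A.
Proof.
exists (range rat_comb); split; first exact: rat_comb_countable.
apply/dense_rnP => a e e0; have [l hl] := rat_comb_approx a e0.
by exists (rat_comb l) => //; exists l.
Qed.

Lemma rep_separable (H : hilbertType R) (sigma : representation A H) :
  separable_ops (range sigma).
Proof.
exists (sigma @` range rat_comb); split.
- exact: sub_countable (card_image_le _ _) rat_comb_countable.
- by move=> _ [a _ <-]; exists a.
- move=> _ [a _ <-] e e0; have [|l hl] := @rat_comb_approx a (e / 2); first by rewrite divr_gt0.
  exists (sigma (rat_comb l)); first by exists (rat_comb l) => //; exists l.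
  have /andP[_ h1] : 0 <= opnorm (fun x => sigma a x - sigma (rat_comb l) x) <= e / 2.
    apply: opnorm_bound => [|x]; first by rewrite divr_ge0// ltW.
    rewrite -(linB _ _ (rep_lin sigma x)); apply: le_trans (rep_contr _ _ _) _.
    by rewrite ler_wpM2r ?rn_ge0.
  by apply: le_lt_trans h1 _; lra.
Qed.

End Separability.

Lemma separable_enum (R : realType) (V : normedModType R[i]) : separable V ->
  exists x : nat -> V, forall y (e : R), 0 < e -> exists n, rn (y - x n) <= e.
Proof.
move=> [D [/countable_injP[f finj] /dense_rnP dD]].
have : forall n, exists y : V, forall z, D z -> f z = n -> y = z.
  move=> n; have [[z [Dz fz]]|nz] := pselect (exists z, D z /\ f z = n).
    exists z => w Dw fw; apply: finj; rewrite ?inE//; exact: etrans fz (esym fw).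
  by exists 0 => z Dz fz; case: nz; exists z.
case/choice => x hx; exists x => y e /(dD y)[z Dz hz].
by exists (f z); rewrite (hx _ z).
Qed.

(** The projections onto the spaces of [filtration] along a dense sequence increase and tend
    strongly to 1. They asymptotically commute with the images of the generators of [heis d], hence
    with every [u g] by the induction principle for Gamma, and with all of [A] by density. *)
Lemma rep_quasidiagonal (R : realType) (Gamma : groupType) (A : cstarType R) (u : Gamma -> A) d
    (h : heis d -> Gamma) (H : hilbertType R) (sigma : representation A H) :
  (forall g k, u (g * k)%g = amul (u g) (u k)) -> (forall g, u (g^-1)%g = Defs.adj (u g)) ->
  dense (range (lin_ext u)) -> (forall g k, h (hmul g k) = (h g * h k)%g) ->
  (forall Q : Gamma -> Prop, (forall x y, Q x -> Q y -> Q (x * y)%g) ->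
     (forall x, Q x -> Q (x^-1)%g) -> (forall i, Q (h (delta_mx 0 i, 0))) -> forall x, Q x) ->
  separable H -> exists P : nat -> boundedOp H,
  [/\ forall n, [/\ compact_op (P n), self_adjoint (P n) & projection (P n)],
      forall m n, (m <= n)%N -> op_le (P m) (P n),
      forall x, P n x @[n --> \oo] --> x &
      forall T, range sigma T ->
        opnorm (fun x => P n (T x) - T (P n x)) @[n --> \oo] --> (0 : R)].
Proof.
move=> uM uV u_dense hM hind /separable_enum[x hx].
pose X := hilbert H; pose p : hrep d X := heis_rep sigma uM uV hM.
have [L [oL SL xL aL]] := filtration p x.
have Lle m n y : (m <= n)%N -> span (L m) y -> span (L n) y.
  by move=> /subnK <-; elim: (n - m)%N => [//|k IH] /IH; rewrite addSn; exact: SL.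
pose P0 n : X -> X := proj (L n).
have lP n : linear (P0 n) := proj_linear (L n).
have nP n (y : X) : nrm (P0 n y) <= nrm y by exact: nrm_proj.
have sP n (y z : X) : ip (P0 n y) z = ip y (P0 n z) by exact: proj_self.
have : forall n, exists T : boundedOp H, forall y, T y = P0 n y.
  by move=> n; apply: (mk_bounded (C := 1) (lP n)) => y; rewrite mul1r -!nrm_rn; exact: nP.
case/choice => P hP; exists P.
have qform n (y : H) : inner (P n y) y = (nsq (P0 n y))%:C.
  by rewrite hP -ipxx sP /P0 proj_idem// -sP.
split.
- move=> n; split.
  + have := precompact_proj (oL n); rewrite /compact_op; congr precompact.
    by apply/seteqP; split=> _ [y hy <-]; exists y => //; rewrite hP.
  + by move=> y z; rewrite !hP; exact: sP.
  + by move=> y; rewrite !hP; exact: (@proj_idem R X (L n) y (oL n)).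
- move=> m n mn y; rewrite !qform lecR.
  have h1 : nrm ((y : X) - P0 n y) <= nrm ((y : X) - P0 m y).
    by apply: proj_nearest => //; apply: Lle mn _; exact: proj_span.
  have := nsq_projD (y : X) (oL n); rewrite (nsq_projD (y : X) (oL m)).
  move: h1; rewrite nrm_leP ?nrm_ge0// nrm2 /P0; lra.
- move=> y; apply/cvg_rnP => e e0; have [k hk] := hx y e e0.
  exists k.+1 => n kn; rewrite rnBC hP -(@nrm_rn R H).
  apply: le_trans (proj_nearest _ (oL n) (Lle _ _ _ kn (xL k))) _.
  by rewrite nrm_rn.
have acL : forall a, acomm sigma P0 a.
  have acu g : acomm sigma P0 (u g).
    apply: (hind (fun g => acomm sigma P0 (u g))) => [g1 g2 h1 h2|g1 h1|i].
    - by rewrite uM; exact: acommM.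
    - by rewrite uV; exact: acomm_star.
    - move=> e e0; pose N := Num.truncn (2 / e).
      (* The bound [1 / (n + 1)] on almost invariance belongs to [L n.+1], so the index 0 is left
         out. *)
      exists N.+1 => -[//|n] Nn y.
      have gu : (delta_mx 0 i, 0) \in usteps d.
        by rewrite mem_cat; apply/orP; left; apply: map_f; rewrite mem_enum.
      have n0 : 0 <= n.+1%:R^-1 :> R by rewrite invr_ge0.
      apply: le_trans (ainv_commutator (p := p) y (oL _) n0 (aL n) gu) _.
      rewrite ler_wpM2r ?nrm_ge0// ler_pdivrMr// mulrC -ler_pdivrMr//.
      by apply: ltW; apply: lt_le_trans (truncnS_gt _) _; rewrite ler_nat.
  have ac0 : acomm sigma P0 0.
    by have := acommD lP (-1) (acu 1%g) (acu 1%g); rewrite scaleN1r addNr.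
  have acf f : acomm sigma P0 (lin_ext u f).
    by apply: (big_rec (acomm sigma P0)) => // g b _ hb; apply: acommD.
  move=> a; apply: acomm_closed => // e e0.
  have /dense_rnP/(_ a e e0)[_ [f _ <-] hf] := u_dense.
  by exists (lin_ext u f).
move=> _ [a _ <-]; apply/cvgrPdist_le => e e0; have [N hN] := acL a e e0.
exists N => // n /= /hN h1; rewrite sub0r normrN.
have /andP[h2 h3] : 0 <= opnorm (fun y => P n (sigma a y) - sigma a (P n y)) <= e.
  by apply: opnorm_bound => [|y]; [exact: ltW|rewrite !hP -!nrm_rn; exact: h1].
by rewrite ger0_norm.
Qed.

Theorem proposition3p9 (R : realType) (Gamma : groupType)
    (Delta : groupClosed Gamma) (Delta_central : central Delta)
    (Delta_fg : finitely_generated [set` Delta])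
    (Delta_abelian : abelian [set` Delta])
    (quotient_fg :
      finitely_generated [set: quotient (central_normal Delta_central)])
    (quotient_abelian : abelian [set: quotient (central_normal Delta_central)])
    (A : cstarType R) (u : Gamma -> A)
    (A_full : is_full_group_cstar u) :
  strongly_quasidiagonal A.
Proof.
have [uM uV _ u_dense] := A_full.
have [d [h [hM hind]]] := heis_cover Delta_fg quotient_fg quotient_abelian.
(* Gamma is the image of a countable type, which yields both separability claims. *)
have h_surj x : exists g : 'rV[int]_d * 'M[int]_d, h g = x.
  apply: (hind (fun x => exists g, h g = x)) => [_ _ [g <-] [k <-]|_ [g <-]|i].
  - by exists (hmul g k).
  - by exists (hinv g); exact: h_inv.
  - by exists (delta_mx 0 i, 0).
split; first exact: (@cstar_separable R A Gamma u u_dense ('rV[int]_d * 'M[int]_d)%type h h_surj).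
move=> H sigma sepH; split=> //; first exact: (@rep_separable R A Gamma u u_dense ('rV[int]_d * 'M[int]_d)%type h h_surj).
exact: (rep_quasidiagonal sigma uM uV u_dense hM hind sepH).
Qed.
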